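(* Let $\mu$ be a finite positive Borel measure on $[0,1)$ and $-1<\alpha<0$. If $\mu$ is a Carleson measure then the operator $\mathcal H_\mu$ is a bounded operator from $\mathcal D^1_\alpha$ to itself.
   Context: $\mathbb D$ is the open unit disc in $\mathbb C$ and $dA=\frac1\pi\,dx\,dy$ is normalized area measure on $\mathbb D$. For $\alpha>-1$, the space of Dirichlet type $\mathcal D^1_\alpha$ consists of all analytic $f$ in $\mathbb D$ with $$\|f\|_{\mathcal D^1_\alpha}=|f(0)|+(\alpha+1)\int_{\mathbb D}(1-|z|^2)^\alpha|f'(z)|\,dA(z)<\infty.$$ For a finite positive Borel measure $\mu$ on $[0,1)$ and $n\ge 0$, let $\mu_n=\int_{[0,1)}t^n\,d\mu(t)$. For $f(z)=\sum_{k\ge0}a_kz^k$ analytic in $\mathbb D$, define formally $$\mathcal H_\mu f(z)=\sum_{n=0}^\infty\Big(\sum_{k=0}^\infty \mu_{n+k}a_k\Big)z^n,\quad z\in\mathbb D;$$ $\mathcal H_\mu f$ is well defined if the inner series converge and the resulting power series defines an analytic function in $\mathbb D$. Boundedness on a space includes that $\mathcal H_\mu f$ is well defined for every $f$ in the space. $\mu$ is a Carleson measure if there is a constant $C>0$ such that $\mu([t,1))\le C(1-t)$ for all $0\le t<1$. *)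

(* Defs.v *)
From HB Require Import structures.
From mathcomp Require Import all_boot all_order all_algebra.
From mathcomp Require Import complex.
From mathcomp Require Import all_classical all_reals all_analysis.

Set Implicit Arguments.
Unset Strict Implicit.
Unset Printing Implicit Defensive.

Import Order.TTheory GRing.Theory Num.Theory.
Import numFieldNormedType.Exports.

Local Open Scope classical_set_scope.
Local Open Scope ring_scope.

(* R[i] packaged as a numFieldType, so that its topology, and with it limits
   and the complex derivative derive1, are inferred from that structure. *)
Definition cplx (R : realType) : numFieldType := R[i]%C.

(* The norm `|z| of R[i] is R[i]-valued; cmod is the same modulus in R. *)
Definition cmod (R : realType) (z : cplx R) : R := complex.Re (`|z| : cplx R).

Definition ofreal (R : realType) (x : R) : cplx R := x%:C%C.

(* f(z) = sum_k a_k z^k on the unit disc, i.e. f is analytic there with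
   Taylor coefficients a_k (they are determined by f). *)
Definition has_taylor (R : realType) (f : cplx R -> cplx R) (a : nat -> cplx R)
    : Prop :=
  forall z : cplx R, cmod z < 1 -> [series a k * z ^+ k]_k @ \oo --> f z.

Definition analytic_disc (R : realType) (f : cplx R -> cplx R) : Prop :=
  exists a, has_taylor f a.

Definition disc (R : realType) : set (R * R) :=
  [set p | p.1 ^+ 2 + p.2 ^+ 2 < 1].

(* The factor pi^-1 normalizes planar Lebesgue measure to the disc. *)
Definition D1_norm (R : realType) (alpha : R) (f : cplx R -> cplx R) : \bar R :=
  ((cmod (f 0))%:E + ((alpha + 1) / pi)%:E *
    \int[@lebesgue_measure R \x @lebesgue_measure R]_(p in @disc R)
      ((1 - (p.1 ^+ 2 + p.2 ^+ 2)) `^ alpha *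
        cmod (derive1 f (p.1 +i* p.2)%C))%:E)%E.

Definition D1_space (R : realType) (alpha : R) : set (cplx R -> cplx R) :=
  [set f | analytic_disc f /\ (D1_norm alpha f < +oo)%E].

Definition moment (R : realType) (mu : {finite_measure set R -> \bar R})
    (n : nat) : R :=
  \int[mu]_(t in `[0, 1[) (t ^+ n).

Definition carleson (R : realType) (mu : {finite_measure set R -> \bar R})
    : Prop :=
  exists C : R, 0 < C /\
    forall t : R, 0 <= t < 1 -> (mu `[t, 1%R[%classic <= (C * (1 - t))%:E)%E.

Section hankel.
Context (R : realType) (mu : {finite_measure set R -> \bar R}).

Definition hankel_series (a : nat -> cplx R) (n : nat) : nat -> cplx R :=
  [series ofreal (moment mu (n + k)) * a k]_k.

Definition hankel_coef (a : nat -> cplx R) (n : nat) : cplx R :=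
  limn (hankel_series a n).

(* The operator acts on f through its Taylor coefficients a. *)
Definition hankel (a : nat -> cplx R) (z : cplx R) : cplx R :=
  limn [series hankel_coef a n * z ^+ n]_n.

Definition hankel_well_defined (a : nat -> cplx R) : Prop :=
  (forall n, cvgn (hankel_series a n)) /\
  has_taylor (hankel a) (hankel_coef a).

Definition hankel_bounded_D1 (alpha : R) : Prop :=
  exists C : R, 0 <= C /\
    forall (f : cplx R -> cplx R) (a : nat -> cplx R),
      D1_space alpha f -> has_taylor f a ->
      [/\ hankel_well_defined a,
          D1_space alpha (hankel a) &
          (D1_norm alpha (hankel a) <= C%:E * D1_norm alpha f)%E].

End hankel.

(* Main.v *)
(* The n-th coefficient of H_mu f is the integral of t^n f(t) over mu, so
   (H_mu f)'(z) is the integral of t f(t) / (1 - t z)^2 and Tonelli's theorem bounds the Dirichlet integral of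
   H_mu f by a constant times the integral over mu of |f(t)| J(t), where J(t)
   is the integral over the disc of (1 - |z|^2)^alpha / |1 - t z|^2.  Averaging
   the kernel over N-th roots of unity and decomposing the disc into dyadic
   annuli gives J(t) <= K (1 - t)^alpha.

   It remains to integrate |f(t)| (1 - t)^alpha over mu.  Bound |f(t)| by
   |f(0)| plus the integral of |f'| over [0, t], and exchange integrals: the
   Carleson condition says that the (1 - t)^alpha mu(dt)-mass of [s, 1) is
   O((1 - s)^(alpha + 1)).  The resulting radial integral of
   |f'(s)| (1 - s)^(alpha + 1) is dominated by the area integral through the
   sub-mean-value property of |f'| on the disc of centre s and radius
   (1 - s) / 2.

   The inner series converge absolutely because mean values on an annulus give
   |a_k| = O(k^alpha), while mu_k = O(k^-b) for every b < 1.

   Circle averages are only taken over roots of unity, so no contour integral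
   is needed: the rotation invariance of planar Lebesgue measure, obtained from
   shears, does the rest. *)
Require Import Defs.
From HB Require Import structures.
From mathcomp Require Import all_boot all_order all_algebra.
From mathcomp Require Import complex.
From mathcomp Require Import all_classical all_reals all_analysis.
From mathcomp Require Import measurable_realfun.
From mathcomp Require Import ring lra zify.

Set Implicit Arguments.
Unset Strict Implicit.
Unset Printing Implicit Defensive.

Import Order.TTheory GRing.Theory Num.Theory.
Import numFieldNormedType.Exports.

Local Open Scope classical_set_scope.
Local Open Scope ring_scope.

(** * The modulus of complex numbers as a real-valued function *)

Section cplx_modulus.
Context {R : realType}.
Implicit Types (x y z w : cplx R) (a b : R).

(** No complex-valued integral is ever formed. Combinations of moments are compared with integrals
    of moduli for finite sums only, separately in real and imaginary parts, which costs a factor 2;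
    limits are then taken in inequalities between nonnegative integrals. Mean values are treated
    alike: each inequality is proved for polynomials, where an average over N-th roots of unity with
    N above the degree is exact, and is passed on by uniform approximation on smaller discs.

    The range of [alpha] enters at both ends of the dyadic sums. Near the circle, [alpha > -1] makes
    the sums for (1 - |z|^2)^alpha converge; farther inside, the averaged kernel is at most a
    multiple of 1 / (1 - |z|^2), and [alpha < 0] makes those for (1 - |z|^2)^(alpha - 1) converge.
    The ranges are separated at 1 - |z|^2 = 1 - t. These sums are estimated once, for an abstract
    measure and an abstract distance to the boundary, and then used for area on the disc and for
    [mu] on [0, 1).

    The inner series need the exponent b = 1 + alpha / 2: it is below 1, and k^(alpha - b) is still
    summable. *)

Lemma norm_cplx z : `|z| = ofreal (cmod z).
Proof. by rewrite /cmod normc_def. Qed.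

Lemma cmodE z : cmod z = Num.sqrt (complex.Re z ^+ 2 + complex.Im z ^+ 2).
Proof. by rewrite /cmod normc_def. Qed.

Lemma cmod_ge0 z : 0 <= cmod z.
Proof. by rewrite cmodE sqrtr_ge0. Qed.

Lemma cmod_sqr z : cmod z ^+ 2 = complex.Re z ^+ 2 + complex.Im z ^+ 2.
Proof. by rewrite cmodE sqr_sqrtr// addr_ge0// sqr_ge0. Qed.

Lemma cmodM z w : cmod (z * w) = cmod z * cmod w.
Proof. by rewrite /cmod normrM !normc_def /= mul0r subr0. Qed.

Lemma cmodD z w : cmod (z + w) <= cmod z + cmod w.
Proof.
have := ler_normD z w.
by rewrite !norm_cplx lecE => /andP[_].
Qed.

Lemma cmodN z : cmod (- z) = cmod z.
Proof. by rewrite /cmod normrN. Qed.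

Lemma cmodC z w : cmod (z - w) = cmod (w - z).
Proof. by rewrite /cmod distrC. Qed.

Lemma cmodB z w : cmod (z - w) <= cmod z + cmod w.
Proof. by rewrite -(cmodN w); exact: cmodD. Qed.

Lemma cmod_triangle z w : cmod z <= cmod w + cmod (z - w).
Proof. by rewrite -[in leLHS](addrNK w z) addrC; exact: cmodD. Qed.

Lemma cmod0 : cmod (0 : cplx R) = 0.
Proof. by rewrite /cmod normr0. Qed.

Lemma cmod1 : cmod (1 : cplx R) = 1.
Proof. by rewrite /cmod normr1. Qed.

Lemma cmodX z n : cmod (z ^+ n) = cmod z ^+ n.
Proof. by elim: n => [|n IH]; rewrite ?expr0 ?cmod1// !exprS cmodM IH. Qed.

Lemma cmod_eq0 z : (cmod z == 0) = (z == 0).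
Proof.
apply/eqP/eqP => [z0|->]; last exact: cmod0.
by apply/eqP; rewrite -normr_eq0 norm_cplx z0.
Qed.

Lemma cmodV z : cmod z^-1 = (cmod z)^-1.
Proof.
have [->|z0] := eqVneq z 0; first by rewrite invr0 cmod0 invr0.
have : cmod (z * z^-1) = 1 by rewrite divff// cmod1.
rewrite cmodM => h; have c0 : cmod z != 0 by rewrite cmod_eq0.
by apply: (mulfI c0); rewrite h divff.
Qed.

Lemma cmod_real a : cmod (ofreal a) = `|a|.
Proof. by rewrite cmodE /= expr0n /= addr0 sqrtr_sqr. Qed.

Lemma cmod_nat n : cmod (n%:R : cplx R) = n%:R.
Proof.
rewrite -[RHS]normr_nat -cmod_real; congr cmod.
by rewrite /ofreal; exact/esym/(rmorph_nat (real_complex R)).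
Qed.

Lemma normRe_le z : `|complex.Re z| <= cmod z.
Proof. by rewrite cmodE -sqrtr_sqr ler_wsqrtr// lerDl sqr_ge0. Qed.

Lemma normIm_le z : `|complex.Im z| <= cmod z.
Proof. by rewrite cmodE -sqrtr_sqr ler_wsqrtr// lerDr sqr_ge0. Qed.

Lemma cmod_leReIm z : cmod z <= `|complex.Re z| + `|complex.Im z|.
Proof.
rewrite -ler_sqr ?nnegrE ?cmod_ge0 ?addr_ge0// cmod_sqr.
rewrite -[complex.Re z ^+ 2]real_normK ?num_real//.
rewrite -[complex.Im z ^+ 2]real_normK ?num_real//.
by rewrite sqrrD lerD2r lerDl mulrn_wge0// mulr_ge0.
Qed.

Lemma cmod_sum I (r : seq I) (P : pred I) (F : I -> cplx R) :
  cmod (\sum_(i <- r | P i) F i) <= \sum_(i <- r | P i) cmod (F i).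
Proof.
elim/big_ind2 : _ => //; first by rewrite cmod0.
by move=> x a y b xa yb; apply: le_trans (cmodD _ _) _; exact: lerD.
Qed.

Lemma ReD z w : complex.Re (z + w) = complex.Re z + complex.Re w.
Proof. by case: z w => [? ?] []. Qed.

Lemma ImD z w : complex.Im (z + w) = complex.Im z + complex.Im w.
Proof. by case: z w => [? ?] []. Qed.

Lemma ReN z : complex.Re (- z) = - complex.Re z.
Proof. by case: z. Qed.

Lemma ImN z : complex.Im (- z) = - complex.Im z.
Proof. by case: z. Qed.

Lemma ReM z w : complex.Re (z * w) =
  complex.Re z * complex.Re w - complex.Im z * complex.Im w.
Proof. by case: z w => [? ?] []. Qed.

Lemma ImM z w : complex.Im (z * w) =
  complex.Re z * complex.Im w + complex.Im z * complex.Re w.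
Proof. by case: z w => [? ?] []. Qed.

Lemma ReZ a z : complex.Re (ofreal a * z) = a * complex.Re z.
Proof. by rewrite ReM /= mul0r subr0. Qed.

Lemma ImZ a z : complex.Im (ofreal a * z) = a * complex.Im z.
Proof. by rewrite ImM /= mul0r addr0. Qed.

Lemma ofrealB a b : ofreal (a - b) = ofreal a - ofreal b.
Proof. exact: (rmorphB (real_complex R)). Qed.

Lemma ofrealM a b : ofreal (a * b) = ofreal a * ofreal b.
Proof. exact: (rmorphM (real_complex R)). Qed.

Lemma ofrealX a n : ofreal (a ^+ n) = ofreal a ^+ n.
Proof. exact: (rmorphXn (real_complex R)). Qed.

Lemma cmod_real_lt1 a : 0 <= a < 1 -> cmod (ofreal a) < 1.
Proof. by move=> /andP[a0 a1]; rewrite cmod_real ger0_norm. Qed.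

End cplx_modulus.

(** * Complex limits and series reduced to real ones *)

Section cplx_limits.
Context {R : realType}.
Implicit Types (u v : nat -> cplx R) (l : cplx R).

(** The radii of balls in [R[i]] are themselves elements of [R[i]], and [0 < e] there forces [e] to
    be a positive real; hence convergence is decided by the real number [cmod]. *)
Lemma cvg_cmodP u l :
  u @ \oo --> l <-> (fun n => cmod (u n - l)) @ \oo --> (0 : R).
Proof.
split=> [/cvgrPdist_lt ul|/cvgrPdist_lt ul]; apply/cvgrPdist_lt => e e0.
  have := ul (ofreal e); rewrite ltcR => /(_ e0); apply: filterS => n.
  by rewrite norm_cplx ltcR sub0r normrN ger0_norm ?cmod_ge0// cmodC.
have [er ei] : 0 < complex.Re e /\ complex.Im e = 0.
  by move: e0; rewrite ltcE /= => /andP[/eqP -> ].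
have := ul _ er; apply: filterS => n.
rewrite sub0r normrN ger0_norm ?cmod_ge0// cmodC norm_cplx ltcE /=.
by rewrite ei eqxx.
Qed.

Lemma cvg_cplx_lim u l : u @ \oo --> l -> limn u = l.
Proof. by move=> h; exact: cvg_lim. Qed.

Lemma cvg_Re u l : u @ \oo --> l ->
  (fun n => complex.Re (u n)) @ \oo --> complex.Re l.
Proof.
move=> /cvg_cmodP/cvgrPdist_lt h; apply/cvgrPdist_lt => e e0.
have := h e e0; apply: filterS => n.
rewrite sub0r normrN ger0_norm ?cmod_ge0//; apply: le_lt_trans.
by rewrite cmodC -ReN -ReD; exact: normRe_le.
Qed.

Lemma cvg_Im u l : u @ \oo --> l ->
  (fun n => complex.Im (u n)) @ \oo --> complex.Im l.
Proof.
move=> /cvg_cmodP/cvgrPdist_lt h; apply/cvgrPdist_lt => e e0.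
have := h e e0; apply: filterS => n.
rewrite sub0r normrN ger0_norm ?cmod_ge0//; apply: le_lt_trans.
by rewrite cmodC -ImN -ImD; exact: normIm_le.
Qed.

Lemma cvg_cmod u l : u @ \oo --> l -> (fun n => cmod (u n)) @ \oo --> cmod l.
Proof.
move=> /cvg_cmodP/cvgrPdist_lt h; apply/cvgrPdist_lt => e e0.
have := h e e0; apply: filterS => n.
rewrite sub0r normrN ger0_norm ?cmod_ge0//; apply: le_lt_trans.
have h1 := cmod_triangle (u n) l; have h2 := cmod_triangle l (u n).
by rewrite [cmod (l - _)]cmodC in h2; rewrite ler_norml; lra.
Qed.

Lemma cvg_cplx u (a b : R) : (fun n => complex.Re (u n)) @ \oo --> a ->
  (fun n => complex.Im (u n)) @ \oo --> b -> u @ \oo --> ((a +i* b)%C : cplx R).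
Proof.
move=> ua ub; apply/cvg_cmodP.
apply: (@squeeze_cvgr _ _ _ _ (fun=> 0)
  (fun n => `|complex.Re (u n) - a| + `|complex.Im (u n) - b|)).
- apply: nearW => n; rewrite cmod_ge0/=; apply: le_trans (cmod_leReIm _) _.
  by rewrite ReD ReN ImD ImN.
- exact: cvg_cst.
- have ha : (fun n => `|complex.Re (u n) - a|) @ \oo --> `|a - a|.
    by apply: cvg_norm; apply: cvgB => //; exact: cvg_cst.
  have hb : (fun n => `|complex.Im (u n) - b|) @ \oo --> `|b - b|.
    by apply: cvg_norm; apply: cvgB => //; exact: cvg_cst.
  have h0 : 0 = `|a - a| + `|b - b| by rewrite !subrr normr0 addr0.
  by rewrite [X in _ --> X]h0; exact: cvgD.
Qed.

Lemma Re_series (c : nat -> cplx R) n :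
  complex.Re (series c n) = series (fun k => complex.Re (c k)) n.
Proof.
by rewrite /series/=; elim/big_ind2 : _ => // x a y b <- <-; rewrite ReD.
Qed.

Lemma Im_series (c : nat -> cplx R) n :
  complex.Im (series c n) = series (fun k => complex.Im (c k)) n.
Proof.
by rewrite /series/=; elim/big_ind2 : _ => // x a y b <- <-; rewrite ImD.
Qed.

(** Real and imaginary parts are dominated separately, so the comparison test is used in [R] only,
    and [cvg_cplx] rebuilds the complex limit. *)
Lemma cvg_cplx_series (c : nat -> cplx R) (b : nat -> R) :
  (forall k, cmod (c k) <= b k) -> cvgn (series b) -> cvgn (series c).
Proof.
move=> cb sb.
have dom (F : cplx R -> R) : (forall z, `|F z| <= cmod z) ->
    cvgn (series (fun k => F (c k))).
  move=> Fle; apply: normed_cvg; apply: series_le_cvg sb => k //=.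
  - by apply: le_trans (cb k); exact: cmod_ge0.
  - exact: le_trans (Fle _) (cb k).
have hr := dom _ normRe_le; have hi := dom _ normIm_le.
apply/cvg_ex; eexists; apply: cvg_cplx.
  by under eq_cvg do rewrite Re_series; exact: hr.
by under eq_cvg do rewrite Im_series; exact: hi.
Qed.

End cplx_limits.

Lemma cmod_cvg_le {R : realType} (u : nat -> cplx R) l (B : R) :
  u @ \oo --> l -> (forall n, cmod (u n) <= B) -> cmod l <= B.
Proof.
move=> /cvg_cmod ul uB; rewrite -(cvg_lim _ ul)//.
by apply: limr_le; [apply/cvg_ex; eexists; exact: ul|exact: nearW].
Qed.

Lemma bernoulli {R : realType} (x : R) n : -1 <= x -> 1 + n%:R * x <= (1 + x) ^+ n.
Proof.
move=> x1; elim: n => [|n IH]; first by rewrite mul0r addr0 expr0.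
rewrite exprS; apply: (@le_trans _ _ ((1 + x) * (1 + n%:R * x))).
  have : 0 <= n%:R * x ^+ 2 by rewrite mulr_ge0// sqr_ge0.
  by rewrite -[in X in _ -> X]addn1 natrD; nra.
by rewrite ler_wpM2l//; lra.
Qed.

(** * Power series on the unit disc and their second-order Taylor bound *)

Section power_series.
Context {R : realType}.
Implicit Types (a : nat -> cplx R) (b : nat -> R) (f : cplx R -> cplx R)
  (z w : cplx R) (r : R).

(* The series sum_k b_k z^k has radius of convergence at least 1. *)
Definition subexp b := (forall k, 0 <= b k) /\
  forall r, 0 < r < 1 -> exists M, forall k, b k * r ^+ k <= M.

Lemma subexp_summable b r : subexp b -> 0 <= r < 1 ->
  cvgn (series (fun k => b k * r ^+ k)).
Proof.
move=> [b0 bb] /andP[r0 r1].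
have r'0 : 0 < (r + 1) / 2 by lra.
have [|M hM] := bb ((r + 1) / 2); first by apply/andP; split; lra.
set r' := (r + 1) / 2 in r'0 hM.
apply: (@series_le_cvg _ _ (geometric M (r / r'))).
- by move=> k; rewrite mulr_ge0// exprn_ge0.
- move=> k /=; apply: mulr_ge0.
    by apply: le_trans (hM 0%N); rewrite mulr_ge0.
  by rewrite exprn_ge0// divr_ge0// ltW.
- move=> k /=; apply: (@le_trans _ _ (b k * r' ^+ k * (r / r') ^+ k)).
    by rewrite -mulrA -exprMn mulrC [r' * _]mulrC divfK ?gt_eqF// mulrC.
  by rewrite ler_wpM2r// exprn_ge0// divr_ge0// ltW.
- apply: is_cvg_geometric_series.
  by rewrite ger0_norm; [rewrite ltr_pdivrMr// mul1r /r'; lra|rewrite divr_ge0// ltW].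
Qed.

(** A slightly larger radius absorbs the factor k + 1: with r' / r = 1 + q, Bernoulli's inequality
    gives (1 + 1/q) (1 + q)^k >= k + 1. *)
Lemma subexp_mulS b : subexp b -> subexp (fun k => k.+1%:R * b k).
Proof.
move=> [b0 bb]; split=> [k|r /andP[r0 r1]]; first by rewrite mulr_ge0.
have r'0 : 0 < (r + 1) / 2 by lra.
have [|M hM] := bb ((r + 1) / 2); first by apply/andP; split; lra.
set r' := (r + 1) / 2 in r'0 hM.
have rr' : r < r' by rewrite /r'; lra.
set q := r' / r - 1.
have q0 : 0 < q by rewrite /q subr_gt0 ltr_pdivlMr// mul1r.
exists ((1 + q^-1) * M) => k.
have hk : k.+1%:R * r ^+ k <= (1 + q^-1) * r' ^+ k.
  have -> : r' ^+ k = (1 + q) ^+ k * r ^+ k.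
    by rewrite -exprMn /q addrCA subrr addr0 divfK// gt_eqF.
  rewrite mulrA ler_pM2r ?exprn_gt0//.
  apply: le_trans (_ : (1 + q^-1) * (1 + k%:R * q) <= _).
    have -> : (1 + q^-1) * (1 + k%:R * q) = 1 + q^-1 + k%:R * q + k%:R :> R.
      by field; rewrite gt_eqF.
    rewrite -addn1 natrD.
    have : 0 <= q^-1 by rewrite invr_ge0 ltW.
    have : 0 <= k%:R * q by rewrite mulr_ge0// ltW.
    by lra.
  rewrite ler_wpM2l ?addr_ge0 ?invr_ge0 ?(ltW q0)//.
  by apply: bernoulli; lra.
rewrite mulrAC; apply: le_trans (ler_wpM2r (b0 k) hk) _.
rewrite -mulrA ler_wpM2l ?addr_ge0 ?invr_ge0 ?(ltW q0)//.
by rewrite mulrC.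
Qed.

Lemma subexp_shift b : subexp b -> subexp (fun k => b k.+1).
Proof.
move=> [b0 bb]; split=> // r r01; have [M hM] := bb r r01.
case/andP: r01 => r0 r1.
exists (M / r) => k; rewrite ler_pdivlMr// -mulrA -exprSr; exact: hM.
Qed.

(** Convergence at the real point [r] bounds the partial sums, hence the terms, which are
    differences of consecutive partial sums. Later lemmas carry this growth condition on the
    coefficients in place of analyticity. *)
Lemma taylor_subexp f a : has_taylor f a -> subexp (fun k => cmod (a k)).
Proof.
move=> fa; split=> [k|r r01]; first exact: cmod_ge0.
have zr : cmod (ofreal r) < 1.
  by apply: cmod_real_lt1; case/andP: r01 => /ltW -> ->.
have [M [_ hM]] := cvg_seq_bounded (cvgP _ (cvg_cmod (fa _ zr))).
have {}hM n : cmod ([series a k * ofreal r ^+ k]_k n) <= `|M| + 1.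
  apply: le_trans (ler_norm _) _.
  by apply: (hM (`|M| + 1)) => //; rewrite (le_lt_trans (ler_norm _))// ltrDl.
exists ((`|M| + 1) + (`|M| + 1)) => k.
have -> : cmod (a k) * r ^+ k = cmod (a k * ofreal r ^+ k).
  by rewrite cmodM cmodX cmod_real ger0_norm//; case/andP: r01 => /ltW.
have -> : a k * ofreal r ^+ k = [series a k * ofreal r ^+ k]_k k.+1 -
    [series a k * ofreal r ^+ k]_k k by rewrite seriesSB.
by apply: le_trans (cmodB _ _) _; exact: lerD.
Qed.

(** The expression is that of [hankel], so [hankel mu a] is [psum (hankel_coef mu a)] by conversion.
    It is meant for coefficients with [subexp] and for |z| < 1. *)
Definition psum a z : cplx R := limn [series a k * z ^+ k]_k.

Definition dcoef a k : cplx R := k.+1%:R * a k.+1.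

Lemma subexp_dcoef a : subexp (fun k => cmod (a k)) ->
  subexp (fun k => cmod (dcoef a k)).
Proof.
move=> /subexp_shift/subexp_mulS; congr subexp.
by apply/funext => k; rewrite /dcoef cmodM cmod_nat.
Qed.

Lemma psum_cvg a z : subexp (fun k => cmod (a k)) -> cmod z < 1 ->
  [series a k * z ^+ k]_k @ \oo --> psum a z.
Proof.
move=> sa z1.
apply: (@cvg_cplx_series _ _ (fun k => cmod (a k) * cmod z ^+ k)).
  by move=> k; rewrite cmodM cmodX.
by apply: subexp_summable => //; rewrite cmod_ge0.
Qed.

Lemma taylor_psum f a z : has_taylor f a -> cmod z < 1 -> f z = psum a z.
Proof. by move=> fa z1; apply/esym/cvg_cplx_lim; exact: fa. Qed.

Lemma psum0 a : psum a 0 = a 0%N.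
Proof.
apply: cvg_cplx_lim; apply: cvg_near_cst; exists 1%N => // -[//|n] _.
rewrite /series/= big_nat_recl// expr0 mulr1 big1 ?addr0// => i _.
by rewrite exprS mul0r mulr0.
Qed.

(** Weierstrass test: the tail of the series of |a_k| r^k bounds the error independently of z. This
    makes analytic functions uniform limits of polynomials on smaller discs. *)
Lemma psum_unif a r (e : R) : subexp (fun k => cmod (a k)) -> 0 <= r < 1 ->
  0 < e -> exists N, forall n z, (N <= n)%N -> cmod z <= r ->
    cmod (psum a z - \sum_(k < n) a k * z ^+ k) <= e.
Proof.
move=> sa r01 e0; have cB := subexp_summable sa r01.
set B := fun k => _ in cB.
have B0 k : 0 <= B k.
  by case/andP: r01 => r0 _; rewrite mulr_ge0 ?cmod_ge0// exprn_ge0.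
have /cvgrPdist_lt/(_ e e0)[N0 _ NP0] := cB.
exists N0 => N z N0N zr.
have NP : limn (series B) - series B N < e.
  by rewrite (le_lt_trans (ler_norm _))//; exact: NP0.
have z1 : cmod z < 1 by case/andP: r01 => _; exact: le_lt_trans.
have hc : (fun n => [series a k * z ^+ k]_k (n + N)%N -
    \sum_(k < N) a k * z ^+ k) @ \oo --> psum a z - \sum_(k < N) a k * z ^+ k.
  apply: cvgB; last exact: cvg_cst.
  by have := psum_cvg sa z1; rewrite -(cvg_shiftn N).
apply: cmod_cvg_le hc _ => n; apply: le_trans (ltW NP).
rewrite -(big_mkord xpredT (fun k => a k * z ^+ k)).
rewrite -[X in _ - X]/([series a k * z ^+ k]_k N) sub_series leq_addl.
apply: le_trans (cmod_sum _ _ _) _.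
apply: le_trans (_ : series B (n + N)%N - series B N <= _).
  rewrite sub_series leq_addl; apply: ler_sum_nat => k _.
  by rewrite cmodM cmodX ler_wpM2l ?cmod_ge0// lerXn2r ?nnegrE ?cmod_ge0//;
    case/andP: r01.
rewrite lerD2r; apply: nondecreasing_cvgn_le => //.
by apply/nondecreasing_series => k _ _.
Qed.

(** Writing |w - z| as [h * r] makes both bounds multiples of [r ^+ k], so no exponent k - 2
    appears. They are proved together because the first-order bound enters the induction step of the
    second, which closes by k^2 + k <= (k + 1)^2. *)
Lemma expr_taylor2 z w r (h : R) k : 0 <= r -> 0 <= h -> cmod z <= r -> cmod w <= r ->
  cmod (w - z) = h * r ->
  cmod (w ^+ k - z ^+ k) <= k%:R * r ^+ k * h /\
  cmod (w ^+ k - z ^+ k - (w - z) * (k%:R * z ^+ k.-1)) <= k%:R ^+ 2 * r ^+ k * h ^+ 2.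
Proof.
move=> r0 h0 zr wr wz; elim: k => [|k [IH1 IH2]].
  by rewrite !expr0 subrr !mul0r mulr0 subr0 cmod0 expr2 !mul0r.
split.
  have -> : w ^+ k.+1 - z ^+ k.+1 = w * (w ^+ k - z ^+ k) + (w - z) * z ^+ k.
    by rewrite !exprS; ring.
  apply: le_trans (cmodD _ _) _; rewrite !cmodM wz cmodX.
  apply: le_trans (_ : r * (k%:R * r ^+ k * h) + h * r * r ^+ k <= _).
    apply: lerD; first by apply: ler_pM; rewrite ?cmod_ge0.
    by rewrite ler_wpM2l ?mulr_ge0// lerXn2r ?nnegrE ?cmod_ge0.
  by rewrite -addn1 natrD exprD expr1; nra.
have -> : w ^+ k.+1 - z ^+ k.+1 - (w - z) * (k.+1%:R * z ^+ k.+1.-1) =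
    z * (w ^+ k - z ^+ k - (w - z) * (k%:R * z ^+ k.-1)) +
    (w - z) * (w ^+ k - z ^+ k).
  case: k {IH1 IH2} => [|k] /=; first by rewrite !expr0 !expr1; ring.
  have -> : k.+2%:R = k.+1%:R + 1 :> cplx R by rewrite -addn1 natrD.
  by rewrite !exprS; ring.
apply: le_trans (cmodD _ _) _; rewrite !cmodM wz.
apply: le_trans (_ : r * (k%:R ^+ 2 * r ^+ k * h ^+ 2) +
   h * r * (k%:R * r ^+ k * h) <= _).
  apply: lerD; first by apply: ler_pM; rewrite ?cmod_ge0.
  by rewrite ler_wpM2l ?mulr_ge0.
rewrite -[k.+1]addn1 natrD exprD expr1.
have p0 : 0 <= r * r ^+ k * h ^+ 2 by rewrite !mulr_ge0 ?exprn_ge0.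
have k0 : 0 <= k%:R :> R by [].
rewrite -subr_ge0.
rewrite (_ : _ - _ = (k%:R + 1) * (r * r ^+ k * h ^+ 2)); last by ring.
by rewrite mulr_ge0// addr_ge0.
Qed.

(** Summing [expr_taylor2] against |a_k| gives K = r^-2 times the sum of (k + 1)^2 |a_k| r^k. The
    remainder is uniform in z and w, so it serves the complex derivative as well as the real
    derivatives along the axis. *)
Lemma psum_taylor2 a r : subexp (fun k => cmod (a k)) -> 0 < r < 1 ->
  exists2 K, 0 <= K & forall z w, cmod z <= r -> cmod w <= r ->
    cmod (psum a w - psum a z - (w - z) * psum (dcoef a) z) <= K * cmod (w - z) ^+ 2.
Proof.
move=> sa r01; have [r0 r1] := andP r01.
have sb := subexp_mulS (subexp_mulS sa).
have sc : cvgn (series (fun k => k.+1%:R * (k.+1%:R * cmod (a k)) * r ^+ k)).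
  by apply: subexp_summable => //; rewrite ltW.
set B := fun k => _ in sc.
have B0 k : 0 <= B k by rewrite !mulr_ge0 ?cmod_ge0 ?exprn_ge0// ltW.
have BL n : series B n <= limn (series B).
  by apply: nondecreasing_cvgn_le => //; apply/nondecreasing_series => k _ _.
have L0 : 0 <= limn (series B).
  by apply: le_trans (BL 0%N); rewrite /series/= big_geq.
exists (limn (series B) / r ^+ 2); first by rewrite divr_ge0// exprn_ge0// ltW.
move=> z w zr wr.
have z1 : cmod z < 1 by exact: le_lt_trans r1.
have w1 : cmod w < 1 by exact: le_lt_trans r1.
(* [n] terms of the derived series correspond to [n.+1] terms of the original one, whose constant
   term disappears. *)
have cvg1 : (fun n => [series a k * w ^+ k]_k n.+1 - [series a k * z ^+ k]_k n.+1 -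
    (w - z) * [series dcoef a k * z ^+ k]_k n) @ \oo -->
    psum a w - psum a z - (w - z) * psum (dcoef a) z.
  apply: cvgB; first apply: cvgB.
  - by have := psum_cvg sa w1; rewrite -cvg_shiftS.
  - by have := psum_cvg sa z1; rewrite -cvg_shiftS.
  - by apply: cvgM; [exact: cvg_cst|exact: (psum_cvg (subexp_dcoef sa) z1)].
apply: cmod_cvg_le cvg1 _ => n.
set h := cmod (w - z) / r.
have h0 : 0 <= h by rewrite divr_ge0 ?cmod_ge0// ltW.
have wzh : cmod (w - z) = h * r by rewrite /h divfK// gt_eqF.
have -> : [series a k * w ^+ k]_k n.+1 - [series a k * z ^+ k]_k n.+1 -
    (w - z) * [series dcoef a k * z ^+ k]_k n =
    \sum_(0 <= k < n.+1) a k * (w ^+ k - z ^+ k - (w - z) * (k%:R * z ^+ k.-1)).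
  have -> : [series dcoef a k * z ^+ k]_k n =
      \sum_(0 <= k < n.+1) a k * (k%:R * z ^+ k.-1).
    rewrite [RHS]big_nat_recl//= mul0r mulr0 add0r /series/=.
    by apply: eq_bigr => k _; rewrite /dcoef; ring.
  rewrite /series/= mulr_sumr -!sumrB; apply: eq_bigr => k _; ring.
apply: le_trans (cmod_sum _ _ _) _.
apply: le_trans (_ : series B n.+1 * h ^+ 2 <= _).
  rewrite /series/= mulr_suml; apply: ler_sum => k _; rewrite cmodM.
  have [_ H] := expr_taylor2 k (ltW r0) h0 zr wr wzh.
  apply: le_trans (ler_wpM2l (cmod_ge0 _) H) _.
  rewrite /B.
  have kk : k%:R ^+ 2 <= k.+1%:R * k.+1%:R :> R.
    by rewrite -expr2 lerXn2r ?nnegrE// ler_nat.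
  have c0 : 0 <= cmod (a k) * r ^+ k * h ^+ 2.
    apply: mulr_ge0; last exact: exprn_ge0.
    by apply: mulr_ge0; [exact: cmod_ge0|exact/exprn_ge0/ltW].
  have := ler_wpM2r c0 kk; rewrite !mulrA => H'.
  by apply: le_trans (le_trans H' _); rewrite le_eqVlt; apply/orP; left; apply/eqP; ring.
have -> : limn (series B) / r ^+ 2 * cmod (w - z) ^+ 2 =
    limn (series B) * h ^+ 2.
  by rewrite wzh; clearbody h; field; rewrite gt_eqF.
by rewrite ler_wpM2r ?exprn_ge0.
Qed.

End power_series.

(** * Measurability of complex-valued maps through their components *)

Section cplx_measurability.
Context {R : realType} d (T : measurableType d).
Implicit Types (D : set T) (g h : T -> cplx R).

Definition cmeas D g := measurable_fun D (fun x => complex.Re (g x)) /\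
  measurable_fun D (fun x => complex.Im (g x)).

Lemma cmeas_cst D (c : cplx R) : cmeas D (fun=> c).
Proof. by split; exact: measurable_cst. Qed.

Lemma cmeasD D g h : cmeas D g -> cmeas D h -> cmeas D (fun x => g x + h x).
Proof.
move=> [g1 g2] [h1 h2]; split.
  by under eq_fun do rewrite ReD; exact: measurable_funD.
by under eq_fun do rewrite ImD; exact: measurable_funD.
Qed.

Lemma cmeasM D g h : cmeas D g -> cmeas D h -> cmeas D (fun x => g x * h x).
Proof.
move=> [g1 g2] [h1 h2]; split.
  by under eq_fun do rewrite ReM;
    apply: measurable_funB; apply: measurable_funM.
by under eq_fun do rewrite ImM; apply: measurable_funD; apply: measurable_funM.
Qed.

Lemma cmeasX D g n : cmeas D g -> cmeas D (fun x => g x ^+ n).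
Proof.
move=> mg; elim: n => [|n IH]; first exact: cmeas_cst.
by under [fun x => _]eq_fun do rewrite exprS; exact: cmeasM.
Qed.

Lemma cmeas_sum D (F : nat -> T -> cplx R) n :
  (forall k, cmeas D (F k)) -> cmeas D (fun x => \sum_(0 <= k < n) F k x).
Proof.
move=> mF; elim: n => [|n IH].
  by under [fun x => _]eq_fun do rewrite big_geq//; exact: cmeas_cst.
by under [fun x => _]eq_fun do rewrite big_nat_recr//=; exact: cmeasD.
Qed.

Lemma cmeas_cmod D g : cmeas D g -> measurable_fun D (fun x => cmod (g x)).
Proof.
move=> [g1 g2]; under eq_fun do rewrite cmodE.
under eq_fun do rewrite -powR12_sqrt ?addr_ge0 ?sqr_ge0//.
apply: (@measurableT_comp _ _ _ _ _ _ (fun x : R => x `^ 2^-1)).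
  exact: measurable_powR.
by apply: measurable_funD; apply: measurable_funX.
Qed.

Lemma cmeas_psum D g (a : nat -> cplx R) : subexp (fun k => cmod (a k)) ->
  (forall x, D x -> cmod (g x) < 1) -> cmeas D g ->
  cmeas D (fun x => psum a (g x)).
Proof.
move=> sa g1 mg.
have mS n : cmeas D (fun x => [series a k * g x ^+ k]_k n).
  by apply: cmeas_sum => k; apply: cmeasM; [exact: cmeas_cst|exact: cmeasX].
split.
- apply: (@measurable_fun_cvg _ _ _ _
    (fun n x => complex.Re ([series a k * g x ^+ k]_k n))).
    by move=> n; case: (mS n).
  by move=> x Dx; apply: cvg_Re; exact: (psum_cvg sa (g1 _ Dx)).
- apply: (@measurable_fun_cvg _ _ _ _
    (fun n x => complex.Im ([series a k * g x ^+ k]_k n))).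
    by move=> n; case: (mS n).
  by move=> x Dx; apply: cvg_Im; exact: (psum_cvg sa (g1 _ Dx)).
Qed.

End cplx_measurability.

(** * Complex and real derivatives of a power series *)

Section derivatives.
Context {R : realType}.
Implicit Types (a : nat -> cplx R) (f : cplx R -> cplx R) (z w : cplx R).

Lemma taylor_derive1 f a z : has_taylor f a -> cmod z < 1 ->
  derive1 f z = psum (dcoef a) z.
Proof.
move=> fa z1; have sa := taylor_subexp fa.
have c0 := cmod_ge0 z.
have r01 : 0 < (cmod z + 1) / 2 < 1 by apply/andP; split; lra.
have [K K0 HK] := psum_taylor2 sa r01.
set r := (cmod z + 1) / 2 in r01 HK.
have zr : cmod z < r by rewrite /r; lra.
rewrite /derive1; apply: cvg_lim => //; apply/cvgrPdist_lt => e e0.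
have [er ei] : 0 < complex.Re e /\ complex.Im e = 0.
  by move: e0; rewrite ltcE /= => /andP[/eqP -> ].
set d := Num.min (r - cmod z) (complex.Re e / (K + 1)).
have d0 : 0 < d by rewrite lt_min subr_gt0 zr divr_gt0// ltr_wpDl.
have dd : 0 < ofreal d by rewrite ltcR.
near=> h.
have h0 : h != 0 by near: h; exact: nbhs_dnbhs_neq.
have hd : cmod h < d.
  suff : `|h| < ofreal d by rewrite norm_cplx ltcR.
  by near: h; exact: dnbhs0_lt.
move: hd; rewrite lt_min ltrBrDr => /andP[hr hK].
have hz : cmod (h + z) < r by apply: le_lt_trans (cmodD _ _) _.
have hz1 : cmod (h + z) < 1 by case/andP: r01 => _; exact: lt_trans.
have := HK z (h + z) (ltW zr) (ltW hz); rewrite addrK => H.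
rewrite (taylor_psum fa hz1) (taylor_psum fa z1).
have -> : psum (dcoef a) z - h^-1 *: (psum a (h + z) - psum a z) =
    - (h^-1 * (psum a (h + z) - psum a z - h * psum (dcoef a) z)).
  by rewrite mulrBr mulKf// opprB.
rewrite normrN norm_cplx ltcE /= ei eqxx /= cmodM cmodV.
have ch0 : 0 < cmod h by rewrite lt_neqAle eq_sym cmod_eq0 h0 cmod_ge0.
apply: le_lt_trans (_ : cmod h * K < _).
  by rewrite ler_pdivrMl// (_ : cmod h * (cmod h * K) = K * cmod h ^+ 2)//; ring.
move: hK; rewrite ltr_pdivlMr ?ltr_wpDl//; apply: le_lt_trans.
by rewrite ler_wpM2l ?cmod_ge0// lerDl.
Unshelve. all: by end_near. Qed.

Lemma quadratic_is_derive (F : R -> R) (s D K d : R) : 0 < d -> 0 <= K ->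
  (forall h, `|h| < d -> `|F (h + s) - F s - h * D| <= K * h ^+ 2) ->
  is_derive s 1 F D.
Proof.
move=> d0 K0 HF.
have H : (fun h => h^-1 *: (F (h *: 1 + s) - F s)) @ 0^' --> D.
  apply/cvgrPdist_lt => e e0.
  set d' := Num.min d (e / (K + 1)).
  have d'0 : 0 < d' by rewrite lt_min d0 divr_gt0// ltr_wpDl.
  near=> h.
  have h0 : h != 0 by near: h; exact: nbhs_dnbhs_neq.
  have : `|h| < d' by near: h; exact: dnbhs0_lt.
  rewrite lt_min => /andP[hd]; rewrite ltr_pdivlMr ?ltr_wpDl// => he.
  have -> : D - h^-1 *: (F (h *: 1 + s) - F s) =
      - (h^-1 * (F (h + s) - F s - h * D)).
    by rewrite mulrBr mulKf// opprB /GRing.scale/= mulr1.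
  rewrite normrN normrM normfV; apply: le_lt_trans he.
  rewrite mulrC ler_pdivrMr ?normr_gt0//; apply: le_trans (HF _ hd) _.
  rewrite -(real_normK (num_real h)).
  have := normr_ge0 h; have := sqr_ge0 `|h|; nra.
apply: DeriveDef; first exact: cvgP H.
exact: cvg_lim H.
Unshelve. all: by end_near. Qed.

Lemma psum_real_derive a (s : R) : subexp (fun k => cmod (a k)) -> -1 < s < 1 ->
  is_derive s 1 (fun x => complex.Re (psum a (ofreal x)))
    (complex.Re (psum (dcoef a) (ofreal s))) /\
  is_derive s 1 (fun x => complex.Im (psum a (ofreal x)))
    (complex.Im (psum (dcoef a) (ofreal s))).
Proof.
move=> sa s1; have s1' : `|s| < 1 by rewrite ltr_norml.
have c0 := normr_ge0 s.
have r01 : 0 < (`|s| + 1) / 2 < 1 by apply/andP; split; lra.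
have [K K0 HK] := psum_taylor2 sa r01.
set r := (`|s| + 1) / 2 in r01 HK.
have sr : `|s| < r by rewrite /r; lra.
have d0 : 0 < r - `|s| by rewrite subr_gt0.
have H h : `|h| < r - `|s| ->
    cmod (psum a (ofreal (h + s)) - psum a (ofreal s) -
      ofreal h * psum (dcoef a) (ofreal s)) <= K * h ^+ 2.
  rewrite ltrBrDr => hr; have := HK (ofreal s) (ofreal (h + s)).
  rewrite !cmod_real -ofrealB addrK => /(_ (ltW sr)); rewrite cmod_real.
  rewrite real_normK ?num_real//; apply; apply: ltW.
  by apply: le_lt_trans (ler_normD _ _) _.
split; apply: (quadratic_is_derive d0 K0) => h /H; apply: le_trans.
- by rewrite -ReZ -!ReN -!ReD; exact: normRe_le.
- by rewrite -ImZ -!ImN -!ImD; exact: normIm_le.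
Qed.

Lemma cmod_psum_lt1 (b : nat -> cplx R) (D : set R) : subexp (fun k => cmod (b k)) ->
  D `<=` `]-1, 1[ -> measurable_fun D (fun x => cmod (psum b (ofreal x))).
Proof.
move=> sb D1; apply: cmeas_cmod; apply: cmeas_psum => //.
- by move=> x /D1 /=; rewrite in_itv/= cmod_real ltr_norml.
- by split=> /=; [exact: measurable_id|exact: measurable_cst].
Qed.

Lemma real_ftc_le (F f : R -> R) (t : R) : 0 < t < 1 ->
  (forall s : R, -1 < s < 1 -> is_derive s 1 F (f s)) ->
  (forall s : R, -1 < s < 1 -> {for s, continuous f}) ->
  (`|F t - F 0|%:E <= \int[lebesgue_measure]_(s in `[0%R, t]) `|f s|%:E)%E.
Proof.
move=> /andP[t0 t1] dF cf.
have s1 s : 0 <= s <= t -> -1 < s < 1 by move=> /andP[? ?]; apply/andP; split; lra.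
have cF s : 0 <= s <= t -> {for s, continuous F}.
  move=> /s1/dF[d _]; apply: differentiable_continuous.
  exact/derivable1_diffP.
have cf' : {within `[0, t], continuous f}.
  by apply: continuous_in_subspaceT => x; rewrite inE/= in_itv/= => /s1/cf.
have ftc := @continuous_FTC2 R f F 0 t t0 cf'.
rewrite (_ : `|F t - F 0|%:E = `|(F t)%:E - (F 0)%:E|%E)// -ftc; last 2 first.
- split.
  + by move=> x; rewrite in_itv/= => /andP[x0 xt]; case: (dF x) => //;
      apply: s1; rewrite !ltW.
  + by apply: cvg_at_right_filter; apply: cF; rewrite lexx ltW.
  + by apply: cvg_at_left_filter; apply: cF; rewrite lexx ltW.
- move=> x; rewrite in_itv/= => /andP[x0 xt]; rewrite derive1E.
  by have [] := dF x; [apply: s1; rewrite !ltW|move=> _ ->].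
apply: le_abse_integral => //; apply/measurable_EFinP.
exact: subspace_continuous_measurable_fun.
Qed.

(** The fundamental theorem of calculus is applied to the real and to the imaginary part, each
    derivative being dominated by the modulus of the complex one; this is the factor 2. The
    continuity of the derivative that it requires comes from differentiating the series once
    more. *)
Lemma cmod_psum_ftc a (t : R) : subexp (fun k => cmod (a k)) -> 0 <= t < 1 ->
  ((cmod (psum a (ofreal t)))%:E <= (cmod (a 0%N))%:E +
   2%:E * \int[lebesgue_measure]_(s in `[0%R, t])
     (cmod (psum (dcoef a) (ofreal s)))%:E)%E.
Proof.
move=> sa /andP[]; rewrite le_eqVlt => /predU1P[<- _|t0 t1].
  rewrite [ofreal 0](_ : _ = 0)// psum0 leeDl// mule_ge0//.
  by apply: integral_ge0 => x _; rewrite lee_fin cmod_ge0.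
have sb := subexp_dcoef sa.
have sc := subexp_dcoef sb.
set g := fun s => cmod (psum (dcoef a) (ofreal s)).
set I := (X in (_ <= _ + _ * X)%E).
have part (P : cplx R -> R) :
    (forall z, `|P z| <= cmod z) ->
    (forall s : R, -1 < s < 1 -> is_derive s 1 (fun x => P (psum a (ofreal x)))
       (P (psum (dcoef a) (ofreal s)))) ->
    (forall s : R, -1 < s < 1 -> is_derive s 1 (fun x => P (psum (dcoef a) (ofreal x)))
       (P (psum (dcoef (dcoef a)) (ofreal s)))) ->
    (`|P (psum a (ofreal t)) - P (psum a (ofreal 0))|%:E <= I)%E.
  move=> Ple d1 d2.
  have cf s : -1 < s < 1 -> {for s, continuous (fun x => P (psum (dcoef a) (ofreal x)))}.
    move=> /d2[d _]; apply: differentiable_continuous; exact/derivable1_diffP.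
  apply: le_trans (real_ftc_le _ d1 cf) _; first by rewrite t0.
  apply: ge0_le_integral => //.
  - apply/measurable_EFinP; apply: measurableT_comp => //.
    apply: subspace_continuous_measurable_fun => //.
    apply: continuous_in_subspaceT => x; rewrite inE/= in_itv/= => /andP[x0 xt].
    by apply: cf; apply/andP; split; lra.
  - apply/measurable_EFinP; apply: cmod_psum_lt1 => //.
    by move=> x /=; rewrite !in_itv/= => /andP[x0 xt]; apply/andP; split; lra.
  - by move=> x _; rewrite lee_fin.
have hR := part _ normRe_le (fun s h => (psum_real_derive sa h).1)
  (fun s h => (psum_real_derive sb h).1).
have hI := part _ normIm_le (fun s h => (psum_real_derive sa h).2)
  (fun s h => (psum_real_derive sb h).2).
have h1 := cmod_triangle (psum a (ofreal t)) (a 0%N).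
have h2 := cmod_leReIm (psum a (ofreal t) - a 0%N).
rewrite -[a 0%N]psum0 ReD ReN ImD ImN in h2.
apply: (@le_trans _ _ ((cmod (a 0%N))%:E + (`|complex.Re (psum a (ofreal t)) - complex.Re (psum a (ofreal 0))|%:E
  + `|complex.Im (psum a (ofreal t)) - complex.Im (psum a (ofreal 0))|%:E))%E).
  rewrite -!EFinD lee_fin; apply: le_trans h1 _; rewrite lerD2l.
  by rewrite -{1}[a 0%N]psum0.
rewrite leeD2l// (_ : 2%:E = 1 + 1)%E// ge0_muleDl// mul1e.
exact: leeD.
Qed.

End derivatives.

(** * Translations, dilations, shears and rotations of the plane *)

Section planar_lebesgue.
Context {R : realType}.
Local Notation leb := (@lebesgue_measure R).
Local Notation area := (leb \x leb)%E.
Implicit Types (F : R * R -> \bar R) (f : R -> \bar R).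

(** The pushforward by a translation agrees with Lebesgue measure on half-open intervals, hence
    everywhere by uniqueness. *)
Lemma integral_translate f (a : R) : measurable_fun setT f ->
  (forall x, 0 <= f x)%E ->
  (\int[leb]_x f (x + a)%R = \int[leb]_x f x)%E.
Proof.
move=> mf f0.
have mphi : measurable_fun setT (fun x : measurableTypeR R => (x + a)%R : measurableTypeR R).
  by apply: measurable_funD.
transitivity (\int[pushforward leb (fun x : measurableTypeR R => (x + a)%R : measurableTypeR R)]_x f x)%E.
  by rewrite ge0_integral_pushforward.
apply: eq_measure_integral => //= A mA _; apply/esym.
apply: lebesgue_measure_unique => //= _ [[x y]] _ <-.
rewrite /pushforward/= [X in _ = leb X](_ : _ = `](x - a), (y - a)]%classic); last first.
  by apply/seteqP; split=> z /=; rewrite !in_itv/= => /andP[? ?]; apply/andP; split; lra.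
rewrite !lebesgue_measure_itv/= !lte_fin ltrBlDr subrK; case: ifP => // _.
by rewrite -!EFinB; congr EFin; ring.
Qed.

Lemma integral_dilate f (k : R) : 0 < k -> measurable_fun setT f ->
  (forall x, 0 <= f x)%E ->
  (\int[leb]_x f (k * x)%R = k^-1%:E * \int[leb]_x f x)%E.
Proof.
move=> k0 mf f0.
have mphi : measurable_fun setT (fun x : measurableTypeR R => (k * x)%R : measurableTypeR R).
  by apply: measurable_funM.
have k0' : 0 <= k by exact: ltW.
have E : (\int[leb]_x f x = k%:E * \int[leb]_x f (k * x)%R)%E.
  transitivity (\int[pushforward (mscale (NngNum k0') leb)
      (fun x : measurableTypeR R => (k * x)%R : measurableTypeR R)]_x f x)%E; last first.
    rewrite ge0_integral_pushforward//= preimage_setT ge0_integral_mscale//.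
    exact: measurableT_comp.
  apply: eq_measure_integral => //= A mA _.
  apply: lebesgue_measure_unique => //= _ [[x y]] _ <-.
  rewrite /mscale /pushforward/= [X in _ = (_ * leb X)%E](_ : _ = `](x / k), (y / k)]%classic); last first.
    by apply/seteqP; split=> z /=; rewrite !in_itv/= ltr_pdivrMr// ler_pdivlMr// (mulrC z).
  rewrite !lebesgue_measure_itv/= !lte_fin ltr_pM2r ?invr_gt0//; case: ifP => // _.
    by rewrite -!EFinB -EFinM; congr EFin; field; rewrite gt_eqF.
  by rewrite mule0.
by rewrite E muleA -EFinM mulVf ?gt_eqF// mul1e.
Qed.

Let mlin (a b c d e g : R) : measurable_fun setT (fun p : measurableTypeR R * measurableTypeR R =>
  ((a * p.1 + b * p.2 + e)%R : measurableTypeR R, (c * p.1 + d * p.2 + g)%R : measurableTypeR R)).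
Proof.
by apply/measurable_fun_pairP; split => /=; apply: measurable_funD => //;
  apply: measurable_funD; apply: measurable_funM.
Qed.

Lemma measurable_affine F (a b c d e g : R) : measurable_fun setT F ->
  measurable_fun setT (fun p : R * R => F (a * p.1 + b * p.2 + e, c * p.1 + d * p.2 + g)).
Proof. by move=> mF; exact: (measurableT_comp mF (mlin a b c d e g)). Qed.

(** On each horizontal slice the shear is a translation, so Tonelli reduces the claim to
    [integral_translate]. *)
Lemma area_shearx F (a : R) : measurable_fun setT F -> (forall p, 0 <= F p)%E ->
  (\int[area]_p F ((p.1 + a * p.2)%R, p.2) = \int[area]_p F p)%E.
Proof.
move=> mF F0.
have mF' : measurable_fun setT (fun p : R * R => F (p.1 + a * p.2, p.2)).
  by have := measurable_affine 1 a 0 1 0 0 mF; apply: eq_measurable_fun => p _;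
    congr F; congr pair; ring.
rewrite fubini_tonelli2// [RHS]fubini_tonelli2//; apply: eq_integral => y _.
rewrite /fubini_G/=; apply: (integral_translate (f := fun x => F (x, y))) => //.
exact: measurableT_comp.
Qed.

Lemma area_sheary F (a : R) : measurable_fun setT F -> (forall p, 0 <= F p)%E ->
  (\int[area]_p F (p.1, (p.2 + a * p.1)%R) = \int[area]_p F p)%E.
Proof.
move=> mF F0.
have mF' : measurable_fun setT (fun p : R * R => F (p.1, p.2 + a * p.1)).
  by have := measurable_affine 1 0 a 1 0 0 mF; apply: eq_measurable_fun => p _;
    congr F; congr pair; ring.
rewrite fubini_tonelli1// [RHS]fubini_tonelli1//; apply: eq_integral => x _.
rewrite /fubini_F/=; apply: (integral_translate (f := fun y => F (x, y))) => //.
exact: measurableT_comp.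
Qed.

Lemma area_translate F (a : R) : measurable_fun setT F -> (forall p, 0 <= F p)%E ->
  (\int[area]_p F ((p.1 + a)%R, p.2) = \int[area]_p F p)%E.
Proof.
move=> mF F0.
have mF' : measurable_fun setT (fun p : R * R => F (p.1 + a, p.2)).
  by have := measurable_affine 1 0 0 1 a 0 mF; apply: eq_measurable_fun => p _;
    congr F; congr pair; ring.
rewrite fubini_tonelli2// [RHS]fubini_tonelli2//; apply: eq_integral => y _.
rewrite /fubini_G/=; apply: (integral_translate (f := fun x => F (x, y))) => //.
exact: measurableT_comp.
Qed.

Lemma area_dilate F (k : R) : 0 < k -> measurable_fun setT F -> (forall p, 0 <= F p)%E ->
  (\int[area]_p F ((k * p.1)%R, (k * p.2)%R) = (k^-1 ^+ 2)%:E * \int[area]_p F p)%E.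
Proof.
move=> k0 mF F0.
have mF' : measurable_fun setT (fun p : R * R => F (k * p.1, k * p.2)).
  by have := measurable_affine k 0 0 k 0 0 mF; apply: eq_measurable_fun => p _;
    congr F; congr pair; ring.
have mF'' : measurable_fun setT (fun p : R * R => F (k * p.1, p.2)).
  by have := measurable_affine k 0 0 1 0 0 mF; apply: eq_measurable_fun => p _;
    congr F; congr pair; ring.
rewrite fubini_tonelli1// /fubini_F/=.
transitivity (\int[leb]_x (k^-1%:E * \int[leb]_y F ((k * x)%R, y)))%E.
  apply: eq_integral => x _; apply: (integral_dilate (f := fun y => F ((k * x)%R, y))) => //.
  exact: measurableT_comp.
rewrite ge0_integralZl//; last 3 first.
- by apply: (@measurable_fun_fubini_tonelli_F _ _ _ _ _ leb (fun p => F ((k * p.1)%R, p.2))).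
- by move=> x _; apply: integral_ge0.
- by rewrite lee_fin invr_ge0 ltW.
transitivity (k^-1%:E * \int[leb]_y \int[leb]_x F ((k * x)%R, y))%E.
  by congr (_ * _)%E; exact: (@fubini_tonelli _ _ _ _ R leb leb (fun p : R * R => F ((k * p.1)%R, p.2)) mF'' (fun p => F0 _)).
transitivity (k^-1%:E * \int[leb]_y (k^-1%:E * \int[leb]_x F (x, y)))%E.
  congr (_ * _)%E; apply: eq_integral => y _.
  apply: (integral_dilate (f := fun x => F (x, y))) => //.
  exact: measurableT_comp.
rewrite ge0_integralZl//; last 3 first.
- by apply: (@measurable_fun_fubini_tonelli_G _ _ _ _ _ leb F).
- by move=> y _; apply: integral_ge0.
- by rewrite lee_fin invr_ge0 ltW.
by rewrite (@fubini_tonelli2 _ _ _ _ R leb leb F mF F0) muleA -EFinM expr2.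
Qed.

Definition rot (w : cplx R) (p : R * R) : R * R :=
  (complex.Re w * p.1 - complex.Im w * p.2, complex.Im w * p.1 + complex.Re w * p.2).

Lemma measurable_rot F w : measurable_fun setT F ->
  measurable_fun setT (fun p : R * R => F (rot w p)).
Proof.
move=> mF.
have := measurable_affine (complex.Re w) (- complex.Im w) (complex.Im w) (complex.Re w) 0 0 mF.
by apply: eq_measurable_fun => p _; congr F; rewrite /rot; congr pair; ring.
Qed.

(* A rotation by an angle other than pi is a product of three shears. *)
Lemma area_rot F w : cmod w = 1 -> w != -1 -> measurable_fun setT F ->
  (forall p, 0 <= F p)%E ->
  (\int[area]_p F (rot w p) = \int[area]_p F p)%E.
Proof.
case: w => c s; set w := (c +i* s)%C => w1 wN1 mF F0.
have cs : c ^+ 2 + s ^+ 2 = 1 by have := cmod_sqr w; rewrite w1 expr1n.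
have c1 : 1 + c != 0.
  apply: contra wN1 => /eqP c1; have cN : c = -1 by lra.
  have s0 : s = 0 by apply/eqP; rewrite -sqrf_eq0; apply/eqP; move: cs; rewrite cN; lra.
  by rewrite eq_complex /= cN s0 oppr0 !eqxx.
(* For w = cos x + i sin x this is -tan(x / 2). The shears are horizontal by [a], vertical by [s],
   horizontal by [a], and [as'] and [a2] are the two identities that identify their product with the
   rotation. *)
set a := - s / (1 + c).
have as' : 1 + a * s = c.
  rewrite /a; apply: (mulIf c1); rewrite mulrDl mul1r mulrAC divfK//.
  by nra.
have a2 : 2 * a + a ^+ 2 * s = - s.
  rewrite (_ : _ + _ = a * (1 + (1 + a * s))); last by ring.
  by rewrite as' /a divfK.
have mG : measurable_fun setT (fun p : R * R => F (p.1 + a * p.2, p.2)).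
  by have := measurable_affine 1 a 0 1 0 0 mF; apply: eq_measurable_fun => p _;
    congr F; congr pair; ring.
have mH : measurable_fun setT (fun p : R * R => F (p.1 + a * (p.2 + s * p.1), p.2 + s * p.1)).
  have := measurable_affine (1 + a * s) a s 1 0 0 mF; apply: eq_measurable_fun => p _.
  by congr F; congr pair; ring.
rewrite -[RHS](area_shearx a mF)// -[RHS](area_sheary s mG)// -[RHS](area_shearx a mH)//=.
apply: eq_integral => p _; congr F; rewrite /rot/=; congr pair.
  transitivity ((1 + a * s) * p.1 + (2 * a + a ^+ 2 * s) * p.2).
    by rewrite as' a2; ring.
  by clear; ring.
transitivity (s * p.1 + (1 + a * s) * p.2); first by rewrite as'.
by clear; ring.
Qed.

Lemma rotM w1 w2 p : rot (w1 * w2) p = rot w1 (rot w2 p).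
Proof. by rewrite /rot ReM ImM /=; congr pair; ring. Qed.

Lemma rot1 p : rot 1 p = p.
Proof. by case: p => x y; rewrite /rot/=; congr pair; ring. Qed.

(** A power of [w] may equal -1, which [area_rot] excludes; iterating the rotation by [w] itself
    avoids that case. *)
Lemma area_rotX F w j : cmod w = 1 -> w != -1 -> measurable_fun setT F ->
  (forall p, 0 <= F p)%E ->
  (\int[area]_p F (rot (w ^+ j) p) = \int[area]_p F p)%E.
Proof.
move=> w1 wN1 mF F0; elim: j => [|j IH].
  by apply: eq_integral => p _; rewrite expr0 rot1.
rewrite -IH -(@area_rot (fun p => F (rot (w ^+ j) p)) w)//; last exact: measurable_rot.
by apply: eq_integral => p _; rewrite exprSr rotM.
Qed.

End planar_lebesgue.

(** * Averages over roots of unity *)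

Section roots_of_unity.
Context {R : realType}.
Implicit Types (w z : cplx R) (p : {poly cplx R}).

(** Roots of order 2^(n + 2) suffice. They are obtained from iterated square roots of -1, so neither
    angles nor an exponential are involved. If [w] were -1, its power of exponent 2^(n + 1) would be
    1 instead of -1. *)
Lemma prim_root_cplx n : exists N w, [/\ (2 < N)%N, (n < N)%N,
  N.-primitive_root w, cmod w = 1 & w != -1].
Proof.
have [w ww] : exists w, w ^+ (2 ^ n.+1) = -1.
  elim: n.+1 => [|m [w ww]]; first by exists (-1); rewrite expr1.
  by exists (sqrtc w); rewrite expnS exprM [X in X ^+ _](_ : _ = w)//; exact: sqr_sqrtc.
have wN : w ^+ (2 ^ n.+2) = 1 by rewrite expnS mulnC exprM ww expr2 mulrNN mulr1.
have [|m mw /dvdn_pfactor[//|j jn mj]] := prim_order_exists _ wN.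
  by rewrite expn_gt0.
have m1 : (-1 : cplx R) != 1.
  by rewrite eq_sym -subr_eq0 opprK -[_ + _]/(2%:R) pnatr_eq0.
have jn2 : j = n.+2.
  apply/eqP; move: jn; rewrite leq_eqVlt ltnS => /orP[//|jn].
  move: m1; rewrite -ww -(subnK jn) expnD mulnC exprM.
  by move: mw; rewrite mj => /prim_expr_order ->; rewrite expr1n eqxx.
exists m, w; rewrite mj jn2; split => //.
- by rewrite -[3%N]/(2 ^ 1).+1 ltn_exp2l.
- by rewrite (ltn_trans (ltn_expl n (ltnSn 1)))// ltn_exp2l.
- by rewrite -jn2 -mj.
- have := congr1 (@cmod R) wN; rewrite cmodX cmod1 => /eqP.
  by rewrite pexpr_eq1 ?expn_gt0 ?cmod_ge0// => /eqP.
- apply: contra_eq_neq ww => ->; rewrite expnS exprM expr2 mulrNN mulr1 expr1n.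
  by rewrite eq_sym.
Qed.

Lemma sum_prim_root N w m : N.-primitive_root w ->
  \sum_(j < N) (w ^+ m) ^+ j = (if (N %| m)%N then N%:R else 0).
Proof.
move=> wN; case: ifPn => [|Nm].
  rewrite (prim_order_dvd wN) => /eqP ->.
  under eq_bigr do rewrite expr1n; by rewrite sumr_const card_ord.
have w1 : w ^+ m - 1 != 0 by rewrite subr_eq0 -(prim_order_dvd wN).
apply: (mulfI w1); rewrite mulr0 -subrX1 -exprM mulnC exprM.
by rewrite (prim_expr_order wN) expr1n subrr.
Qed.

(** A discrete Cauchy formula, in which w^(j (N - k)) stands for w^(-j k). Since the degree is below
    N there is no aliasing: i + (N - k) lies strictly between 0 and 2 N, so N divides it only for i
    = k. *)
Lemma coef_average p (k N : nat) w z : N.-primitive_root w ->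
  (size p <= N)%N -> (k < N)%N ->
  N%:R * (p`_k * z ^+ k) = \sum_(j < N) w ^+ (j * (N - k)) * p.[w ^+ j * z].
Proof.
move=> wN pN kN.
transitivity (\sum_(j < N) \sum_(i < N) (p`_i * z ^+ i) * (w ^+ (i + (N - k))) ^+ j);
    last first.
  apply: eq_bigr => j _; rewrite (horner_coef_wide _ pN) mulr_sumr.
  apply: eq_bigr => i _; rewrite exprMn -!exprM mulnDl exprD.
  by rewrite [(j * i)%N]mulnC [(j * _)%N]mulnC; ring.
rewrite exchange_big/= (bigD1 (Ordinal kN))//= [X in _ + X]big1 ?addr0.
  rewrite -mulr_sumr sum_prim_root// subnKC; last exact: ltnW.
  by rewrite dvdnn mulrC.
move=> i ik; rewrite -mulr_sumr sum_prim_root//.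
rewrite ifN ?mulr0//; apply: contra ik => /dvdnP[q].
have iN := ltn_ord i.
case: q => [|[|q]] /eqP; rewrite ?mul0n ?mul1n ?addn_eq0 ?subn_eq0.
- by move=> /andP[_]; rewrite leqNgt kN.
- by move=> /eqP e; apply/eqP/val_inj => /=; lia.
- by move=> /eqP e; exfalso; lia.
Qed.

Lemma cmod_coef_average p (k N : nat) w z : N.-primitive_root w -> cmod w = 1 ->
  (size p <= N)%N -> (k < N)%N ->
  N%:R * (cmod p`_k * cmod z ^+ k) <= \sum_(j < N) cmod p.[w ^+ j * z].
Proof.
move=> wN w1 pN kN; rewrite -cmodX -cmodM -cmod_nat -cmodM (coef_average _ wN pN kN).
apply: le_trans (cmod_sum _ _ _) _; apply: ler_sum => j _.
by rewrite cmodM cmodX w1 expr1n mul1r.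
Qed.

(* The Poisson kernel is the real part of (1 + x) / (1 - x), and averaging
   1 / (1 - x) over the rotations by N-th roots of unity gives 1 / (1 - x^N). *)
Lemma kernel_average N w x : (0 < N)%N -> N.-primitive_root w -> cmod w = 1 ->
  cmod x < 1 ->
  (1 - cmod x ^+ N) * (1 - cmod x ^+ 2) *
    \sum_(j < N) (cmod (1 - w ^+ j * x) ^+ 2)^-1 <= 2 * N%:R.
Proof.
move=> N0 wN w1 x1.
have nz y : cmod y < 1 -> 1 - y != 0.
  apply: contraTneq => y1; rewrite (_ : y = 1) ?cmod1 ?ltxx//.
  by apply/eqP; rewrite eq_sym -subr_eq0 y1.
have cwx j : cmod (w ^+ j * x) = cmod x by rewrite cmodM cmodX w1 expr1n mul1r.
have nzj j : 1 - w ^+ j * x != 0 by rewrite nz// cwx.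
have cxN : cmod x ^+ N < 1 by rewrite exprn_ilt1 ?cmod_ge0// -lt0n.
have nzN : 1 - x ^+ N != 0 by rewrite nz// cmodX.
have avg : \sum_(j < N) (1 - w ^+ j * x)^-1 = N%:R / (1 - x ^+ N).
  apply: (mulIf nzN); rewrite divfK// mulr_suml.
  transitivity (\sum_(j < N) \sum_(i < N) x ^+ i * (w ^+ i) ^+ j).
    apply: eq_bigr => j _; apply: (mulfI (nzj j)); rewrite mulrA divff// mul1r.
    have -> : x ^+ N = (w ^+ j * x) ^+ N.
      by rewrite exprMn -exprM mulnC exprM (prim_expr_order wN) expr1n mul1r.
    rewrite -[LHS]opprB subrX1 -mulNr opprB; congr (_ * _); apply: eq_bigr => i _.
    by rewrite exprMn mulrC -!exprM mulnC.
  rewrite exchange_big/= (bigD1 (Ordinal N0))//= -mulr_sumr sum_prim_root// dvdn0.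
  rewrite expr0 mul1r big1 ?addr0// => i i0; rewrite -mulr_sumr sum_prim_root//.
  rewrite ifN ?mulr0//; apply: contra i0 => Ni; apply/eqP/val_inj => /=.
  by apply/eqP; rewrite -leqn0 leqNgt; apply/negP => i0; have := dvdn_leq i0 Ni; rewrite leqNgt ltn_ord.
have poisson y : 1 - y != 0 ->
    (1 - cmod y ^+ 2) * (cmod (1 - y) ^+ 2)^-1 = 2 * complex.Re (1 - y)^-1 - 1.
  move=> y1.
  have d0 : cmod (1 - y) ^+ 2 != 0 by rewrite sqrf_eq0 cmod_eq0.
  apply: (mulIf d0); rewrite divfK//.
  have -> : complex.Re (1 - y)^-1 = complex.Re (1 - y) / cmod (1 - y) ^+ 2.
    by rewrite cmod_sqr; case: (1 - y) => a b.
  rewrite mulrBl mulrA divfK// !cmod_sqr ReD ImD ReN ImN /=; ring.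
rewrite -mulrA mulr_sumr.
under eq_bigr => j _ do rewrite -{1}(cwx j) poisson//.
rewrite big_split/= -mulr_sumr sumr_const card_ord.
have -> : \sum_(j < N) complex.Re (1 - w ^+ j * x)^-1 =
    complex.Re (\sum_(j < N) (1 - w ^+ j * x)^-1).
  by elim/big_ind2 : _ => // a b c d -> ->; rewrite ReD.
rewrite avg.
have h1 : complex.Re (N%:R / (1 - x ^+ N)) <= N%:R / (1 - cmod x ^+ N).
  apply: le_trans (ler_norm _) _; apply: le_trans (normRe_le _) _.
  rewrite cmodM cmodV cmod_nat ler_wpM2l// lef_pV2 ?posrE ?subr_gt0//; last first.
    by rewrite lt_neqAle cmod_ge0 andbT eq_sym cmod_eq0.
  by have := cmod_triangle 1 (x ^+ N); rewrite cmod1 cmodX; lra.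
have c1 : 0 < 1 - cmod x ^+ N by rewrite subr_gt0.
have n0 : 0 <= N%:R :> R by [].
have c1N : 0 <= (1 - cmod x ^+ N) * N%:R by rewrite mulr_ge0// ltW.
by move: h1; rewrite ler_pdivlMr// mulNrn => h1; nra.
Qed.

End roots_of_unity.

(** [powR] gives the inverse on nonnegative numbers only, hence the detour 1 / f = f (f^2)^(-1),
    which also holds where f vanishes because both sides are then 0. *)
Lemma measurable_funV {R : realType} d (T : measurableType d) (D : set T) (f : T -> R) :
  measurable_fun D f -> measurable_fun D (fun x => (f x)^-1).
Proof.
move=> mf.
have fV x : (f x)^-1 = f x * (f x ^+ 2) `^ (-1).
  rewrite powR_inv1 ?sqr_ge0// expr2 invfM mulrA.
  by have [->|f0] := eqVneq (f x) 0; rewrite ?invr0 ?mulr0// divff// mul1r.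
under [fun x => _]eq_fun do rewrite fV.
apply: measurable_funM => //.
apply: (@measurableT_comp _ _ _ _ _ _ (fun x : R => x `^ (-1))).
  exact: measurable_powR.
exact: measurable_funX.
Qed.

(** * Integrals over the plane against radial weights *)

Section radial_averages.
Context {R : realType}.
Local Notation leb := (@lebesgue_measure R).
Local Notation area := (leb \x leb)%E.
Implicit Types (F : R * R -> \bar R) (p : {poly cplx R}) (w : cplx R) (W : R -> R).

Definition zof (q : R * R) : cplx R := (q.1 +i* q.2)%C.

(** Radial quantities are functions of |z|^2 instead of |z|: this is the variable of the weight, and
    the area of the set where [nsq] is below u is linear in u. *)
Definition nsq (q : R * R) : R := q.1 ^+ 2 + q.2 ^+ 2.

Lemma cmod_zof_sqr q : cmod (zof q) ^+ 2 = nsq q.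
Proof. by rewrite cmod_sqr. Qed.

Lemma zof_rot w q : zof (rot w q) = w * zof q.
Proof.
case: w q => c s [x y]; apply/eqP; rewrite eq_complex /= eqxx/=.
by rewrite addrC.
Qed.

Lemma nsq_rot w q : cmod w = 1 -> nsq (rot w q) = nsq q.
Proof. by move=> w1; rewrite -!cmod_zof_sqr zof_rot cmodM w1 mul1r. Qed.

Lemma nsq_ge0 q : 0 <= nsq q.
Proof. by rewrite addr_ge0// sqr_ge0. Qed.

Lemma measurable_nsq (D : set (R * R)) : measurable_fun D nsq.
Proof.
by apply: measurable_funD; apply: measurable_funX; apply: measurable_funTS;
  [exact: measurable_fst|exact: measurable_snd].
Qed.

Lemma measurable_nsq_comp W : measurable_fun setT W ->
  measurable_fun setT (fun q => W (nsq q)).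
Proof. by move=> mW; apply: measurableT_comp => //; exact: measurable_nsq. Qed.

Lemma cmeas_zof (D : set (R * R)) : cmeas D zof.
Proof.
by split; apply: measurable_funTS; [exact: measurable_fst|exact: measurable_snd].
Qed.

Lemma cmeas_horner (D : set (R * R)) p : cmeas D (fun q => p.[zof q]).
Proof.
under [fun x => _]eq_fun do rewrite horner_coef -(big_mkord xpredT (fun k => p`_k * zof _ ^+ k)).
apply: cmeas_sum => k; apply: cmeasM; first exact: cmeas_cst.
by apply: cmeasX; exact: cmeas_zof.
Qed.

Lemma area_rot_sum F w N : cmod w = 1 -> w != -1 -> measurable_fun setT F ->
  (forall q, 0 <= F q)%E ->
  (\int[area]_q (\sum_(j < N) F (rot (w ^+ j) q)) = N%:R%:E * \int[area]_q F q)%E.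
Proof.
move=> w1 wN1 mF F0; rewrite ge0_integral_sum//; last first.
  by move=> j; exact: measurable_rot.
under eq_bigr => j _ do rewrite area_rotX//.
elim: N => [|N IH]; first by rewrite big_ord0 mul0e.
rewrite big_ord_recr/= IH -natr1 EFinD ge0_muleDl ?lee_fin// mul1e//.
Qed.

(** [cmod_coef_average] bounds the coefficient by the sum of |p| over an orbit of rotations. A
    radial weight is constant on the orbit, and by rotation invariance integrating the orbit sum
    gives N times the integral. *)
Lemma coef_mean p k W : measurable_fun setT W -> (forall x, 0 <= W x) ->
  (\int[area]_q (cmod p`_k * cmod (zof q) ^+ k * W (nsq q))%:E <=
   \int[area]_q (cmod p.[zof q] * W (nsq q))%:E)%E.
Proof.
move=> mW W0.
have [N [w [_ nN wN w1 wN1]]] := @prim_root_cplx R (size p + k)%N.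
have pN : (size p <= N)%N by rewrite (leq_trans (leq_addr k _))// ltnW.
have kN : (k < N)%N by rewrite (leq_ltn_trans (leq_addl (size p) _)).
have N0 : (0 < N)%N by exact: leq_ltn_trans kN.
have mWn := measurable_nsq_comp mW.
have mL : measurable_fun setT (fun q => (cmod p`_k * cmod (zof q) ^+ k * W (nsq q))%:E).
  apply/measurable_EFinP; apply: measurable_funM => //; apply: measurable_funM => //.
  by apply: measurable_funX; apply: cmeas_cmod; exact: cmeas_zof.
have mR : measurable_fun setT (fun q => (cmod p.[zof q] * W (nsq q))%:E).
  apply/measurable_EFinP; apply: measurable_funM => //.
  by apply: cmeas_cmod; exact: cmeas_horner.
have R0 q : (0 <= (cmod p.[zof q] * W (nsq q))%:E)%E.
  by rewrite lee_fin mulr_ge0// cmod_ge0.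
have L0 q : (0 <= (cmod p`_k * cmod (zof q) ^+ k * W (nsq q))%:E)%E.
  by rewrite lee_fin !mulr_ge0 ?exprn_ge0 ?cmod_ge0.
rewrite -(@lee_pmul2l _ N%:R%:E)//; last by rewrite lte_fin ltr0n.
rewrite -(area_rot_sum N w1 wN1 mR R0) -ge0_integralZl//.
apply: ge0_le_integral => //.
- by move=> q _; rewrite mule_ge0// lee_fin.
- exact: measurable_funeM.
- by apply: emeasurable_sum => j; exact: (measurable_rot _ mR).
- move=> q _; rewrite sumEFin -EFinM lee_fin.
  under eq_bigr => j _ do rewrite nsq_rot ?cmodX ?w1 ?expr1n// zof_rot.
  rewrite -mulr_suml mulrA ler_wpM2r//.
  exact: cmod_coef_average.
Qed.

(** The same orbit argument with [kernel_average]. Since the weight vanishes outside the disc, only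
    points with |t z| < 1 have to be estimated. *)
Lemma kernel_mean (t : R) W : 0 <= t < 1 -> measurable_fun setT W ->
  (forall x, 0 <= W x) -> (forall x, 1 <= x -> W x = 0) ->
  (\int[area]_q ((cmod (1 - ofreal t * zof q) ^+ 2)^-1 * W (nsq q))%:E <=
   \int[area]_q (4 * (1 - t ^+ 2 * nsq q)^-1 * W (nsq q))%:E)%E.
Proof.
move=> /andP[t0 t1] mW W0 W1.
(* With t^N <= 1/2 the factor 1 - |t z|^N is at least 1/2, which turns the constant 2 of
   [kernel_average] into 4. *)
have [n tn] : exists n, t ^+ n.+1 <= 2^-1.
  have t1' : `|t| < 1 by rewrite ger0_norm.
  have /cvgrPdist_lt/(_ 2^-1) := cvg_expr t1'.
  rewrite invr_gt0 => /(_ (ltr0n _ 2))[m _ /(_ m.+1)/=].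
  rewrite sub0r normrN ger0_norm ?exprn_ge0// leqnSn => /(_ isT)/ltW h.
  by exists m.
have [N [w [_ nN wN w1 wN1]]] := @prim_root_cplx R n.
have N0 : (0 < N)%N by exact: leq_ltn_trans nN.
have mWn := measurable_nsq_comp mW.
have mK : measurable_fun setT (fun q => ((cmod (1 - ofreal t * zof q) ^+ 2)^-1 * W (nsq q))%:E).
  apply/measurable_EFinP; apply: measurable_funM => //.
  apply: measurable_funV; apply: measurable_funX; apply: cmeas_cmod; apply: cmeasD; first exact: cmeas_cst.
  under [fun x => _]eq_fun do rewrite -mulNr.
  by apply: cmeasM; [exact: cmeas_cst|exact: cmeas_zof].
have mR : measurable_fun setT (fun q => (4 * (1 - t ^+ 2 * nsq q)^-1 * W (nsq q))%:E).
  apply/measurable_EFinP; apply: measurable_funM => //; apply: measurable_funM => //.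
  apply: measurable_funV.
  by apply: measurable_funB => //; apply: measurable_funM => //; exact: measurable_nsq.
have K0 q : (0 <= ((cmod (1 - ofreal t * zof q) ^+ 2)^-1 * W (nsq q))%:E)%E.
  by rewrite lee_fin mulr_ge0// invr_ge0 exprn_ge0// cmod_ge0.
have tq q : nsq q < 1 -> t ^+ 2 * nsq q < 1.
  move=> q1; have := nsq_ge0 q; have : t ^+ 2 <= 1 by rewrite exprn_ile1// ltW.
  have := sqr_ge0 t; nra.
have R0 q : (0 <= (4 * (1 - t ^+ 2 * nsq q)^-1 * W (nsq q))%:E)%E.
  rewrite lee_fin; have [q1|q1] := ltP (nsq q) 1; last by rewrite W1// mulr0.
  by rewrite !mulr_ge0// invr_ge0 subr_ge0 ltW// tq.
rewrite -(@lee_pmul2l _ N%:R%:E)//; last by rewrite lte_fin ltr0n.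
rewrite -(area_rot_sum N w1 wN1 mK K0) -ge0_integralZl//.
apply: ge0_le_integral => //.
- by move=> q _; apply: sume_ge0.
- by apply: emeasurable_sum => j; exact: (measurable_rot _ mK).
- exact: measurable_funeM.
move=> q _; rewrite sumEFin -EFinM lee_fin.
under eq_bigr => j _ do rewrite nsq_rot ?cmodX ?w1 ?expr1n// zof_rot.
rewrite -mulr_suml mulrA.
have [q1|q1] := ltP (nsq q) 1; last by rewrite W1// !mulr0.
rewrite ler_wpM2r//.
have cx2 : cmod (ofreal t * zof q) ^+ 2 = t ^+ 2 * nsq q.
  by rewrite cmodM cmod_real exprMn cmod_zof_sqr ger0_norm.
have zq1 : cmod (zof q) <= 1.
  by rewrite -(@ler_pXn2r _ 2) ?nnegrE ?cmod_ge0// expr1n cmod_zof_sqr ltW.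
have cxt : cmod (ofreal t * zof q) <= t.
  by rewrite cmodM cmod_real ger0_norm// ler_piMr.
have cx1 : cmod (ofreal t * zof q) < 1 by exact: le_lt_trans t1.
have := kernel_average N0 wN w1 cx1; rewrite cx2.
have cN : cmod (ofreal t * zof q) ^+ N <= 2^-1.
  apply: le_trans tn; apply: (@le_trans _ _ (t ^+ N)).
    by rewrite lerXn2r ?nnegrE ?cmod_ge0.
  by rewrite ler_wiXn2l// ltW.
under eq_bigr => j _ do rewrite mulrCA.
set S := \sum_(j < N) _ => H.
have S0 : 0 <= S by apply: sumr_ge0 => j _; rewrite invr_ge0 exprn_ge0// cmod_ge0.
have d0 : 0 < 1 - t ^+ 2 * nsq q by rewrite subr_gt0 tq.
rewrite mulrA ler_pdivlMr// mulrC.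
have : 0 <= (1 - t ^+ 2 * nsq q) * S by rewrite mulr_ge0// ltW.
move: H; rewrite -mulrA; set T := _ * S => H T0; nra.
Qed.

End radial_averages.

Lemma measurable_lt_set {R : realType} d (T : measurableType d) (f g : T -> R) :
  measurable_fun setT f -> measurable_fun setT g -> measurable [set x | f x < g x].
Proof.
move=> mf mg; rewrite -[X in measurable X]setTI.
exact: (measurable_fun_ltr mf mg measurableT (_ : measurable [set true])).
Qed.

Lemma measurable_le_set {R : realType} d (T : measurableType d) (f g : T -> R) :
  measurable_fun setT f -> measurable_fun setT g -> measurable [set x | f x <= g x].
Proof.
move=> mf mg; rewrite -[X in measurable X]setTI.
exact: (measurable_fun_ler mf mg measurableT (_ : measurable [set true])).
Qed.

(** * Areas of concentric discs and annuli *)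

Section disc_area.
Context {R : realType}.
Local Notation leb := (@lebesgue_measure R).
Local Notation area := (leb \x leb)%E.

Lemma measurable_nsq_lt (u : R) : measurable [set q : R * R | nsq q < u].
Proof.
apply: (measurable_lt_set (f := @nsq R) (g := cst u)) => //.
exact: measurable_nsq.
Qed.

Lemma measurable_disc : measurable (@disc R).
Proof. exact: (measurable_nsq_lt 1). Qed.

(** The estimates below rely on its being finite and positive, without evaluating it. *)
Definition disc_area : R := fine (area (@disc R)).

Lemma disc_areaE : area (@disc R) = disc_area%:E.
Proof.
rewrite fineK// ge0_fin_numE//.
apply: (@le_lt_trans _ _ (area (`]-1, 1[%classic `*` `]-1, 1[%classic))).
  apply: le_measure; rewrite ?inE//; first exact: measurable_disc.
    by apply: measurableX; exact: measurable_itv.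
  move=> [x y]; rewrite /disc/= => xy; rewrite !in_itv/=.
  have := sqr_ge0 x; have := sqr_ge0 y.
  by split; apply/andP; split; nra.
rewrite product_measure1E ?measurable_itv//= !lebesgue_measure_itv/= lte_fin.
by case: ifP => _; rewrite ?mul0e// -!EFinB -EFinM ltry.
Qed.

Lemma disc_area_gt0 : 0 < disc_area.
Proof.
rewrite -lte_fin -disc_areaE.
apply: (@lt_le_trans _ _ (area (`](- 2^-1), 2^-1[%classic `*` `](- 2^-1), 2^-1[%classic))).
  rewrite product_measure1E ?measurable_itv//= !lebesgue_measure_itv/= lte_fin.
  rewrite ifT; last by lra.
  by rewrite -!EFinB -EFinM lte_fin mulr_gt0//; lra.
apply: le_measure; rewrite ?inE//; first by apply: measurableX; exact: measurable_itv.
  exact: measurable_disc.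
move=> [x y]; rewrite /disc/= !in_itv/= => -[/andP[? ?] /andP[? ?]]; nra.
Qed.

(** The dilation by the square root of u maps the unit disc onto this one and multiplies area by
    u. *)
Lemma area_nsq_lt (u : R) : 0 <= u -> area [set q | nsq q < u] = (u * disc_area)%:E.
Proof.
rewrite le_eqVlt => /predU1P[<-|u0].
  rewrite mul0r [X in area X](_ : _ = set0) ?measure0//.
  by apply/seteqP; split=> q //=; rewrite ltNge nsq_ge0.
have k0 : 0 < Num.sqrt u by rewrite sqrtr_gt0.
have k2 : Num.sqrt u ^+ 2 = u by rewrite sqr_sqrtr// ltW.
have mu' := measurable_nsq_lt u.
have mF : measurable_fun setT (fun q : R * R => (\1_[set q | nsq q < u] q)%:E : \bar R).
  by apply/measurable_EFinP; exact: measurable_indic.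
have F0 (q : R * R) : (0 <= (\1_[set q | nsq q < u] q)%:E :> \bar R)%E by rewrite lee_fin.
have := area_dilate k0 mF F0.
rewrite [in RHS]integral_indic// setIT exprVn k2.
have -> : (\int[area]_p (\1_[set q | nsq q < u] (Num.sqrt u * p.1, Num.sqrt u * p.2))%:E)%E
    = (\int[area]_p (\1_(@disc R) p)%:E)%E.
  apply: eq_integral => p _; congr EFin; rewrite !indicE; congr (_%:R).
  congr nat_of_bool; apply/idP/idP; rewrite !inE/= /nsq/= !exprMn k2 -mulrDr;
    by rewrite -[X in _ < X]mulr1 ltr_pM2l// /disc/= ?mulr1.
rewrite integral_indic ?setIT//; last exact: measurable_disc.
move=> H; have E : disc_area%:E = (u^-1%:E * area [set q | (nsq q < u)%R])%E.
  by rewrite -disc_areaE; exact: H.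
by rewrite EFinM E muleA -EFinM divff ?mul1e// gt_eqF.
Qed.

Lemma area_annulus (h : R) : 0 < h <= 1 ->
  area (@disc R `&` [set q | 1 - nsq q <= h]) = (h * disc_area)%:E.
Proof.
move=> /andP[h0 h1].
rewrite [X in area X](_ : _ = @disc R `\` [set q | nsq q < 1 - h]); last first.
  apply/seteqP; split=> q /= [dq hq]; split => //; first by apply/negP; rewrite -leNgt; lra.
  by move/negP: hq; rewrite -leNgt; lra.
rewrite measureD//=; last 3 first.
- exact: measurable_disc.
- exact: measurable_nsq_lt.
- by rewrite disc_areaE ltry.
rewrite setIidr; last by move=> q /=; rewrite /disc/= -/(nsq q); lra.
by rewrite disc_areaE area_nsq_lt ?subr_ge0// -EFinB; congr EFin; ring.
Qed.

End disc_area.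

(** * Dyadic sums for measures of Carleson type *)

Section geometric_decomposition.
Context {R : realType} d (T : measurableType d) (mu : {measure set T -> \bar R}).
Implicit Types (D : set T) (f v : T -> R).

(** The integrand is dominated by the step function with value b_k on E_k, whose integral is at most
    the sum of b_k m_k, a geometric series. The pieces only have to cover; they may overlap. *)
Lemma geometric_cover D f (E : nat -> set T) (b m : nat -> R) (A q : R) :
  measurable D -> (forall k, measurable (E k)) -> measurable_fun D f ->
  (forall x, D x -> 0 <= f x) -> (forall k, 0 <= b k) ->
  (forall x, D x -> exists2 k, E k x & f x <= b k) ->
  (forall k, mu (D `&` E k) <= (m k)%:E)%E ->
  0 <= A -> 0 < q < 1 -> (forall k, b k * m k <= A * q ^+ k) ->
  (\int[mu]_(x in D) (f x)%:E <= (A / (1 - q))%:E)%E.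
Proof.
move=> mD mE mf f0 b0 cov mm A0 /andP[q0 q1] bm.
have mterm k : measurable_fun D (fun x => (b k * \1_(E k) x)%:E).
  by apply/measurable_EFinP; apply: measurable_funM => //; exact: measurable_indic.
have term0 k x : (0 <= (b k * \1_(E k) x)%:E)%E by rewrite lee_fin mulr_ge0.
apply: (@le_trans _ _ (\int[mu]_(x in D) \sum_(k <oo) (b k * \1_(E k) x)%:E)%E).
  apply: ge0_le_integral => //.
  - exact/measurable_EFinP.
  - by apply: ge0_emeasurable_sum.
  - move=> x Dx; have [k Ekx fb] := cov x Dx.
    apply: le_trans (nneseries_lim_ge k.+1 _) => //=.
    rewrite big_nat_recr//= indicE mem_set// mulr1.
    apply: (@le_trans _ _ (b k)%:E); first by rewrite lee_fin.
    by apply: leeDr; apply: sume_ge0.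
rewrite integral_nneseries//.
apply: lime_le; first by apply: is_cvg_nneseries => n _ _; apply: integral_ge0.
apply: nearW => n.
apply: (@le_trans _ _ (\sum_(0 <= k < n) (A * q ^+ k)%:E)%E).
  apply: lee_sum => k _.
  apply: (@le_trans _ _ ((b k)%:E * mu (D `&` E k))%E).
    under eq_integral do rewrite EFinM.
    rewrite ge0_integralZl//.
      by rewrite integral_indic// setIC.
      by apply/measurable_EFinP; exact: measurable_indic.
    by rewrite lee_fin.
  apply: (@le_trans _ _ ((b k)%:E * (m k)%:E)%E); last by rewrite -EFinM lee_fin.
  by apply: lee_wpmul2l => //; rewrite lee_fin.
rewrite sumEFin lee_fin.
have qn : `|q| < 1 by rewrite ger0_norm// ltW.
exact: (geometric_le_lim n A0 q0 qn).
Qed.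

Lemma powR_anti (a x y : R) : a <= 0 -> 0 < x -> x <= y -> y `^ a <= x `^ a.
Proof.
move=> a0 x0 xy; have y0 : 0 < y by exact: lt_le_trans xy.
rewrite -[a]opprK !(powRN _ (- a)) lef_pV2 ?posrE ?powR_gt0//.
by apply: ge0_ler_powR; rewrite ?nnegrE ?oppr_ge0// ltW.
Qed.

Lemma powR_exprn (x a : R) n : 0 <= x -> (x ^+ n) `^ a = (x `^ a) ^+ n.
Proof. by move=> x0; rewrite -powR_mulrn// powRAC powR_mulrn// powR_ge0. Qed.

Lemma powR_lt1 (x a : R) : 0 < x < 1 -> 0 < a -> x `^ a < 1.
Proof.
move=> /andP[x0 x1] a0; have <- : 1 `^ a = 1 :> R by rewrite powR1.
by apply: gt0_ltr_powR => //; rewrite nnegrE ltW.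
Qed.

Lemma dyadic_scale (y : R) : 0 < y <= 1 -> exists k, 2^-1 ^+ k.+1 < y <= 2^-1 ^+ k.
Proof.
move=> /andP[y0 y1].
have ex : exists n, 2^-1 ^+ n.+1 < y.
  have h1 : `|2^-1 : R| < 1 by rewrite ger0_norm; lra.
  have /cvgrPdist_lt/(_ y y0)[m _ /(_ m.+1)/=] := cvg_expr h1.
  rewrite sub0r normrN ger0_norm ?exprn_ge0// leqnSn => /(_ isT) h.
  by exists m.
case: (ex_minnP ex) => k hk kmin; exists k; rewrite hk/=.
case: k hk kmin => [|k] hk kmin; first by rewrite expr0.
by rewrite leNgt; apply/negP => /kmin; rewrite ltnn.
Qed.

(* v plays the role of the distance to the boundary: mu is a Carleson measure
   with respect to v. *)
Definition carleson_fun D v (C : R) := [/\ measurable D, measurable_fun setT v,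
  (forall x, D x -> 0 < v x) &
  forall h, 0 < h -> (mu (D `&` [set x | (v x <= h)%R]) <= (C * h)%:E)%E].

Let measurable_le v (h : R) : measurable_fun setT v -> measurable [set x | (v x <= h)%R].
Proof. by move=> mv; exact: (measurable_le_set mv (measurable_cst h)). Qed.

Let measurable_gt v (h : R) : measurable_fun setT v -> measurable [set x | (h < v x)%R].
Proof. by move=> mv; exact: (measurable_lt_set (measurable_cst h) mv). Qed.

Lemma carleson_fun_small a : -1 < a <= 0 -> exists2 K, 0 < K &
  forall D v C e, 0 <= C -> carleson_fun D v C -> 0 < e ->
  (\int[mu]_(x in D `&` [set x | (v x <= e)%R]) (v x `^ a)%:E <=
    (C * K * e `^ (a + 1))%:E)%E.
Proof.
move=> /andP[a1 a0].
have q01 : 0 < 2^-1 `^ (a + 1) < (1 : R).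
  by rewrite powR_gt0 ?invr_gt0//= powR_lt1//; lra.
set q := 2^-1 `^ (a + 1) in q01.
have q1 : 0 < 1 - q by case/andP: q01 => _; rewrite subr_gt0.
exists (2^-1 `^ a / (1 - q)); first by rewrite divr_gt0// powR_gt0.
move=> D v C e C0 [mD mv v0 vC] e0.
rewrite (_ : C * _ * _ = (C * e `^ (a + 1) * 2^-1 `^ a) / (1 - q)); last by ring.
pose E k := [set x | v x <= e * 2^-1 ^+ k] `&` [set x | e * 2^-1 ^+ k.+1 < v x].
have p0 k : 0 < e * 2^-1 ^+ k by rewrite mulr_gt0// exprn_gt0.
apply: (@geometric_cover _ _ E (fun k => (e * 2^-1 ^+ k.+1) `^ a)
  (fun k => C * (e * 2^-1 ^+ k))) => //.
- by apply: measurableI => //; exact: measurable_le.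
- by move=> k; apply: measurableI; [exact: measurable_le|exact: measurable_gt].
- apply: measurable_funTS.
  by apply: (@measurableT_comp _ _ _ _ _ _ (fun x : R => x `^ a)) => //; exact: measurable_powR.
- by move=> x _; exact: powR_ge0.
- by move=> k; exact: powR_ge0.
- move=> x [Dx /= xe].
  have [|k /andP[k1 k2]] := @dyadic_scale (v x / e).
    by rewrite divr_gt0 ?v0//= ler_pdivrMr// mul1r.
  rewrite ltr_pdivlMr// mulrC in k1; rewrite ler_pdivrMr// mulrC in k2.
  exists k; first by split.
  by apply: powR_anti => //; exact: ltW.
- move=> k; apply: le_trans (vC _ (p0 k)); apply: le_measure; rewrite ?inE.
  + apply: measurableI; first by apply: measurableI => //; exact: measurable_le.
    by apply: measurableI; [exact: measurable_le|exact: measurable_gt].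
  + by apply: measurableI => //; exact: measurable_le.
  + by move=> x [[Dx _] [h _]].
- by rewrite !mulr_ge0// powR_ge0.
- move=> k; rewrite le_eqVlt; apply/orP; left; apply/eqP.
  have h2 : (2^-1 : R) != 0 by rewrite invr_eq0.
  have -> : q = 2^-1 `^ a * 2^-1.
    by rewrite /q powRD ?h2 ?implybT// powRr1// invr_ge0.
  have -> : e `^ (a + 1) = e `^ a * e.
    by rewrite powRD ?(gt_eqF e0) ?implybT// powRr1// ltW.
  rewrite powRM ?(ltW e0) ?exprn_ge0 ?invr_ge0// powR_exprn ?invr_ge0//.
  by rewrite exprMn exprS; ring.
Qed.

(** The pieces e 2^k < v <= e 2^(k+1) now grow. The bound (e 2^k)^(a-1) times the mass C e 2^(k+1)
    has ratio q = 2^a, below 1 because a < 0; the 2 in the constant is the quotient of the end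
    points of a piece. *)
Lemma carleson_fun_large a : a < 0 -> exists2 K, 0 < K &
  forall D v C e, 0 <= C -> carleson_fun D v C -> 0 < e ->
  (\int[mu]_(x in D `&` [set x | (e < v x)%R]) (v x `^ (a - 1))%:E <=
    (C * K * e `^ a)%:E)%E.
Proof.
move=> a0.
have q01 : 0 < 2^-1 `^ (- a) < (1 : R).
  by rewrite powR_gt0 ?invr_gt0//= powR_lt1//; lra.
set q := 2^-1 `^ (- a) in q01.
have q1 : 0 < 1 - q by case/andP: q01 => _; rewrite subr_gt0.
exists (2 / (1 - q)); first by rewrite divr_gt0.
move=> D v C e C0 [mD mv v0 vC] e0.
rewrite (_ : C * _ * _ = (C * e `^ a * 2) / (1 - q)); last by ring.
pose E k := [set x | v x <= e * 2 ^+ k.+1] `&` [set x | e * 2 ^+ k < v x].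
have p0 k : 0 < e * 2 ^+ k by rewrite mulr_gt0// exprn_gt0.
apply: (@geometric_cover _ _ E (fun k => (e * 2 ^+ k) `^ (a - 1))
  (fun k => C * (e * 2 ^+ k.+1))) => //.
- by apply: measurableI => //; exact: measurable_gt.
- by move=> k; apply: measurableI; [exact: measurable_le|exact: measurable_gt].
- apply: measurable_funTS.
  by apply: (@measurableT_comp _ _ _ _ _ _ (fun x : R => x `^ (a - 1))) => //; exact: measurable_powR.
- by move=> x _; exact: powR_ge0.
- by move=> k; exact: powR_ge0.
- move=> x [Dx /= xe].
  have ex : exists n, v x <= e * 2 ^+ n.+1.
    have [|k /andP[k1 k2]] := @dyadic_scale (e / v x).
      by rewrite divr_gt0 ?v0//= ler_pdivrMr ?v0// mul1r ltW.
    exists k; move: k1; rewrite ltr_pdivlMr ?v0// exprVn mulrC ltr_pdivrMr ?exprn_gt0//.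
    exact: ltW.
  case: (ex_minnP ex) => k hk kmin; exists k.
    split=> //=; case: k hk kmin => [|k] hk kmin; first by rewrite expr0 mulr1.
    by rewrite ltNge; apply/negP => /kmin; rewrite ltnn.
  apply: powR_anti => //; first by lra.
  case: k hk kmin => [|k] hk kmin; first by rewrite expr0 mulr1 ltW.
  by rewrite leNgt; apply/negP => /ltW/kmin; rewrite ltnn.
- move=> k; apply: le_trans (vC _ (p0 k.+1)); apply: le_measure; rewrite ?inE.
  + apply: measurableI; first by apply: measurableI => //; exact: measurable_gt.
    by apply: measurableI; [exact: measurable_le|exact: measurable_gt].
  + by apply: measurableI => //; exact: measurable_le.
  + by move=> x [[Dx _] [h _]].
- by rewrite !mulr_ge0// powR_ge0.
- move=> k; rewrite le_eqVlt; apply/orP; left; apply/eqP.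
  have h2 : (2 : R) != 0 by [].
  have -> : q = 2 `^ a by rewrite /q -(powR_inv1 (ler0n R 2)) -powRrM; congr powR; ring.
  rewrite powRD; last by rewrite (gt_eqF (p0 k)) implybT.
  rewrite powR_inv1 ?(ltW (p0 k))// powRM ?(ltW e0) ?exprn_ge0// powR_exprn//.
  have -> : e * 2 ^+ k.+1 = 2 * (e * 2 ^+ k) by rewrite exprS; ring.
  have := gt_eqF (p0 k); set y := e * 2 ^+ k => y0.
  by field; rewrite y0.
Qed.

End geometric_decomposition.

(** * The kernel integral over the disc *)

Section disc_estimates.
Context {R : realType}.
Local Notation leb := (@lebesgue_measure R).
Local Notation area := (leb \x leb)%E.
Implicit Types (a b : nat -> cplx R).

Lemma nsq_lt1_cmod (q : R * R) : nsq q < 1 -> cmod (zof q) < 1.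
Proof.
by move=> q1; rewrite -(@ltr_pXn2r _ 2) ?nnegrE ?cmod_ge0// cmod_zof_sqr expr1n.
Qed.

Lemma carleson_fun_disc : carleson_fun area (@disc R) (fun q => 1 - nsq q) disc_area.
Proof.
split.
- exact: measurable_disc.
- by apply: measurable_funB => //; exact: measurable_nsq.
- by move=> q; rewrite subr_gt0.
- move=> h h0; have [h1|h1] := leP h 1.
    have h01 : 0 < h <= 1 by rewrite h0.
    by apply: (@le_trans _ _ (h * disc_area)%:E); [rewrite -(area_annulus h01)|rewrite mulrC].
  apply: (@le_trans _ _ (area (@disc R))).
    apply: le_measure; rewrite ?inE; [|exact: measurable_disc|by []].
    apply: measurableI; first exact: measurable_disc.
    apply: (measurable_le_set (f := fun q : R * R => 1 - nsq q) (g := cst h)) => //.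
    by apply: measurable_funB => //; exact: measurable_nsq.
  by rewrite disc_areaE lee_fin ler_pMr ?disc_area_gt0// ltW.
Qed.

Lemma int_restrict (D : set (R * R)) (g : R * R -> R) :
  (\int[area]_(q in D) (g q)%:E = \int[area]_q (\1_D q * g q)%:E)%E.
Proof.
rewrite integral_mkcond; apply: eq_integral => q _; rewrite /patch indicE.
by case: (q \in D); rewrite ?mul1r ?mul0r.
Qed.

Lemma measurable_weight (al : R) (D : set (R * R)) :
  measurable_fun D (fun q : R * R => (1 - nsq q) `^ al).
Proof.
apply: measurable_funTS.
apply: (@measurableT_comp _ _ _ _ _ _ (fun x : R => x `^ al)); first exact: measurable_powR.
by apply: measurable_funB => //; exact: measurable_nsq.
Qed.

Lemma measurable_cmod_psum a : subexp (fun k => cmod (a k)) ->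
  measurable_fun (@disc R) (fun q => cmod (psum a (zof q))).
Proof.
move=> sa; apply: cmeas_cmod; apply: cmeas_psum => //; last exact: cmeas_zof.
by move=> q; exact: nsq_lt1_cmod.
Qed.

(** After averaging, the kernel is 4 / (1 - t^2 |z|^2). Where 1 - |z|^2 <= 1 - t = e it is at most 4
    / e, and [carleson_fun_small] contributes e^(al+1); elsewhere it is at most 4 / (1 - |z|^2), and
    [carleson_fun_large] contributes e^al. Both parts are of order e^al. *)
Lemma kernel_int (al : R) : -1 < al < 0 -> exists2 K, 0 < K &
  forall t, 0 <= t < 1 ->
  (\int[area]_(q in @disc R) ((1 - nsq q) `^ al * (cmod (1 - ofreal t * zof q) ^+ 2)^-1)%:E
    <= (K * (1 - t) `^ al)%:E)%E.
Proof.
move=> /andP[al1 al0].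
have al01 : -1 < al <= 0 by rewrite al1 ltW.
have [K1 K10 H1] := @carleson_fun_small R _ _ area al al01.
have [K2 K20 H2] := @carleson_fun_large R _ _ area al al0.
have c0 : 0 < disc_area :> R := disc_area_gt0.
exists (4 * (disc_area * K1 + disc_area * K2)).
  by rewrite mulr_gt0// addr_gt0// mulr_gt0.
move=> t t01; have /andP[t0 t1] := t01.
set e := 1 - t; have e0 : 0 < e by rewrite subr_gt0.
pose W (u : R) : R := \1_[set x | x < 1] u * (1 - u) `^ al.
have mW : measurable_fun setT W.
  apply: measurable_funM.
    apply: measurable_indic.
    exact: (measurable_lt_set (f := fun x : R => x) (g := cst (1 : R)) (@measurable_id _ _ _) (measurable_cst _)).
  apply: (@measurableT_comp _ _ _ _ _ _ (fun x : R => x `^ al)).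
    exact: measurable_powR.
  exact: measurable_funB.
have W0 x : 0 <= W x by rewrite mulr_ge0// powR_ge0.
have W1 x : 1 <= x -> W x = 0.
  move=> x1; rewrite /W indicE memNset ?mul0r//=.
  by apply/negP; rewrite -leNgt.
have := kernel_mean t01 mW W0 W1.
have -> : (\int[area]_q ((cmod (1 - ofreal t * zof q) ^+ 2)^-1 * W (nsq q))%:E =
    \int[area]_(q in @disc R) ((1 - nsq q) `^ al * (cmod (1 - ofreal t * zof q) ^+ 2)^-1)%:E)%E.
  rewrite [RHS]int_restrict; apply: eq_integral => q _; congr EFin; rewrite /W.
  by rewrite mulrC -mulrA; congr (_ * _).
move=> /le_trans; apply.
have -> : (\int[area]_q (4 * (1 - t ^+ 2 * nsq q)^-1 * W (nsq q))%:E =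
    \int[area]_(q in @disc R) (4 * ((1 - t ^+ 2 * nsq q)^-1 * (1 - nsq q) `^ al))%:E)%E.
  rewrite [RHS]int_restrict; apply: eq_integral => q _; congr EFin; rewrite /W.
  have -> : \1_[set x | x < 1] (nsq q) = \1_(@disc R) q :> R by [].
  by ring.
pose D1 := @disc R `&` [set q | (1 - nsq q <= e)%R].
pose D2 := @disc R `&` [set q | (e < 1 - nsq q)%R].
have mv : measurable_fun setT (fun q : R * R => 1 - nsq q).
  by apply: measurable_funB => //; exact: measurable_nsq.
have mD1 : measurable D1.
  apply: measurableI; first exact: measurable_disc.
  exact: (measurable_le_set mv (measurable_cst e)).
have mD2 : measurable D2.
  apply: measurableI; first exact: measurable_disc.
  exact: (measurable_lt_set (measurable_cst e) mv).
have DU : @disc R = D1 `|` D2.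
  apply/seteqP; split=> q; last by move=> [[]|[]].
  by move=> dq; have [h|h] := leP (1 - nsq q) e; [left|right].
have mf (D : set (R * R)) : measurable_fun D
    (fun q => (4 * ((1 - t ^+ 2 * nsq q)^-1 * (1 - nsq q) `^ al))%:E).
  apply/measurable_EFinP; apply: measurable_funM => //.
  apply: measurable_funM; last exact: measurable_weight.
  apply: measurable_funV; apply: measurable_funB => //.
  by apply: measurable_funM => //; exact: measurable_nsq.
(* Two lower bounds for the averaged denominator, the first from t^2 <= 1, the second from t^2 <= t
   and |z| < 1. *)
have tq (q : R * R) : nsq q < 1 -> 1 - nsq q <= 1 - t ^+ 2 * nsq q /\ e <= 1 - t ^+ 2 * nsq q.
  move=> q1; have q0 := nsq_ge0 q.
  have : t ^+ 2 <= t by rewrite expr2 ler_piMr// ltW.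
  have := sqr_ge0 t; rewrite /e; split; nra.
have f0 (q : R * R) : disc q -> (0 <= (4 * ((1 - t ^+ 2 * nsq q)^-1 * (1 - nsq q) `^ al))%:E)%E.
  move=> /tq[_ h]; rewrite lee_fin !mulr_ge0// ?powR_ge0// invr_ge0 (le_trans (ltW e0) h)//.
rewrite DU ge0_integral_setU//; last 3 first.
- exact: mf.
- by rewrite -DU.
- rewrite disj_set2E; apply/eqP/seteqP; split=> q //= [[_ /= h1] [_ /= h2]].
  by move: h1; rewrite leNgt h2.
have -> : 4 * (disc_area * K1 + disc_area * K2) * e `^ al =
    4 * (e^-1 * (disc_area * K1 * e `^ (al + 1))) + 4 * (disc_area * K2 * e `^ al).
  rewrite powRD ?(gt_eqF e0) ?implybT// powRr1 ?(ltW e0)//.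
  by field; rewrite gt_eqF.
rewrite EFinD; apply: leeD.
- apply: (@le_trans _ _ (\int[area]_(q in D1) ((4 * e^-1)%:E * ((1 - nsq q) `^ al)%:E))%E).
    apply: ge0_le_integral => //.
    + by move=> q [dq _]; exact: f0.
    + exact: mf.
    + under eq_fun do rewrite -EFinM.
      by apply/measurable_EFinP/measurable_funM => //; exact: measurable_weight.
    + move=> q [dq /= _]; rewrite -EFinM lee_fin.
      have -> : 4 / e * (1 - nsq q) `^ al = 4 * (e^-1 * (1 - nsq q) `^ al) by rewrite mulrA.
      apply: ler_wpM2l => //; apply: ler_wpM2r; first exact: powR_ge0.
      have [_ h] := tq q dq.
      by rewrite lef_pV2 ?posrE ?(lt_le_trans e0 h).
  rewrite ge0_integralZl//; last 3 first.
  + by apply/measurable_EFinP; exact: measurable_weight.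
  + by move=> q _; rewrite lee_fin powR_ge0.
  + by rewrite lee_fin mulr_ge0// invr_ge0 ltW.
  have -> : 4 * (e^-1 * (disc_area * K1 * e `^ (al + 1))) =
      4 / e * (disc_area * K1 * e `^ (al + 1)) by rewrite mulrA.
  rewrite [leRHS]EFinM; apply: lee_wpmul2l; first by rewrite lee_fin divr_ge0// ltW.
  exact: (H1 _ _ _ _ (ltW c0) carleson_fun_disc e0).
- apply: (@le_trans _ _ (\int[area]_(q in D2) (4%:E * ((1 - nsq q) `^ (al - 1))%:E))%E).
    apply: ge0_le_integral => //.
    + by move=> q [dq _]; exact: f0.
    + exact: mf.
    + under eq_fun do rewrite -EFinM.
      by apply/measurable_EFinP/measurable_funM => //; exact: measurable_weight.
    + move=> q [dq /= _]; rewrite -EFinM lee_fin ler_wpM2l//.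
      have [h _] := tq q dq.
      have v0 : 0 < 1 - nsq q by rewrite subr_gt0.
      rewrite powRB ?(gt_eqF v0) ?implybT// powRr1 ?(ltW v0)// mulrC ler_wpM2l ?powR_ge0//.
      by rewrite lef_pV2 ?posrE ?(lt_le_trans v0 h).
  rewrite ge0_integralZl//; last 2 first.
  + by apply/measurable_EFinP; exact: measurable_weight.
  + by move=> q _; rewrite lee_fin powR_ge0.
  rewrite EFinM; apply: lee_wpmul2l; first by rewrite lee_fin.
  exact: (H2 _ _ _ _ (ltW c0) carleson_fun_disc e0).
Qed.

End disc_estimates.

(** * Passing mean-value inequalities from polynomials to their limits *)

Section mean_values.
Context {R : realType}.
Local Notation leb := (@lebesgue_measure R).
Local Notation area := (leb \x leb)%E.
Implicit Types (a b : nat -> cplx R).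

Lemma measurable_indicM d (T : measurableType d) (S : set T) (f : T -> R) :
  measurable S -> measurable_fun S f -> measurable_fun setT (fun q => \1_S q * f q).
Proof.
move=> mS mf; have := (measurable_restrictT f mS).1 mf.
apply: eq_measurable_fun => q _; rewrite /patch indicE.
by case: (q \in S); rewrite ?mul1r ?mul0r.
Qed.

(** [G] stands for the modulus of an analytic function and [beta] for the modulus of its k-th
    coefficient. [coef_mean] holds for the approximating polynomials; the error passes to the limit
    because the weight is bounded and supported in the disc, so that both integrals multiplied by
    the error are finite. *)
Lemma approx_mean (G : R * R -> R) (k : nat) (beta u0 M : R) (W : R -> R) :
  measurable_fun setT W -> (forall x, 0 <= W x <= M) -> u0 <= 1 ->
  (forall x, u0 <= x -> W x = 0) -> (forall q, 0 <= G q) ->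
  measurable_fun setT (fun q => G q * W (nsq q)) ->
  (forall e, 0 < e -> exists p : {poly cplx R}, beta - e <= cmod p`_k /\
     forall q, nsq q < u0 -> cmod p.[zof q] <= G q + e) ->
  (beta%:E * \int[area]_q (cmod (zof q) ^+ k * W (nsq q))%:E <=
   \int[area]_q (G q * W (nsq q))%:E)%E.
Proof.
move=> mW WM u1 W0 G0 mG happ.
have mWn := measurable_nsq_comp mW.
have Wge x : 0 <= W x by have /andP[] := WM x.
have M0 : 0 <= M by have /andP[h1] := WM 0; exact: le_trans.
have mz : measurable_fun setT (fun q : R * R => cmod (zof q) ^+ k * W (nsq q)).
  apply: measurable_funM => //; apply: measurable_funX; apply: cmeas_cmod.
  exact: cmeas_zof.
have z0 q : 0 <= cmod (zof q) ^+ k * W (nsq q).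
  by rewrite mulr_ge0// exprn_ge0// cmod_ge0.
set A := (\int[area]_q (cmod (zof q) ^+ k * W (nsq q))%:E)%E.
set B := (\int[area]_q (W (nsq q))%:E)%E.
have B0 : (0 <= B)%E by apply: integral_ge0 => q _; rewrite lee_fin.
have A0 : (0 <= A)%E by apply: integral_ge0 => q _; rewrite lee_fin.
have Bfin : (B < +oo)%E.
  apply: (@le_lt_trans _ _ (\int[area]_q (M * \1_(@disc R) q)%:E)%E).
    apply: ge0_le_integral => //.
    - by move=> q _; rewrite lee_fin.
    - exact/measurable_EFinP.
    - apply/measurable_EFinP; apply: measurable_funM => //.
      by apply: measurable_indic; exact: measurable_disc.
    - move=> q _; rewrite lee_fin indicE; have [q1|q1] := ltP (nsq q) 1.
        by rewrite mem_set// mulr1; have /andP[] := WM (nsq q).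
      by rewrite W0 ?(le_trans u1)// mulr_ge0.
  under eq_integral do rewrite EFinM.
  rewrite ge0_integralZl//; last first.
    by apply/measurable_EFinP; apply: measurable_indic; exact: measurable_disc.
  rewrite integral_indic//; last exact: measurable_disc.
  rewrite setIT.
  apply: (@le_lt_trans _ _ (M%:E * disc_area%:E)%E); last by rewrite -EFinM ltry.
  by rewrite -disc_areaE.
have AB : (A <= B)%E.
  apply: ge0_le_integral => //;
    [by move=> q _; rewrite lee_fin|exact/measurable_EFinP|exact/measurable_EFinP|].
  move=> q _; rewrite lee_fin; have [q1|q1] := ltP (nsq q) 1.
    by rewrite ler_piMl// exprn_ile1 ?cmod_ge0// ltW// nsq_lt1_cmod.
  by rewrite W0 ?(le_trans u1)// mulr0.
have Bf : B = (fine B)%:E by rewrite fineK// ge0_fin_numE.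
have Af : A = (fine A)%:E by rewrite fineK// ge0_fin_numE// (le_lt_trans AB).
have fB0 : 0 <= fine B by rewrite fine_ge0.
have fA0 : 0 <= fine A by rewrite fine_ge0.
apply/lee_addgt0Pr => e e0.
(* The total error is (e / c) (A + B), which this choice keeps below e; the 1 makes the denominator
   positive. *)
set c := fine A + fine B + 1.
have c0 : 0 < c by rewrite /c; lra.
have d0 : 0 < e / c by rewrite divr_gt0.
have [p [pk pq]] := happ _ d0.
have H : ((beta - e / c)%:E * A <= \int[area]_q (G q * W (nsq q))%:E + (e / c)%:E * B)%E.
  apply: (@le_trans _ _ ((cmod p`_k)%:E * A)%E); first by rewrite lee_wpmul2r// lee_fin.
  rewrite -ge0_integralZl//; last 3 first.
  - exact/measurable_EFinP.
  - by move=> q _; rewrite lee_fin.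
  - by rewrite lee_fin cmod_ge0.
  rewrite -ge0_integralZl//; last 3 first.
  - exact/measurable_EFinP.
  - by move=> q _; rewrite lee_fin.
  - by rewrite lee_fin ltW.
  rewrite -ge0_integralD//; last 4 first.
  - by move=> q _; rewrite lee_fin mulr_ge0.
  - exact/measurable_EFinP.
  - by move=> q _; rewrite -EFinM lee_fin mulr_ge0// ltW.
  - by under eq_fun do rewrite -EFinM; apply/measurable_EFinP; exact: measurable_funM.
  apply: (@le_trans _ _ (\int[area]_q (cmod p.[zof q] * W (nsq q))%:E)%E).
    apply: le_trans (@coef_mean R p k W mW Wge); rewrite le_eqVlt; apply/orP; left.
    by apply/eqP/eq_integral => q _; rewrite -mulrA EFinM.
  apply: ge0_le_integral => //.
  - by move=> q _; rewrite lee_fin mulr_ge0// cmod_ge0.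
  - apply/measurable_EFinP; apply: measurable_funM => //.
    by apply: cmeas_cmod; exact: cmeas_horner.
  - under eq_fun do rewrite -EFinM -EFinD; apply/measurable_EFinP.
    by apply: measurable_funD => //; exact: measurable_funM.
  - move=> q _; rewrite -EFinM -EFinD lee_fin -mulrDl.
    have [q1|q1] := ltP (nsq q) u0; first by rewrite ler_wpM2r// pq.
    by rewrite W0// !mulr0.
have I0 : (0 <= \int[area]_q (G q * W (nsq q))%:E)%E.
  by apply: integral_ge0 => q _; rewrite lee_fin mulr_ge0.
move: H I0; case: (\int[area]_q (G q * W (nsq q))%:E)%E => [I|//|//].
  rewrite Af Bf -!EFinM -!EFinD !lee_fin => H _.
  have : e / c * (fine A + fine B) <= e.
    by rewrite mulrAC ler_pdivrMr// ler_wpM2l ?(ltW e0)// /c; lra.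
  by move: H; rewrite mulrBl mulrDr; lra.
by move=> _ _; rewrite addye// leey.
Qed.

Lemma horner_psum_unif b (r e : R) k : subexp (fun k => cmod (b k)) -> 0 <= r < 1 ->
  0 < e -> exists p : {poly cplx R}, p`_k = b k /\
    forall z, cmod z <= r -> cmod (psum b z - p.[z]) <= e.
Proof.
move=> sb r01 e0.
have [N HN] := psum_unif sb r01 e0.
(* The length is at least k + 1, so that the k-th coefficient is exactly that of the series. *)
exists (\poly_(i < maxn N k.+1) b i); split.
  by rewrite coef_poly leq_max ltnSn orbT.
by move=> z zr; rewrite horner_poly; apply: HN => //; exact: leq_maxl.
Qed.

End mean_values.

(** * Local mean values and coefficient growth *)

Section embedding.
Context {R : realType}.
Local Notation leb := (@lebesgue_measure R).
Local Notation area := (leb \x leb)%E.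
Implicit Types (a b : nat -> cplx R).

Definition near_disc (s : R) : set (R * R) :=
  [set q | nsq (q.1 - s, q.2) < ((1 - s) / 2) ^+ 2].

(** The triangle inequality around the centre s: with a radius of half of 1 - s, the distance to the
    circle stays comparable to 1 - s on the whole disc. *)
Lemma near_discP s q : s < 1 -> near_disc s q ->
  (1 - s) / 2 < 1 - cmod (zof q) < 3 * (1 - s) / 2 \/ s < 0.
Proof.
move=> s1; rewrite /near_disc/= => h.
have [s0|s0] := ltP s 0; [by right|left].
have {}h : cmod (zof q - ofreal s) < (1 - s) / 2.
  rewrite -(@ltr_pXn2r _ 2) ?nnegrE ?cmod_ge0 ?divr_ge0 ?subr_ge0 ?(ltW s1)//.
  by rewrite cmod_sqr ReD ImD ReN ImN /= subr0.
have := cmod_triangle (zof q) (ofreal s).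
have := cmod_triangle (ofreal s) (zof q).
rewrite (cmodC (ofreal s)) cmod_real ger0_norm// => h1 h2.
by apply/andP; split; lra.
Qed.

Lemma measurable_near_disc s : measurable (near_disc s).
Proof.
apply: (measurable_lt_set (f := fun q : R * R => nsq (q.1 - s, q.2))
  (g := cst (((1 - s) / 2) ^+ 2))) => //.
rewrite /nsq/=; apply: measurable_funD; apply: measurable_funX => //.
by apply: measurable_funB => //; exact: measurable_fst.
Qed.

Lemma near_disc_sub s : 0 <= s < 1 -> near_disc s `<=` @disc R.
Proof.
move=> /andP[s0 s1] q /(near_discP s1)[/andP[h _]|]; last by rewrite ltNge s0.
rewrite /disc/= -/(nsq q) -cmod_zof_sqr.
have := cmod_ge0 (zof q); nra.
Qed.

(** The case k = 0 of [approx_mean], for the function translated to s and the indicator weight of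
    the small disc. All points involved satisfy |z| <= (1 + s) / 2 < 1, where polynomials
    approximate uniformly; they are translated by composition with X + s. *)
Lemma submean b s : subexp (fun k => cmod (b k)) -> 0 <= s < 1 ->
  ((cmod (psum b (ofreal s)) * (((1 - s) / 2) ^+ 2 * disc_area))%:E <=
   \int[area]_(q in near_disc s) (cmod (psum b (zof q)))%:E)%E.
Proof.
move=> sb s01; have /andP[s0 s1] := s01.
set rho := (1 - s) / 2; set u0 := rho ^+ 2.
have r0 : 0 < rho by rewrite /rho; lra.
have u00 : 0 <= u0 by rewrite exprn_ge0// ltW.
have u01 : u0 <= 1 by rewrite exprn_ile1 ?(ltW r0)// /rho; lra.
pose W := (\1_[set u | u < u0] : R -> R).
have mW : measurable_fun setT W.
  apply: measurable_indic.
  exact: (measurable_lt_set (f := fun x : R => x) (g := cst u0) (@measurable_id _ _ _) (measurable_cst _)).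
have WM x : 0 <= W x <= 1 by rewrite /W indicE; case: (_ \in _); rewrite ?lexx ler01.
have W0 x : u0 <= x -> W x = 0.
  by move=> x1; rewrite /W indicE memNset//=; apply/negP; rewrite -leNgt.
pose G (q : R * R) := cmod (psum b (ofreal s + zof q)).
have wlt (q : R * R) : nsq q < u0 -> cmod (ofreal s + zof q) <= (1 + s) / 2.
  move=> q1; apply: le_trans (cmodD _ _) _; rewrite cmod_real ger0_norm//.
  suff : cmod (zof q) < rho by rewrite /rho; lra.
  by rewrite -(@ltr_pXn2r _ 2) ?nnegrE ?cmod_ge0 ?(ltW r0)// cmod_zof_sqr.
have mGW : measurable_fun setT (fun q => G q * W (nsq q)).
  under [fun x => _]eq_fun do rewrite mulrC.
  apply: (@measurable_indicM _ _ _ [set q : R * R | nsq q < u0]).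
    exact: measurable_nsq_lt.
  apply: cmeas_cmod; apply: cmeas_psum => //.
    by move=> q /wlt h; apply: le_lt_trans h _; lra.
  by apply: cmeasD; [exact: cmeas_cst|exact: cmeas_zof].
have := @approx_mean R G 0 (cmod (psum b (ofreal s))) u0 1 W mW WM u01 W0 _ mGW _.
move=> /(_ (fun=> cmod_ge0 _)) H.
have {}H := H _.
have -> : (\int[area]_(q in near_disc s) (cmod (psum b (zof q)))%:E =
   \int[area]_q (G q * W (nsq q))%:E)%E.
  rewrite int_restrict.
  pose F (q : R * R) := (\1_(near_disc s) q * cmod (psum b (zof q)))%:E.
  rewrite -(@area_translate R F s).
  - apply: eq_integral => q _.
    have E1 : zof (q.1 + s, q.2) = ofreal s + zof q.
      by apply/eqP; rewrite eq_complex /= addrC add0r !eqxx.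
    have E2 : \1_(near_disc s) (q.1 + s, q.2) = W (nsq q).
      rewrite /W !indicE; congr (_%:R); congr nat_of_bool.
      by apply/idP/idP; rewrite !inE /near_disc /= addrK.
    by rewrite /F E1 E2 mulrC.
  - apply/measurable_EFinP/measurable_indicM; first exact: measurable_near_disc.
    apply: measurable_funS (measurable_cmod_psum sb); first exact: measurable_disc.
    exact: near_disc_sub.
  - by move=> q; rewrite lee_fin mulr_ge0// cmod_ge0.
apply: le_trans (H _).
  rewrite EFinM lee_wpmul2l ?lee_fin ?cmod_ge0//.
  under eq_integral do rewrite expr0 mul1r.
  rewrite -area_nsq_lt//.
  rewrite (_ : (fun q : R * R => (W (nsq q))%:E) = (fun q => (\1_[set q : R * R | nsq q < u0] q)%:E))//.
  by rewrite integral_indic// ?setIT//; exact: measurable_nsq_lt.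
move=> e e0.
have [|P [_ HP]] := @horner_psum_unif R b ((1 + s) / 2) e 0 sb _ e0.
  by apply/andP; split; lra.
have Pw (w : cplx R) : (P \Po ('X + (ofreal s)%:P)).[w] = P.[ofreal s + w].
  by rewrite horner_comp hornerD hornerX hornerC addrC.
exists (P \Po ('X + (ofreal s)%:P)); split.
  rewrite -horner_coef0 Pw addr0.
  have h : cmod (ofreal s) <= (1 + s) / 2 by rewrite cmod_real ger0_norm//; lra.
  have := HP _ h; have := cmod_triangle (psum b (ofreal s)) P.[ofreal s]; lra.
move=> q /wlt h; rewrite Pw /G.
have := HP _ h; rewrite cmodC.
have := cmod_triangle P.[ofreal s + zof q] (psum b (ofreal s + zof q)); lra.
Qed.

(** The weight is cut down to the annulus 1 - h <= |z|^2 < 1 - h/2 with h = 1 / (2 (k + 1)). There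
    |z|^k >= (1 - h)^k >= 1/2 by Bernoulli, the weight is at least h^al, and the area is h/2 times
    that of the disc. The outer cut keeps the weight bounded and leaves room for uniform
    approximation. *)
Lemma coef_bound (al : R) b k : al < 0 -> subexp (fun k => cmod (b k)) ->
  ((cmod (b k) * (disc_area / 4 * ((2 * k.+1%:R)^-1) `^ (al + 1)))%:E <=
   \int[area]_(q in @disc R) ((1 - nsq q) `^ al * cmod (psum b (zof q)))%:E)%E.
Proof.
move=> al0 sb; set h := (2 * k.+1%:R)^-1.
have n1 : 1 <= k.+1%:R :> R by rewrite ler1n.
have h0 : 0 < h by rewrite invr_gt0; lra.
have hk : h * k.+1%:R = 2^-1.
  by rewrite /h invfM -mulrA mulVf ?mulr1// pnatr_eq0.
have h1 : h <= 2^-1 by rewrite -hk ler_peMr// ltW.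
pose S := [set u : R | u < 1 - h / 2] `&` [set u | 1 - h <= u].
pose S' := [set q : R * R | nsq q < 1 - h / 2] `&` [set q | 1 - h <= nsq q].
have mS : measurable S.
  apply: measurableI.
    exact: (measurable_lt_set (f := fun x : R => x) (g := cst (1 - h / 2)) (@measurable_id _ _ _) (measurable_cst _)).
  exact: (measurable_le_set (f := cst (1 - h)) (g := fun x : R => x) (measurable_cst _) (@measurable_id _ _ _)).
have mS' : measurable S'.
  apply: measurableI; first exact: measurable_nsq_lt.
  by apply: (measurable_le_set (f := cst (1 - h)) (g := @nsq R)) => //; exact: measurable_nsq.
have S'E q : \1_S (nsq q) = \1_S' q :> R.
  by rewrite !indicE; congr (_%:R); congr nat_of_bool; apply/idP/idP; rewrite !inE.
pose W (u : R) : R := \1_S u * (1 - u) `^ al.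
have mW : measurable_fun setT W.
  apply: measurable_funM; first exact: measurable_indic.
  apply: (@measurableT_comp _ _ _ _ _ _ (fun x : R => x `^ al)).
    exact: measurable_powR.
  exact: measurable_funB.
have WM x : 0 <= W x <= (h / 2) `^ al.
  rewrite /W indicE; case: (boolP (x \in S)) => [|_].
    rewrite inE mul1r powR_ge0/= => -[/= x1 x2].
    by apply: powR_anti; [exact: ltW|lra|lra].
  by rewrite mul0r lexx powR_ge0.
have W0 x : 1 - h / 2 <= x -> W x = 0.
  by move=> x1; rewrite /W indicE memNset ?mul0r//= => -[/=]; rewrite ltNge x1.
pose G (q : R * R) := cmod (psum b (zof q)).
have S'disc : S' `<=` @disc R.
  by move=> q [/= q1 _]; rewrite /disc/= -/(nsq q); lra.
have mG : measurable_fun S' G.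
  by apply: measurable_funS (measurable_cmod_psum sb) => //; exact: measurable_disc.
have mGW : measurable_fun setT (fun q => G q * W (nsq q)).
  have : measurable_fun setT (fun q => \1_S' q * (G q * (1 - nsq q) `^ al)).
    apply: measurable_indicM => //; apply: measurable_funM => //.
    exact: measurable_weight.
  by apply: eq_measurable_fun => q _; rewrite /W S'E; ring.
have u01 : 1 - h / 2 <= 1 by lra.
set r := Num.sqrt (1 - h / 2).
have r2 : r ^+ 2 = 1 - h / 2 by rewrite sqr_sqrtr; lra.
have r01 : 0 <= r < 1.
  rewrite sqrtr_ge0/= -(@ltr_pXn2r _ 2) ?nnegrE ?sqrtr_ge0// r2 expr1n; lra.
have happ e : 0 < e -> exists p : {poly cplx R}, cmod (b k) - e <= cmod p`_k /\
     forall q, nsq q < 1 - h / 2 -> cmod p.[zof q] <= G q + e.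
  move=> e0; have [p [pk pz]] := horner_psum_unif k sb r01 e0.
  exists p; split; first by rewrite pk; lra.
  move=> q q1; have qr : cmod (zof q) <= r.
    have /andP[rr _] := r01.
    by rewrite -(@ler_pXn2r _ 2) ?nnegrE ?cmod_ge0// cmod_zof_sqr r2 ltW.
  have := pz _ qr; rewrite cmodC.
  have := cmod_triangle p.[zof q] (psum b (zof q)); rewrite /G; lra.
have H := approx_mean mW WM u01 W0 (fun=> cmod_ge0 _) mGW happ.
apply: le_trans (le_trans H _); last first.
  rewrite [X in (_ <= X)%E]int_restrict; apply: ge0_le_integral => //.
  - move=> q _; rewrite lee_fin mulr_ge0 ?cmod_ge0//.
    by have /andP[] := WM (nsq q).
  - exact/measurable_EFinP.
  - apply/measurable_EFinP/measurable_indicM; first exact: measurable_disc.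
    by apply: measurable_funM; [exact: measurable_weight|exact: measurable_cmod_psum].
  - move=> q _; rewrite lee_fin /W S'E mulrCA (mulrC (G q)).
    rewrite ler_wpM2r ?mulr_ge0 ?powR_ge0 ?cmod_ge0// !indicE.
    case: (boolP (q \in S')) => [|_]; last by rewrite ler0n.
    by rewrite inE => /S'disc dq; rewrite mem_set.
rewrite EFinM lee_wpmul2l ?lee_fin ?cmod_ge0//.
have aS' : area S' = (h / 2 * disc_area)%:E.
  have -> : S' = [set q | nsq q < 1 - h / 2] `\` [set q | nsq q < 1 - h].
    apply/seteqP; split=> q /= [q1 q2]; split => //; first by apply/negP; rewrite -leNgt.
    by move/negP: q2; rewrite -leNgt.
  rewrite measureD//=; last 3 first.
  - exact: measurable_nsq_lt.
  - exact: measurable_nsq_lt.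
  - by rewrite area_nsq_lt ?ltry//; lra.
  rewrite setIidr; last by move=> q /=; lra.
  rewrite !area_nsq_lt; [|by lra|by lra].
  by rewrite -EFinB; congr EFin; field.
apply: (@le_trans _ _ (\int[area]_q ((2^-1 * h `^ al)%:E * (\1_S' q)%:E))%E).
  rewrite ge0_integralZl//; last 2 first.
  - by apply/measurable_EFinP; exact: measurable_indic.
  - by rewrite lee_fin mulr_ge0// powR_ge0.
  rewrite integral_indic// setIT.
  apply: (@le_trans _ _ ((2^-1 * h `^ al)%:E * (h / 2 * disc_area)%:E)%E); last by rewrite -aS'.
  rewrite -EFinM lee_fin powRD ?(gt_eqF h0) ?implybT// powRr1 ?(ltW h0)//.
  rewrite le_eqVlt; apply/orP; left; apply/eqP; by field.
apply: ge0_le_integral => //.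
- by move=> q _; rewrite -EFinM lee_fin !mulr_ge0// powR_ge0.
- under eq_fun do rewrite -EFinM; apply/measurable_EFinP; exact: measurable_funM.
- apply/measurable_EFinP; apply: measurable_funM; last exact: measurable_nsq_comp.
  by apply: measurable_funX; apply: cmeas_cmod; exact: cmeas_zof.
- move=> q _; rewrite -EFinM lee_fin /W S'E indicE.
  case: (boolP (q \in S')) => [|_]; last by rewrite !mul0r !mulr0.
  rewrite inE mulr1 mul1r => -[/= q1 q2].
  apply: ler_pM; rewrite ?powR_ge0//; last first.
    by apply: powR_anti; [exact: ltW|lra|lra].
  apply: (@le_trans _ _ ((1 - h) ^+ k)).
    have hN : -1 <= - h by lra.
    apply: le_trans (bernoulli k hN).
    have : k%:R * h <= 2^-1 by rewrite -hk mulrC ler_wpM2l ?(ltW h0)// ler_nat.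
    lra.
  apply: (@le_trans _ _ (nsq q ^+ k)).
    by rewrite lerXn2r ?nnegrE//; [lra|exact: nsq_ge0].
  rewrite lerXn2r ?nnegrE ?nsq_ge0 ?cmod_ge0// -cmod_zof_sqr expr2 ler_piMl ?cmod_ge0//.
  by apply: ltW; apply: nsq_lt1_cmod; lra.
Qed.

End embedding.

(** * Planar Lebesgue measure as one factor of a further product *)

Section planar_measure.
Context {R : realType}.
Local Notation leb := (@lebesgue_measure R).

(** A named copy of the product measure, to carry the sigma-finite structure under which Tonelli
    exchanges a planar variable with a third real one. *)
Definition planar_measure :
  set (measurableTypeR R * measurableTypeR R) -> \bar R := (leb \x leb)%E.

HB.instance Definition _ := Measure.on planar_measure.

Lemma planar_sigma_finite : sigma_finite setT planar_measure.
Proof.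
have /sigma_finiteP[F [TF ndF Foo]] := sigma_finiteT leb.
exists (fun n => F n `*` F n).
  rewrite -setXTT TF predeqE => -[x y]; split.
    move=> [/= [n _ Fnx] [k _ Gky]]; exists (maxn n k) => //; split.
    - by move: x Fnx; exact/subsetPset/ndF/leq_maxl.
    - by move: y Gky; exact/subsetPset/ndF/leq_maxr.
  by move=> [n _ []/= ? ?]; split; exists n.
move=> k; have [mF FF] := Foo k.
split; first exact: measurableX.
by rewrite /planar_measure product_measure1E// lte_mul_pinfty// ge0_fin_numE.
Qed.

HB.instance Definition _ := Measure_isSigmaFinite.Build _ _ _ planar_measure
  planar_sigma_finite.

End planar_measure.

(** * From the area integral to the radial integral *)

Section radial_embedding.
Context {R : realType}.
Local Notation leb := (@lebesgue_measure R).
Local Notation area := (leb \x leb)%E.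
Implicit Types (a b : nat -> cplx R).

Lemma measurable_near_pairs :
  measurable [set x : R * (R * R) | near_disc x.1 x.2].
Proof.
apply: (measurable_lt_set (f := fun x : R * (R * R) => nsq (x.2.1 - x.1, x.2.2))
  (g := fun x : R * (R * R) => ((1 - x.1) / 2) ^+ 2)).
  rewrite /nsq/=; apply: measurable_funD; apply: measurable_funX => /=.
    apply: measurable_funB; last exact: measurable_fst.
    exact: (measurableT_comp measurable_fst measurable_snd).
  exact: (measurableT_comp measurable_snd measurable_snd).
apply: measurable_funX; apply: measurable_funM => //.
by apply: measurable_funB => //; exact: measurable_fst.
Qed.

(** With d = 1 - |z|, [near_discP] confines s to an interval of length 4 d / 3, on which 1 / (1 - s)
    is at most 3 / (2 d); the product is 2. *)
Lemma near_int (q : R * R) : @disc R q ->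
  (\int[leb]_s (\1_(`[0%R, 1%R[) s * \1_[set x : R * (R * R) | near_disc x.1 x.2] (s, q)
      * (1 - s)^-1)%:E <= 2%:E)%E.
Proof.
move=> dq; set d := 1 - cmod (zof q).
have d0 : 0 < d by rewrite subr_gt0 nsq_lt1_cmod.
pose I := `](1 - 2 * d), (1 - 2 * d / 3)[%classic.
have mI : measurable I by exact: measurable_itv.
apply: (@le_trans _ _ (\int[leb]_s ((3 / (2 * d))%:E * (\1_I s)%:E))%E); last first.
  rewrite ge0_integralZl//; last 2 first.
  - by apply/measurable_EFinP; apply: measurable_indic; exact: measurable_itv.
  - by rewrite lee_fin divr_ge0// mulr_ge0// ltW.
  have LI : leb I = (4 * d / 3)%:E.
    rewrite /I lebesgue_measure_itv/= lte_fin ifT; last by lra.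
    by rewrite -EFinB; congr EFin; field.
  rewrite integral_indic// setIT.
  apply: (@le_trans _ _ ((3 / (2 * d))%:E * (4 * d / 3)%:E)%E); first by rewrite -LI.
  rewrite -EFinM lee_fin le_eqVlt; apply/orP; left; apply/eqP.
  by field; rewrite gt_eqF.
apply: ge0_le_integral => //.
- move=> s _; rewrite lee_fin indicE; case: (boolP (s \in _)) => [|_]; last by rewrite !mul0r.
  by rewrite inE/= in_itv/= => /andP[s0 s1]; rewrite !mulr_ge0// invr_ge0 subr_ge0 ltW.
- apply/measurable_EFinP; apply: measurable_funM; last first.
    by apply: measurable_funV; exact: measurable_funB.
  apply: measurable_funM; first by apply: measurable_indic; exact: measurable_itv.
  have mN : measurable_fun setT (\1_[set x : R * (R * R) | near_disc x.1 x.2] : R * (R * R) -> R).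
    by apply: measurable_indic; exact: measurable_near_pairs.
  exact: (measurableT_comp mN (measurable_pair2 q)).
- under eq_fun do rewrite -EFinM; apply/measurable_EFinP; exact: measurable_funM.
- move=> s _; rewrite -EFinM lee_fin !indicE.
  case: (boolP (s \in `[0%R, 1%R[%classic)) => [|_]; last first.
    by rewrite !mul0r mulr_ge0// divr_ge0// mulr_ge0// ltW.
  rewrite inE/= in_itv/= => /andP[s0 s1].
  case: (boolP ((s, q) \in _)) => [|_]; last first.
    by rewrite mulr0 mul0r mulr_ge0// divr_ge0// mulr_ge0// ltW.
  rewrite inE/= => /(near_discP s1)[/andP[h1 h2]|]; last by rewrite ltNge s0.
  rewrite mem_set ?mulr1 ?mul1r; last first.
    by rewrite /I/= in_itv/=; apply/andP; split; rewrite /d; lra.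
  rewrite -[leRHS]invrK lef_pV2 ?posrE ?invr_gt0 ?divr_gt0 ?mulr_gt0 ?subr_gt0//.
    by rewrite invf_div ler_pdivrMr//; rewrite /d; lra.
  exact: nsq_lt1_cmod.
Qed.

(** [submean] replaces |f(s)| by an average over the disc around s, and Tonelli leaves for each z
    the integral over the admissible s, which [near_int] bounds by 2. The factor 4 / [disc_area]
    normalizes the average, and 3^(-al) compares the weights at s and at z. *)
Lemma radial_carleson (al : R) : -1 < al < 0 -> exists2 K, 0 < K &
  forall b, subexp (fun k => cmod (b k)) ->
  (\int[leb]_(s in `[0%R, 1%R[) (cmod (psum b (ofreal s)) * (1 - s) `^ (al + 1))%:E <=
   K%:E * \int[area]_(q in @disc R) ((1 - nsq q) `^ al * cmod (psum b (zof q)))%:E)%E.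
Proof.
move=> /andP[al1 al0].
have c0 : 0 < disc_area :> R := disc_area_gt0.
have A0 : 0 < 4 / disc_area * 3 `^ (- al) :> R.
  by rewrite mulr_gt0// ?divr_gt0// powR_gt0.
set A := 4 / disc_area * 3 `^ (- al) in A0.
exists (A * 2); first by rewrite mulr_gt0.
move=> b sb.
pose g (q : R * R) := (1 - nsq q) `^ al * cmod (psum b (zof q)).
have g0 q : 0 <= g q by rewrite mulr_ge0 ?powR_ge0 ?cmod_ge0.
have mg : measurable_fun (@disc R) g.
  by apply: measurable_funM; [exact: measurable_weight|exact: measurable_cmod_psum].
pose g1 (q : R * R) : R := \1_(@disc R) q * g q.
have mg1 : measurable_fun setT g1 by apply: measurable_indicM => //; exact: measurable_disc.
have g10 q : 0 <= g1 q by rewrite mulr_ge0.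
pose N := [set x : R * (R * R) | near_disc x.1 x.2].
(* The power (1 - s)^(al+1) is distributed: (1 - s)^2 is spent on the area of the small disc, (1 -
   s)^al becomes the weight at z, and (1 - s)^-1 stays here. All domains are put into indicators so
   that Tonelli applies on the whole product. *)
pose Phi (x : R * (R * R)) : \bar R :=
  (\1_(`[0%R, 1%R[) x.1 * \1_N x * (1 - x.1)^-1 * g1 x.2)%:E.
have mPhi : measurable_fun setT Phi.
  apply/measurable_EFinP; apply: measurable_funM; last exact: (measurableT_comp mg1 measurable_snd).
  apply: measurable_funM; last first.
    by apply: measurable_funV; apply: measurable_funB => //; exact: measurable_fst.
  apply: measurable_funM; last by apply: measurable_indic; exact: measurable_near_pairs.
  have mi : measurable_fun setT (\1_(`[0%R, 1%R[) : R -> R).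
    by apply: measurable_indic; exact: measurable_itv.
  exact: (measurableT_comp mi measurable_fst).
have h0 (s : R) (r : R) : 0 <= r -> 0 <= \1_(`[0%R, 1%R[) s * r * (1 - s)^-1.
  move=> r0; rewrite indicE; case: (boolP (s \in _)) => [|_]; last by rewrite !mul0r.
  by rewrite inE/= in_itv/= => /andP[s0 s1]; rewrite !mulr_ge0// invr_ge0 subr_ge0 ltW.
have Phi0 x : (0 <= Phi x)%E by rewrite lee_fin mulr_ge0// h0.
have step1 s : `[0%R, 1%R[%classic s ->
    ((cmod (psum b (ofreal s)) * (1 - s) `^ (al + 1))%:E <= A%:E * \int[area]_q Phi (s, q))%E.
  move=> /=; rewrite in_itv/= => s01; have /andP[s0 s1] := s01.
  have e0 : 0 < 1 - s by rewrite subr_gt0.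
  have H := submean sb s01.
  have -> : cmod (psum b (ofreal s)) * (1 - s) `^ (al + 1) =
      4 / disc_area * (1 - s) `^ (al - 1) *
      (cmod (psum b (ofreal s)) * (((1 - s) / 2) ^+ 2 * disc_area)).
    have -> : al + 1 = (al - 1) + 2 by ring.
    rewrite powRD; last by rewrite (gt_eqF e0) implybT.
    rewrite powR_mulrn ?(ltW e0)//; field; rewrite gt_eqF//.
  rewrite EFinM; apply: (@le_trans _ _ ((4 / disc_area * (1 - s) `^ (al - 1))%:E *
      \int[area]_(q in near_disc s) (cmod (psum b (zof q)))%:E)%E).
    by apply: lee_wpmul2l => //; rewrite lee_fin mulr_ge0 ?powR_ge0// divr_ge0// ltW.
  have mnd := measurable_near_disc s.
  have mpn : measurable_fun (near_disc s) (fun q => cmod (psum b (zof q))).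
    apply: measurable_funS (measurable_cmod_psum sb); first exact: measurable_disc.
    exact: near_disc_sub.
  rewrite -ge0_integralZl//; last 3 first.
  - exact/measurable_EFinP.
  - by move=> q _; rewrite lee_fin cmod_ge0.
  - by rewrite lee_fin mulr_ge0 ?powR_ge0// divr_ge0// ltW.
  have -> : (A%:E * \int[area]_q Phi (s, q) = \int[area]_q (A%:E * Phi (s, q)))%E.
    apply/esym/ge0_integralZl; [exact: measurableT| |by move=> q _; exact: Phi0|].
      exact: (measurableT_comp mPhi (measurable_pair1 s)).
    by rewrite lee_fin ltW.
  under eq_integral do rewrite -EFinM.
  rewrite int_restrict.
  apply: ge0_le_integral => //.
  - move=> q _; rewrite lee_fin !mulr_ge0 ?powR_ge0 ?cmod_ge0//.
    by rewrite invr_ge0 ltW.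
  - by apply/measurable_EFinP/measurable_indicM => //; exact: measurable_funM.
  - apply: measurable_funeM; exact: (measurableT_comp mPhi (measurable_pair1 s)).
  move=> q _; rewrite /Phi -EFinM lee_fin/=.
  have -> : \1_(`[0%R, 1%R[) s = 1 :> R by rewrite indicE mem_set//= in_itv/= s0 s1.
  rewrite mul1r.
  have -> : \1_N (s, q) = \1_(near_disc s) q :> R.
    by rewrite !indicE; congr (_%:R); congr nat_of_bool; apply/idP/idP; rewrite !inE.
  rewrite indicE; case: (boolP (q \in near_disc s)) => [|_]; last by rewrite !mul0r mulr0.
  rewrite inE => nq; have dq := near_disc_sub s01 nq.
  have [/andP[h1 h2]|] := near_discP s1 nq; last by rewrite ltNge s0.
  rewrite /g1 /g indicE mem_set// !mul1r.
  have v0 : 0 < 1 - nsq q by rewrite subr_gt0.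
  (* 1 - |z|^2 <= 2 (1 - |z|), and 1 - |z| < 3 (1 - s) / 2 on the small disc. *)
  have v3 : 1 - nsq q <= 3 * (1 - s).
    by rewrite -cmod_zof_sqr; have := cmod_ge0 (zof q); nra.
  have vp : (3 * (1 - s)) `^ al <= (1 - nsq q) `^ al by apply: powR_anti => //; exact: ltW.
  have -> : (1 - s) `^ (al - 1) = 3 `^ (- al) * (3 * (1 - s)) `^ al * (1 - s)^-1.
    rewrite powRB; last by rewrite (gt_eqF e0) implybT.
    rewrite powRr1 ?(ltW e0)// powRM ?(ltW e0)// mulrA -powRD ?addNr ?powRr0 ?mul1r//.
    by rewrite eqxx implyTb.
  rewrite /A.
  rewrite [leLHS](_ : _ = 4 / disc_area * 3 `^ (- al) * ((1 - s)^-1 *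
    ((3 * (1 - s)) `^ al * cmod (psum b (zof q))))); last by ring.
  by rewrite ler_wpM2l ?(ltW A0)// ler_wpM2l ?invr_ge0 ?(ltW e0)// ler_wpM2r ?cmod_ge0.
clearbody A.
have mIn : measurable_fun setT (fun s : R => \int[area]_q Phi (s, q))%E.
  have := @measurable_fun_fubini_tonelli_F _ _ (measurableTypeR R) _ R planar_measure Phi mPhi Phi0.
  exact.
have sub01 : (`[0%R, 1%R[%classic : set R) `<=` `]-1, 1[%classic.
  by move=> x /=; rewrite !in_itv/= => /andP[x0 ->]; rewrite andbT; lra.
apply: (@le_trans _ _ (\int[leb]_(s in `[0%R, 1%R[) (A%:E * \int[area]_q Phi (s, q)))%E).
  apply: ge0_le_integral => //.
  - by move=> s _; rewrite lee_fin mulr_ge0 ?powR_ge0 ?cmod_ge0.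
  - apply/measurable_EFinP; apply: measurable_funM; first exact: cmod_psum_lt1.
    apply: measurable_funTS.
    apply: (@measurableT_comp _ _ _ _ _ _ (fun x : R => x `^ (al + 1))); first exact: measurable_powR.
    exact: measurable_funB.
  - by apply: measurable_funTS; exact: measurable_funeM.
rewrite ge0_integralZl//; last 3 first.
- exact: measurable_funTS.
- by move=> s _; apply: integral_ge0.
- by rewrite lee_fin ltW.
rewrite EFinM -muleA; apply: lee_wpmul2l; first by rewrite lee_fin ltW.
apply: (@le_trans _ _ (\int[leb]_s \int[area]_q Phi (s, q))%E).
  apply: ge0_subset_integral => //.
  by move=> s _; apply: integral_ge0.
have -> : (\int[leb]_s \int[area]_q Phi (s, q) = \int[area]_q \int[leb]_s Phi (s, q))%E.
  exact: (@fubini_tonelli _ _ _ _ R leb planar_measure Phi mPhi Phi0).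
rewrite int_restrict -/g.
have -> : (2%:E * \int[area]_q (g1 q)%:E = \int[area]_q (2%:E * (g1 q)%:E))%E.
  apply/esym/ge0_integralZl; [exact: measurableT|exact/measurable_EFinP| |by []].
  by move=> q _; rewrite lee_fin; exact: g10.
apply: ge0_le_integral.
- exact: measurableT.
- by move=> q _; apply: integral_ge0.
- have := @measurable_fun_fubini_tonelli_G _ _ _ (measurableTypeR R * measurableTypeR R)%type R leb Phi mPhi Phi0.
  exact.
- by apply: measurable_funeM; exact/measurable_EFinP.
move=> q _; rewrite /Phi/=.
under eq_integral do rewrite EFinM.
rewrite ge0_integralZr//; last 3 first.
- apply/measurable_EFinP; apply: measurable_funM; last first.
    by apply: measurable_funV; exact: measurable_funB.
  apply: measurable_funM; first by apply: measurable_indic; exact: measurable_itv.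
  have mN : measurable_fun setT (\1_N : R * (R * R) -> R).
    by apply: measurable_indic; exact: measurable_near_pairs.
  exact: (measurableT_comp mN (measurable_pair2 q)).
- by move=> s _; rewrite lee_fin h0.
- by rewrite lee_fin.
rewrite /g1 indicE; case: (boolP (q \in @disc R)) => [|_]; last by rewrite !mul0r !mule0.
rewrite inE => dq; rewrite mul1r; apply: lee_wpmul2r; first by rewrite lee_fin.
exact: near_int.
Qed.

End radial_embedding.

(** * Integrals against a Carleson measure on [0, 1) *)

Section carleson_measures.
Context {R : realType} (mu : {finite_measure set R -> \bar R}).
Local Notation leb := (@lebesgue_measure R).
Local Notation area := (leb \x leb)%E.
Local Notation I01 := (`[0%R, 1%R[%classic : set R).
Implicit Types (a b : nat -> cplx R).

Lemma carleson_fun_mu : carleson mu ->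
  exists2 C, 0 < C & carleson_fun mu I01 (fun t => 1 - t) C.
Proof.
move=> [C [C0 HC]]; exists C => //; split.
- exact: measurable_itv.
- exact: measurable_funB.
- by move=> t /=; rewrite in_itv/= => /andP[_]; rewrite subr_gt0.
- move=> h h0; have [h1|h1] := leP h 1.
    have h01 : 0 <= 1 - h < 1 by apply/andP; split; lra.
    have := HC _ h01; rewrite (_ : 1 - (1 - h) = h); last by ring.
    apply: le_trans; rewrite le_eqVlt; apply/orP; left; apply/eqP; congr (mu _).
    apply/seteqP; split=> t /=; rewrite !in_itv/=.
      by move=> [/andP[t0 t1] th]; apply/andP; split; lra.
    by move=> /andP[t0 t1]; split; [apply/andP; split|]; lra.
  have h01 : 0 <= (0 : R) < 1 by rewrite lexx ltr01.
  apply: (@le_trans _ _ (mu I01)).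
    apply: le_measure; rewrite ?inE; [|exact: measurable_itv|by []].
    apply: measurableI; first exact: measurable_itv.
    by apply: (measurable_le_set (f := fun t : R => 1 - t) (g := cst h)) => //; exact: measurable_funB.
  apply: le_trans (HC _ h01) _; rewrite lee_fin subr0 mulr1 ler_pMr//.
  exact: ltW.
Qed.

(** The small-distance estimate, cut at 1 - t <= 1 - s. It is applied with the exponent of the
    weight and again with an exponent -b, where it yields the decay of the moments. *)
Lemma mu_tail (al : R) : carleson mu -> -1 < al <= 0 -> exists2 K, 0 < K &
  forall s, 0 <= s < 1 ->
  (\int[mu]_(t in `[s, 1%R[) ((1 - t) `^ al)%:E <= (K * (1 - s) `^ (al + 1))%:E)%E.
Proof.
move=> /carleson_fun_mu[C C0 HC] al01.
have [K K0 HK] := carleson_fun_small mu al01.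
exists (C * K); first by rewrite mulr_gt0.
move=> s /andP[s0 s1]; have e0 : 0 < 1 - s by rewrite subr_gt0.
have := HK _ _ _ _ (ltW C0) HC e0; congr (_ <= _)%E; congr (integral _ _ _).
apply/seteqP; split=> t /=; rewrite !in_itv/=.
  by move=> [/andP[t0 t1] th]; apply/andP; split; lra.
by move=> /andP[t0 t1]; split; [apply/andP; split|]; lra.
Qed.

Let sub01 : I01 `<=` `]-1, 1[%classic.
Proof. by move=> x /=; rewrite !in_itv/= => /andP[x0 ->]; rewrite andbT; lra. Qed.

Let measurable_psum01 b : subexp (fun k => cmod (b k)) ->
  measurable_fun I01 (fun t => cmod (psum b (ofreal t))).
Proof. by move=> sb; exact: cmod_psum_lt1. Qed.

Let measurable_pow01 (al : R) (D : set R) : measurable_fun D (fun t : R => (1 - t) `^ al).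
Proof.
apply: measurable_funTS.
apply: (@measurableT_comp _ _ _ _ _ _ (fun x : R => x `^ al)); first exact: measurable_powR.
exact: measurable_funB.
Qed.

(** Tonelli on the triangle s <= t leaves for each s an integral over [s, 1), which is [mu_tail].
    The measurability statement is a by-product of Tonelli and is needed to integrate the bound of
    [cmod_psum_ftc]. *)
Lemma int_primitive (al : R) : carleson mu -> -1 < al < 0 -> exists2 K, 0 < K &
  forall b, subexp (fun k => cmod (b k)) ->
  measurable_fun I01 (fun t => ((1 - t) `^ al)%:E *
      \int[leb]_(s in `[0%R, t]) (cmod (psum b (ofreal s)))%:E)%E /\
  (\int[mu]_(t in I01) (((1 - t) `^ al)%:E *
      \int[leb]_(s in `[0%R, t]) (cmod (psum b (ofreal s)))%:E) <=
   K%:E * \int[leb]_(s in I01) (cmod (psum b (ofreal s)) * (1 - s) `^ (al + 1))%:E)%E.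
Proof.
move=> cmu /andP[al1 al0].
have al01 : -1 < al <= 0 by rewrite al1 ltW.
have [K K0 HK] := mu_tail cmu al01.
exists K => // b sb.
pose g (s : R) : R := \1_I01 s * cmod (psum b (ofreal s)).
have mI01 : measurable I01 by exact: measurable_itv.
have mg : measurable_fun setT g by apply: measurable_indicM => //; exact: measurable_psum01.
have g0 s : 0 <= g s by rewrite mulr_ge0 ?cmod_ge0.
pose Psi (x : R * R) : \bar R :=
  (\1_I01 x.1 * \1_[set x : R * R | x.2 <= x.1] x * (1 - x.1) `^ al * g x.2)%:E.
have mle : measurable [set x : R * R | x.2 <= x.1].
  exact: (measurable_le_set (f := snd) (g := fst) measurable_snd measurable_fst).
have mi : measurable_fun setT (\1_I01 : R -> R) by exact: measurable_indic.
have mp : measurable_fun setT (fun t : R => (1 - t) `^ al) by exact: measurable_pow01.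
have mPsi : measurable_fun setT Psi.
  apply/measurable_EFinP; apply: measurable_funM; last exact: (measurableT_comp mg measurable_snd).
  apply: measurable_funM; last exact: (measurableT_comp mp measurable_fst).
  apply: measurable_funM; last exact: measurable_indic.
  exact: (measurableT_comp mi measurable_fst).
have Psi0 x : (0 <= Psi x)%E.
  rewrite lee_fin; apply: mulr_ge0 => //; apply: mulr_ge0; last exact: powR_ge0.
  exact: mulr_ge0.
have mPsi1 : measurable_fun setT (fun t : R => \int[leb]_s Psi (t, s))%E.
  exact: (@measurable_fun_fubini_tonelli_F _ _ (measurableTypeR R) _ R leb Psi mPsi Psi0).
have step t : I01 t -> (((1 - t) `^ al)%:E *
      \int[leb]_(s in `[0%R, t]) (cmod (psum b (ofreal s)))%:E = \int[leb]_s Psi (t, s))%E.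
  move=> It; have := It; rewrite /= in_itv/= => /andP[t0 t1].
  have st : `[0%R, t]%classic `<=` I01.
    by move=> s /=; rewrite !in_itv/= => /andP[-> st]; exact: le_lt_trans t1.
  rewrite -ge0_integralZl; last 4 first.
  - exact: measurable_itv.
  - by apply/measurable_EFinP; apply: measurable_funS (measurable_psum01 sb).
  - by move=> s _; rewrite lee_fin cmod_ge0.
  - by rewrite lee_fin powR_ge0.
  rewrite integral_mkcond; apply: eq_integral => s _; rewrite /Psi /patch/=.
  have -> : \1_I01 t = 1 :> R by rewrite indicE mem_set.
  rewrite mul1r /g !indicE.
  case: (boolP (s \in `[0%R, t]%classic)) => [|].
    rewrite inE => s0t; have := st _ s0t => sI; move: s0t.
    rewrite /= in_itv/= => /andP[s0 s1].
    by rewrite !mem_set// !mul1r -EFinM.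
  move=> /negP; rewrite inE/= in_itv/= => /negP h.
  have [s0|s0] := leP 0 s; last first.
    by rewrite [s \in _]memNset ?mul0r ?mulr0//= in_itv/= leNgt s0.
  rewrite [(t, s) \in _]memNset ?mul0r//=.
  by move: h; rewrite s0/= => /negP.
split.
  apply: (eq_measurable_fun (fun t : R => \int[leb]_s Psi (t, s))%E); last exact: measurable_funTS.
  by move=> t; rewrite inE => /step.
have -> : (\int[mu]_(t in I01) (((1 - t) `^ al)%:E *
      \int[leb]_(s in `[0%R, t]) (cmod (psum b (ofreal s)))%:E) =
    \int[mu]_(t in I01) \int[leb]_s Psi (t, s))%E.
  by apply: eq_integral => t; rewrite inE => /step.
apply: (@le_trans _ _ (\int[mu]_t \int[leb]_s Psi (t, s))%E).
  apply: ge0_subset_integral => //.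
  by move=> t _; apply: integral_ge0.
have -> : (\int[mu]_t \int[leb]_s Psi (t, s) = \int[leb]_s \int[mu]_t Psi (t, s))%E.
  exact: (@fubini_tonelli _ _ _ _ R mu leb Psi mPsi Psi0).
have mgK : measurable_fun setT (fun s : R => (g s * (1 - s) `^ (al + 1))%:E).
  by apply/measurable_EFinP; apply: measurable_funM => //; exact: measurable_pow01.
have -> : (\int[leb]_(s in I01) (cmod (psum b (ofreal s)) * (1 - s) `^ (al + 1))%:E =
    \int[leb]_s (g s * (1 - s) `^ (al + 1))%:E)%E.
  rewrite integral_mkcond; apply: eq_integral => s _; rewrite /patch /g indicE.
  by case: (s \in I01); rewrite ?mul1r ?mul0r.
rewrite -[X in (_ <= X)%E]ge0_integralZl; last 4 first.
- exact: measurableT.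
- exact: mgK.
- by move=> s _; rewrite lee_fin mulr_ge0 ?powR_ge0.
- by rewrite lee_fin ltW.
apply: ge0_le_integral.
- exact: measurableT.
- by move=> s _; apply: integral_ge0.
- exact: (@measurable_fun_fubini_tonelli_G _ _ _ (measurableTypeR R) R mu Psi mPsi Psi0).
- exact: measurable_funeM.
move=> s _.
have [sI|sI] := boolP (s \in I01); last first.
  have gs : g s = 0 by rewrite /g indicE (negbTE sI) mul0r.
  rewrite integral0_eq; first by rewrite gs mul0r mule0.
  by move=> t _; rewrite /Psi/= gs mulr0.
move: sI; rewrite inE => sI; have := sI; rewrite /= in_itv/= => s01; have /andP[s0 s1] := s01.
have st : `[s, 1%R[%classic `<=` I01.
  by move=> t /=; rewrite !in_itv/= => /andP[st ->]; rewrite andbT (le_trans s0).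
apply: (@le_trans _ _ ((g s)%:E * \int[mu]_(t in `[s, 1%R[) ((1 - t) `^ al)%:E)%E).
  rewrite -ge0_integralZl; last 4 first.
  - exact: measurable_itv.
  - by apply/measurable_EFinP; exact: measurable_pow01.
  - by move=> t _; rewrite lee_fin powR_ge0.
  - by rewrite lee_fin.
  rewrite [X in (_ <= X)%E]integral_mkcond.
  rewrite le_eqVlt; apply/orP; left; apply/eqP; apply: eq_integral => t _; rewrite /Psi /patch/= !indicE.
  case: (boolP (t \in `[s, 1%R[%classic)) => [|].
    rewrite inE => tI; have tI' := st _ tI; move: tI; rewrite /= in_itv/= => /andP[h1 h2].
    by rewrite !mem_set// !mul1r -EFinM mulrC.
  move=> /negP; rewrite inE/= in_itv/= => /negP h.
  have [h1|h1] := leP s t; last first.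
    by rewrite [(t, s) \in _]memNset ?mulr0 ?mul0r//= => h2; move: h1; rewrite ltNge h2.
  rewrite [t \in I01]memNset ?mul0r//= in_itv/= => /andP[_ h2].
  by move: h; rewrite h1 h2.
apply: (@le_trans _ _ ((g s)%:E * (K * (1 - s) `^ (al + 1))%:E)%E).
  by apply: lee_wpmul2l; [rewrite lee_fin|exact: HK].
by rewrite -!EFinM lee_fin mulrCA.
Qed.

Lemma mu_embed (al : R) : carleson mu -> -1 < al < 0 -> exists2 K, 0 < K &
  forall a, subexp (fun k => cmod (a k)) ->
  (\int[mu]_(t in I01) (cmod (psum a (ofreal t)) * (1 - t) `^ al)%:E <=
   K%:E * ((cmod (a 0%N))%:E + \int[area]_(q in @disc R)
      ((1 - nsq q) `^ al * cmod (psum (dcoef a) (zof q)))%:E))%E.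
Proof.
move=> cmu al01; have /andP[al1 al0] := al01.
have al01' : -1 < al <= 0 by rewrite al1 ltW.
have [K1 K10 H1] := mu_tail cmu al01'.
have [K2 K20 H2] := int_primitive cmu al01.
have [K3 K30 H3] := @radial_carleson R al al01.
(* [K1] belongs to the constant term |a_0|; the other summand joins the 2 of [cmod_psum_ftc] to the
   exchange of integrals and the radial estimate. *)
exists (K1 + 2 * (K2 * K3)); first by rewrite addr_gt0// !mulr_gt0.
move=> a sa; have sb := subexp_dcoef sa.
have mI01 : measurable I01 by exact: measurable_itv.
set J := (\int[area]_(q in @disc R) _)%E.
have J0 : (0 <= J)%E.
  by apply: integral_ge0 => q _; rewrite lee_fin mulr_ge0 ?powR_ge0 ?cmod_ge0.
set G := fun t : R => (\int[leb]_(s in `[0%R, t]) (cmod (psum (dcoef a) (ofreal s)))%:E)%E.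
have G0 t : (0 <= G t)%E by apply: integral_ge0 => s _; rewrite lee_fin cmod_ge0.
have mG : measurable_fun I01 (fun t => ((1 - t) `^ al)%:E * G t)%E.
  by have [] := H2 _ sb.
have b1 : (\int[mu]_(t in I01) ((cmod (a 0%N))%:E * ((1 - t) `^ al)%:E) <=
    (cmod (a 0%N))%:E * K1%:E)%E.
  rewrite ge0_integralZl//; last 3 first.
  - by apply/measurable_EFinP; exact: measurable_pow01.
  - by move=> t _; rewrite lee_fin powR_ge0.
  - by rewrite lee_fin cmod_ge0.
  apply: lee_wpmul2l; first by rewrite lee_fin cmod_ge0.
  have h01 : 0 <= (0 : R) < 1 by rewrite lexx ltr01.
  by have := H1 0 h01; rewrite subr0 powR1 mulr1.
have b2 : (\int[mu]_(t in I01) (2%:E * (((1 - t) `^ al)%:E * G t)) <= 2%:E * (K2%:E * (K3%:E * J)))%E.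
  rewrite ge0_integralZl//; last first.
    by move=> t _; rewrite mule_ge0 ?lee_fin ?powR_ge0.
  apply: lee_wpmul2l => //; apply: le_trans (H2 _ sb).2 _.
  by apply: lee_wpmul2l; [rewrite lee_fin ltW|exact: H3].
apply: (@le_trans _ _ (\int[mu]_(t in I01) ((cmod (a 0%N))%:E * ((1 - t) `^ al)%:E +
    2%:E * (((1 - t) `^ al)%:E * G t)))%E).
  apply: ge0_le_integral => //.
  - by move=> t _; rewrite lee_fin mulr_ge0 ?powR_ge0 ?cmod_ge0.
  - apply/measurable_EFinP; apply: measurable_funM; first exact: measurable_psum01.
    exact: measurable_pow01.
  - apply: emeasurable_funD; last exact: measurable_funeM.
    by apply: measurable_funeM; apply/measurable_EFinP; exact: measurable_pow01.
  - move=> t /=; rewrite in_itv/= => t01.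
    rewrite mulrC EFinM; apply: (@le_trans _ _ (((1 - t) `^ al)%:E *
        ((cmod (a 0%N))%:E + 2%:E * G t))%E).
      by apply: lee_wpmul2l; [rewrite lee_fin powR_ge0|exact: cmod_psum_ftc].
    rewrite ge0_muleDr ?lee_fin ?cmod_ge0 ?mule_ge0//.
    by rewrite muleC [X in (_ + X)%E]muleCA.
rewrite ge0_integralD//; last 4 first.
- by move=> t _; rewrite -EFinM lee_fin mulr_ge0 ?powR_ge0 ?cmod_ge0.
- by apply: measurable_funeM; apply/measurable_EFinP; exact: measurable_pow01.
- by move=> t _; rewrite !mule_ge0 ?lee_fin ?powR_ge0.
- exact: measurable_funeM.
apply: le_trans (leeD b1 b2) _.
have K4 : 0 <= 2 * (K2 * K3) by rewrite !mulr_ge0 ?(ltW K20) ?(ltW K30).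
rewrite [leRHS]ge0_muleDr //; last by rewrite lee_fin cmod_ge0.
apply: leeD.
  by rewrite -!EFinM lee_fin mulrC ler_wpM2r ?cmod_ge0// lerDl.
rewrite !muleA -!EFinM; apply: lee_wpmul2r => //.
by rewrite lee_fin -mulrA lerDr ltW.
Qed.

End carleson_measures.

(** * Convergence of the series of n^(-e) for e > 1 *)

Section p_series.
Context {R : realType}.

Lemma powR_ge1Dln (x d : R) : 0 < x -> 1 + d * ln x <= x `^ d.
Proof. by move=> x0; rewrite /powR gt_eqF// expR_ge1Dx. Qed.

(** Take x = (n + 2) / (n + 1) in x^d >= 1 + d ln x and use ln x >= 1 / (n + 2), which is ln (1 - u)
    <= -u for u = 1 / (n + 2). *)
Lemma powR_telescope (d : R) n : 0 < d ->
  d * n.+2%:R `^ (- (1 + d)) <= n.+1%:R `^ (- d) - n.+2%:R `^ (- d).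
Proof.
move=> d0.
have n1 : 0 < n.+1%:R :> R by [].
have n2 : 0 < n.+2%:R :> R by [].
have n12 : n.+2%:R = n.+1%:R + 1 :> R by rewrite -addn1 natrD.
have p2 : 0 < n.+2%:R `^ (- d) :> R by rewrite powR_gt0.
have -> : n.+1%:R `^ (- d) = (n.+2%:R / n.+1%:R) `^ d * n.+2%:R `^ (- d) :> R.
  rewrite powRM ?invr_ge0// mulrAC -powRD ?subrr ?powRr0 ?mul1r//.
    by rewrite -[n.+1%:R^-1]powR_inv1// -powRrM mulN1r.
  by rewrite eqxx implyTb gt_eqF.
have -> : n.+2%:R `^ (- (1 + d)) = n.+2%:R^-1 * n.+2%:R `^ (- d) :> R.
  by rewrite opprD powRD ?(gt_eqF n2) ?implybT// powR_inv1.
rewrite mulrA -[X in _ - X]mul1r -mulrBl ler_wpM2r ?(ltW p2)//.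
have q0 : 0 < n.+2%:R / n.+1%:R :> R by rewrite divr_gt0.
have := @powR_ge1Dln (n.+2%:R / n.+1%:R) d q0.
have : n.+2%:R^-1 <= ln (n.+2%:R / n.+1%:R) :> R.
  rewrite -[_ / _]invrK lnV ?posrE ?invr_gt0// invf_div lerNr.
  have -> : n.+1%:R / n.+2%:R = 1 + - n.+2%:R^-1 :> R.
    apply: (mulIf (lt0r_neq0 n2)).
    by rewrite divfK ?gt_eqF// mulrDl mul1r mulNr mulVf ?gt_eqF// n12 addrK.
  apply: le_ln1Dx; rewrite ltrN2 invf_lt1// n12 ltrDr//.
by move=> h1 h2; rewrite lerBrDl; apply: le_trans h2; rewrite lerD2l ler_wpM2l// ltW.
Qed.

Lemma cvg_p_series (e : R) : 1 < e ->
  cvgn (series (fun n => n.+1%:R `^ (- e) : R)).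
Proof.
move=> e1; have d0 : 0 < e - 1 by rewrite subr_gt0.
set d := e - 1 in d0.
have bound n : \sum_(0 <= k < n.+1) k.+1%:R `^ (- e) <= 1 + d^-1 * (1 - n.+1%:R `^ (- d)) :> R.
  elim: n => [|n IH]; first by rewrite big_nat1 !powR1 subrr mulr0 addr0.
  rewrite big_nat_recr//=.
  have := powR_telescope n d0.
  rewrite (_ : - (1 + d) = - e); last by rewrite /d; ring.
  rewrite mulrC -ler_pdivlMr// => H.
  have := lerD IH H; rewrite mulrBr mulr1 mulrBl mulrBr; lra.
apply: nondecreasing_is_cvgn.
  by apply/nondecreasing_series => k _ _; exact: powR_ge0.
exists (1 + d^-1) => _ [n _ <-].
case: n => [|n]; first by rewrite /series/= big_geq// addr_ge0// invr_ge0 ltW.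
apply: le_trans (bound n) _; rewrite lerD2l -[leRHS]mulr1 ler_wpM2l ?invr_ge0 ?(ltW d0)//.
Qed.

End p_series.

(** * Decay of the moments and summability against coefficients *)

Section moments.
Context {R : realType} (mu : {finite_measure set R -> \bar R}).
Local Notation leb := (@lebesgue_measure R).
Local Notation area := (leb \x leb)%E.
Local Notation I01 := (`[0%R, 1%R[%classic : set R).
Implicit Types (a b : nat -> cplx R).

Lemma momentE n : (moment mu n)%:E = (\int[mu]_(t in I01) (t ^+ n)%:E)%E.
Proof.
rewrite /moment /Rintegral fineK// ge0_fin_numE; last first.
  by apply: integral_ge0 => t /=; rewrite in_itv/= => /andP[t0 _]; rewrite lee_fin exprn_ge0.
apply: (@le_lt_trans _ _ (\int[mu]_(t in I01) cst 1%E t)%E).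
  apply: ge0_le_integral => //.
  - by move=> t /=; rewrite in_itv/= => /andP[t0 _]; rewrite lee_fin exprn_ge0.
  - by apply/measurable_EFinP; exact: measurable_funX.
  - by move=> t /=; rewrite in_itv/= => /andP[t0 t1]; rewrite lee_fin exprn_ile1// ltW.
rewrite integral_cst// mul1e.
have := @fin_num_measure _ _ _ mu I01 (measurable_itv _).
by rewrite ge0_fin_numE.
Qed.

Lemma moment_ge0 n : 0 <= moment mu n.
Proof.
rewrite -lee_fin momentE; apply: integral_ge0 => t /=.
by rewrite in_itv/= => /andP[t0 _]; rewrite lee_fin exprn_ge0.
Qed.

Lemma moment_decr m n : (m <= n)%N -> moment mu n <= moment mu m.
Proof.
move=> mn; rewrite -lee_fin !momentE; apply: ge0_le_integral => //.
- by move=> t /=; rewrite in_itv/= => /andP[t0 _]; rewrite lee_fin exprn_ge0.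
- by apply/measurable_EFinP; exact: measurable_funX.
- by apply/measurable_EFinP; exact: measurable_funX.
- move=> t /=; rewrite in_itv/= => /andP[t0 t1]; rewrite lee_fin ler_wiXn2l//; exact: ltW.
Qed.

(** Pointwise t^n <= y^(-b) with y = (n + 1) (1 - t). This is clear for y <= 1; for y > 1 already
    t^n <= 1 / y, since (t (2 - t))^n <= 1 and (2 - t)^n >= 1 + n (1 - t) >= y by Bernoulli. The
    power of 1 - t is integrated by [mu_tail], which asks for b < 1. *)
Lemma moment_bound (b : R) : carleson mu -> 0 < b < 1 -> exists2 K, 0 < K &
  forall n, moment mu n <= K * n.+1%:R `^ (- b).
Proof.
move=> cmu /andP[b0 b1].
have b01 : -1 < - b <= 0 by apply/andP; split; lra.
have [K K0 HK] := mu_tail cmu b01.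
exists K => // n; rewrite -lee_fin momentE.
have n0 : 0 < n.+1%:R :> R by [].
apply: (@le_trans _ _ (\int[mu]_(t in I01) ((n.+1%:R `^ (- b))%:E * ((1 - t) `^ (- b))%:E))%E).
  apply: ge0_le_integral => //.
  - by move=> t /=; rewrite in_itv/= => /andP[t0 _]; rewrite lee_fin exprn_ge0.
  - by apply/measurable_EFinP; exact: measurable_funX.
  - apply: measurable_funeM; apply/measurable_EFinP; apply: measurable_funTS.
    apply: (@measurableT_comp _ _ _ _ _ _ (fun x : R => x `^ (- b))); first exact: measurable_powR.
    exact: measurable_funB.
  - move=> t /=; rewrite in_itv/= => /andP[t0 t1]; rewrite -EFinM lee_fin.
    have v0 : 0 < 1 - t by rewrite subr_gt0.
    rewrite -powRM ?(ltW v0)//.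
    have tn1 : t ^+ n <= 1 by rewrite exprn_ile1// ltW.
    have y0 : 0 < n.+1%:R * (1 - t) by rewrite mulr_gt0.
    have [y1|y1] := leP (n.+1%:R * (1 - t)) 1.
      apply: le_trans tn1 _; apply: (@le_trans _ _ (1 `^ (- b))); first by rewrite powR1.
      by apply: powR_anti => //; lra.
    apply: (@le_trans _ _ (n.+1%:R * (1 - t))^-1).
      have tn0 : 0 <= t ^+ n by rewrite exprn_ge0.
      have hB : 1 + n%:R * (1 - t) <= (1 + (1 - t)) ^+ n by apply: bernoulli; lra.
      have h1 : t ^+ n * (1 + (1 - t)) ^+ n <= 1.
        by rewrite -exprMn exprn_ile1//; [nra|nra].
      rewrite -[leRHS]mul1r ler_pdivlMr//.
      apply: le_trans h1; rewrite ler_wpM2l//; apply: le_trans hB.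
      by rewrite -addn1 natrD; lra.
    rewrite -powR_inv1 ?(ltW y0)//; apply: ler_powR; lra.
rewrite ge0_integralZl//; last 2 first.
- apply/measurable_EFinP; apply: measurable_funTS.
  apply: (@measurableT_comp _ _ _ _ _ _ (fun x : R => x `^ (- b))); first exact: measurable_powR.
  exact: measurable_funB.
- by move=> t _; rewrite lee_fin powR_ge0.
rewrite [leRHS]EFinM muleC; apply: lee_wpmul2r; first by rewrite lee_fin powR_ge0.
have h01 : 0 <= (0 : R) < 1 by rewrite lexx ltr01.
by have := HK 0 h01; rewrite subr0 powR1 mulr1.
Qed.

(** [coef_bound] for the derivative gives |a_k| = O(k^al). With b = 1 + al / 2 the moments
    contribute k^(-1 - al/2), and the product k^(-1 + al/2) is summable because al < 0. *)
Lemma summable_moments (al : R) a : carleson mu -> -1 < al < 0 ->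
  subexp (fun k => cmod (a k)) ->
  (\int[area]_(q in @disc R) ((1 - nsq q) `^ al * cmod (psum (dcoef a) (zof q)))%:E < +oo)%E ->
  cvgn (series (fun k => moment mu k * cmod (a k))).
Proof.
move=> cmu /andP[al1 al0] sa; set J := (\int[area]_(q in _) _)%E => Jfin.
have J0 : (0 <= J)%E.
  by apply: integral_ge0 => q _; rewrite lee_fin mulr_ge0 ?powR_ge0 ?cmod_ge0.
have JE : J = (fine J)%:E by rewrite fineK// ge0_fin_numE.
set j := fine J in JE; have j0 : 0 <= j by rewrite fine_ge0.
have c0 : 0 < disc_area :> R := disc_area_gt0.
have b01 : 0 < 1 + al / 2 < 1 by apply/andP; split; lra.
have [K K0 HK] := moment_bound cmu b01.
have ak k : cmod (a k.+1) <= 4 * j / disc_area * 2 `^ (al + 1) * k.+1%:R `^ al.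
  have := coef_bound k al0 (subexp_dcoef sa); rewrite -/J JE lee_fin.
  rewrite /dcoef cmodM cmod_nat.
  have n0 : 0 < k.+1%:R :> R by [].
  have e : (2 * k.+1%:R)^-1 = (2 * k.+1%:R) `^ (-1) :> R by rewrite powR_inv1// mulr_ge0.
  rewrite e -powRrM mulN1r powRN powRM// invfM.
  have p1 : 0 < 2 `^ (al + 1) :> R by rewrite powR_gt0.
  have p2 : 0 < k.+1%:R `^ al :> R by rewrite powR_gt0.
  have -> : k.+1%:R `^ (al + 1) = k.+1%:R `^ al * k.+1%:R :> R.
    by rewrite powRD ?(gt_eqF n0) ?implybT// powRr1.
  move=> H.
  have -> : 4 * j / disc_area * 2 `^ (al + 1) * k.+1%:R `^ al =
     j / (disc_area / 4 * ((2 `^ (al + 1))^-1 * (k.+1%:R `^ al)^-1)).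
    by field; rewrite ?gt_eqF.
  rewrite ler_pdivlMr; last by rewrite !mulr_gt0// ?divr_gt0// invr_gt0.
  apply: le_trans H; rewrite le_eqVlt; apply/orP; left; apply/eqP.
  by field; rewrite ?gt_eqF.
set A := 4 * j / disc_area * 2 `^ (al + 1) in ak.
have A0 : 0 <= A by rewrite !mulr_ge0 ?powR_ge0// invr_ge0 ltW.
clearbody A.
(* The first summand takes care of k = 0, about which the derivative carries no information. *)
pose C := moment mu 0 * cmod (a 0%N) + K * A * 2 `^ (- al).
have m0 : 0 <= moment mu 0 * cmod (a 0%N) by rewrite mulr_ge0 ?moment_ge0 ?cmod_ge0.
have K2 : 0 <= K * A * 2 `^ (- al) by rewrite !mulr_ge0 ?powR_ge0// ltW.
have cp : cvgn (series (fun n => C *: (n.+1%:R `^ (- (1 - al / 2)) : R))).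
  by apply: is_cvg_seriesZ; apply: cvg_p_series; lra.
apply: series_le_cvg cp.
- by move=> k; rewrite mulr_ge0 ?moment_ge0 ?cmod_ge0.
- by move=> k; rewrite /GRing.scale/= mulr_ge0 ?powR_ge0// addr_ge0.
move=> [|k]; first by rewrite /GRing.scale/= powR1 mulr1 lerDl.
have n2 : 0 < k.+2%:R :> R by [].
(* Shifts the coefficient bound by one index to match the moment bound, using k + 2 <= 2 (k + 1). *)
have h : k.+1%:R `^ al <= 2 `^ (- al) * k.+2%:R `^ al :> R.
  have -> : 2 `^ (- al) = (2^-1) `^ al :> R.
    by rewrite powRN -[2^-1]powR_inv1// -powRrM mulN1r powRN.
  rewrite -powRM//; apply: powR_anti; [exact: ltW|by rewrite mulr_gt0 ?invr_gt0|].
  have n12 : k.+2%:R = k.+1%:R + 1 :> R by rewrite -addn1 natrD.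
  have n1 : 1 <= k.+1%:R :> R by rewrite ler1n.
  by rewrite n12; lra.
apply: (@le_trans _ _ ((K * k.+2%:R `^ (- (1 + al / 2))) * (A * (2 `^ (- al) * k.+2%:R `^ al)))).
  apply: ler_pM; rewrite ?moment_ge0 ?cmod_ge0//.
  by apply: le_trans (ak k) _; rewrite ler_wpM2l.
have -> : - (1 - al / 2) = - (1 + al / 2) + al by lra.
rewrite /GRing.scale/= powRD; last by rewrite (gt_eqF n2) implybT.
rewrite [leLHS](_ : _ = K * A * 2 `^ (- al) * (k.+2%:R `^ (- (1 + al / 2)) * k.+2%:R `^ al)); last by ring.
by rewrite ler_wpM2r ?mulr_ge0 ?powR_ge0// lerDr.
Qed.

End moments.

(** * Moments as a positive functional on polynomials *)

Section moment_functional.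
Context {R : realType} (mu : {finite_measure set R -> \bar R}).
Local Notation I01 := (`[0%R, 1%R[%classic : set R).
Implicit Types (a : nat -> cplx R).

Let mI01 : measurable I01. Proof. exact: measurable_itv. Qed.

Let sub01 : I01 `<=` `]-1, 1[%classic.
Proof. by move=> x /=; rewrite !in_itv/= => /andP[x0 ->]; rewrite andbT; lra. Qed.

Lemma integrable_expr n : mu.-integrable I01 (fun t => (t ^+ n)%:E).
Proof.
apply/integrableP; split.
  by apply/measurable_EFinP; exact: measurable_funX.
apply: (@le_lt_trans _ _ (moment mu n)%:E); last by rewrite ltry.
rewrite momentE; apply: ge0_le_integral => //.
- apply/measurable_EFinP; apply: measurableT_comp => //; exact: measurable_funX.
- by apply/measurable_EFinP; exact: measurable_funX.
- by move=> t /=; rewrite in_itv/= => /andP[t0 _]; rewrite lee_fin ger0_norm ?exprn_ge0.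
Qed.

Lemma moment_poly I (r : seq I) (c : I -> R) (e : I -> nat) :
  mu.-integrable I01 (fun t => (\sum_(i <- r) c i * t ^+ e i)%:E) /\
  (\int[mu]_(t in I01) (\sum_(i <- r) c i * t ^+ e i)%:E =
   (\sum_(i <- r) c i * moment mu (e i))%:E)%E.
Proof.
elim: r => [|i r [IH1 IH2]].
  have -> : (fun t : R => (\sum_(i <- [::]) c i * t ^+ e i)%:E) = cst 0%E.
    by apply/funext => t; rewrite big_nil.
  by rewrite big_nil integral0; split => //; exact: integrable0.
have -> : (fun t : R => (\sum_(j <- i :: r) c j * t ^+ e j)%:E) =
   (fun t => (c i)%:E * (t ^+ e i)%:E + (\sum_(j <- r) c j * t ^+ e j)%:E)%E.
  by apply/funext => t; rewrite big_cons EFinD EFinM.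
have iX : mu.-integrable I01 (fun t => (c i)%:E * (t ^+ e i)%:E)%E.
  by apply: integrableZl => //; exact: integrable_expr.
split; first exact: integrableD.
rewrite integralD// IH2 integralZl//; last exact: integrable_expr.
by rewrite -momentE big_cons EFinD EFinM.
Qed.

Lemma Re_bigsum I (r : seq I) (F : I -> cplx R) :
  complex.Re (\sum_(i <- r) F i) = \sum_(i <- r) complex.Re (F i).
Proof. by apply: (big_morph _ ReD). Qed.

Lemma Im_bigsum I (r : seq I) (F : I -> cplx R) :
  complex.Im (\sum_(i <- r) F i) = \sum_(i <- r) complex.Im (F i).
Proof. by apply: (big_morph _ ImD). Qed.

Lemma cmeas_poly01 I (r : seq I) (c : I -> cplx R) (e : I -> nat) :
  cmeas I01 (fun t => \sum_(i <- r) ofreal (t ^+ e i) * c i).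
Proof.
split.
- have -> : (fun x : R => complex.Re (\sum_(i <- r) ofreal (x ^+ e i) * c i)) =
      (fun x => \sum_(i <- r) x ^+ e i * complex.Re (c i)).
    by apply/funext => x; rewrite Re_bigsum; apply: eq_bigr => i _; rewrite ReZ.
  by apply: measurable_sum => i; apply: measurable_funM => //; exact: measurable_funX.
- have -> : (fun x : R => complex.Im (\sum_(i <- r) ofreal (x ^+ e i) * c i)) =
      (fun x => \sum_(i <- r) x ^+ e i * complex.Im (c i)).
    by apply/funext => x; rewrite Im_bigsum; apply: eq_bigr => i _; rewrite ImZ.
  by apply: measurable_sum => i; apply: measurable_funM => //; exact: measurable_funX.
Qed.

(** Replacing each power of t by its moment is integration against [mu]. Done for the real and the
    imaginary part, each bounded by the integral of the modulus, it gives the factor 2. *)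
Lemma cmod_moment_poly I (r : seq I) (c : I -> cplx R) (e : I -> nat) :
  ((cmod (\sum_(i <- r) ofreal (moment mu (e i)) * c i))%:E <=
   2%:E * \int[mu]_(t in I01) (cmod (\sum_(i <- r) ofreal (t ^+ e i) * c i))%:E)%E.
Proof.
have mP := cmeas_poly01 r c e.
set J := (\int[mu]_(t in I01) _)%E.
have part (d : I -> R) : (forall t : R, `|\sum_(i <- r) d i * t ^+ e i| <=
      cmod (\sum_(i <- r) ofreal (t ^+ e i) * c i)) ->
    (`|\sum_(i <- r) d i * moment mu (e i)|%:E <= J)%E.
  move=> hd; have [iP EP] := moment_poly r d e.
  rewrite -abse_EFin -EP; apply: le_trans (le_abse_integral mu mI01 _) _.
    by case/integrableP: iP.
  apply: ge0_le_integral => //.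
  - by apply: measurableT_comp => //; case/integrableP: iP.
  - by apply/measurable_EFinP; exact: cmeas_cmod.
  - by move=> t _; rewrite abse_EFin lee_fin.
have J0 : (0 <= J)%E by apply: integral_ge0 => t _; rewrite lee_fin cmod_ge0.
rewrite (_ : 2 = 1 + 1 :> R)// EFinD ge0_muleDl// mul1e.
apply: (@le_trans _ _ (`|complex.Re (\sum_(i <- r) ofreal (moment mu (e i)) * c i)|%:E +
   `|complex.Im (\sum_(i <- r) ofreal (moment mu (e i)) * c i)|%:E)%E).
  by rewrite -EFinD lee_fin cmod_leReIm.
apply: leeD.
- rewrite Re_bigsum; under eq_bigr do rewrite ReZ mulrC.
  apply: part => t; apply: le_trans (normRe_le _).
  by rewrite Re_bigsum; under [X in _ <= `|X|]eq_bigr do rewrite ReZ mulrC.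
- rewrite Im_bigsum; under eq_bigr do rewrite ImZ mulrC.
  apply: part => t; apply: le_trans (normIm_le _).
  by rewrite Im_bigsum; under [X in _ <= `|X|]eq_bigr do rewrite ImZ mulrC.
Qed.

(** Integrating term by term gives the series of mu_k |a_k|. The function is the dominating one in
    [cvg_int_partial]. *)
Lemma integrable_majorant a : cvgn (series (fun k => moment mu k * cmod (a k))) ->
  mu.-integrable I01 (fun t => \sum_(0 <= k <oo) (cmod (a k) * t ^+ k)%:E)%E.
Proof.
move=> ca.
have t0 k t : I01 t -> (0 <= (cmod (a k) * t ^+ k)%:E)%E.
  by rewrite /= in_itv/= => /andP[t0 _]; rewrite lee_fin mulr_ge0 ?exprn_ge0 ?cmod_ge0.
have mt k : measurable_fun I01 (fun t => (cmod (a k) * t ^+ k)%:E).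
  by apply/measurable_EFinP; apply: measurable_funM => //; exact: measurable_funX.
apply/integrableP; split.
  by apply: ge0_emeasurable_sum => // k t It _; exact: t0.
rewrite (eq_integral (fun t : R => \sum_(0 <= k <oo) (cmod (a k) * t ^+ k)%:E)%E); last first.
  move=> t; rewrite inE => It; rewrite gee0_abs//; apply: nneseries_ge0 => k _ _; exact: t0.
rewrite integral_nneseries//.
apply: (@le_lt_trans _ _ (limn (series (fun k => moment mu k * cmod (a k))))%:E); last by rewrite ltry.
apply: lime_le.
  by apply: is_cvg_nneseries => k _ _; apply: integral_ge0 => t; exact: t0.
apply: nearW => n.
have -> : (\sum_(0 <= k < n) \int[mu]_(t in I01) (cmod (a k) * t ^+ k)%:E)%E =
    (series (fun k => moment mu k * cmod (a k)) n)%:E.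
  rewrite /series/= -sumEFin; apply: eq_bigr => k _.
  under eq_integral do rewrite EFinM.
  by rewrite integralZl//; [rewrite -momentE -EFinM mulrC|exact: integrable_expr].
rewrite lee_fin; apply: nondecreasing_cvgn_le => //.
by apply/nondecreasing_series => k _ _; rewrite mulr_ge0 ?moment_ge0 ?cmod_ge0.
Qed.

Lemma cvg_int_partial a (g : R -> R) (G : R) :
  subexp (fun k => cmod (a k)) ->
  cvgn (series (fun k => moment mu k * cmod (a k))) ->
  measurable_fun I01 g -> (forall t, I01 t -> 0 <= g t <= G) ->
  (fun n => \int[mu]_(t in I01)
      (g t * cmod (\sum_(k < n) ofreal (t ^+ k) * a k))%:E)%E @ \oo -->
  (\int[mu]_(t in I01) (g t * cmod (psum a (ofreal t)))%:E)%E.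
Proof.
move=> sa ca mg gG.
have G0 : 0 <= G.
  have h0 : I01 0 by rewrite /= in_itv/= lexx ltr01.
  by have /andP[h1 h2] := gG 0 h0; exact: le_trans h2.
have [] := @dominated_convergence _ _ R mu I01 mI01
  (fun n t => (g t * cmod (\sum_(k < n) ofreal (t ^+ k) * a k))%:E)
  (fun t => (g t * cmod (psum a (ofreal t)))%:E)
  (fun t => G%:E * \sum_(0 <= k <oo) (cmod (a k) * t ^+ k)%:E)%E; last by [].
- move=> n; apply/measurable_EFinP; apply: measurable_funM => //.
  exact/cmeas_cmod/cmeas_poly01.
- apply/measurable_EFinP; apply: measurable_funM => //; exact: cmod_psum_lt1.
- apply: aeW => t It; apply/fine_cvgP; split; first exact: nearW.
  apply: cvgM; first exact: cvg_cst.
  apply: cvg_cmod; have t1 : cmod (ofreal t) < 1.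
    by apply: cmod_real_lt1; move: It; rewrite /= in_itv.
  rewrite (_ : (fun n => _) = [series a k * ofreal t ^+ k]_k); first exact: psum_cvg.
  apply/funext => n; rewrite /series/= big_mkord; apply: eq_bigr => k _.
  by rewrite ofrealX mulrC.
- by apply: integrableZl => //; exact: integrable_majorant.
apply: aeW => t n It; have := It; rewrite /= in_itv/= => /andP[t0 t1].
have /andP[g0 g1] := gG _ It.
rewrite ger0_norm ?mulr_ge0 ?cmod_ge0//.
rewrite EFinM; apply: lee_pmul; rewrite ?lee_fin ?cmod_ge0//.
apply: (@le_trans _ _ (\sum_(0 <= k < n) (cmod (a k) * t ^+ k)%:E)%E); last first.
  by apply: nneseries_lim_ge => k _ _; rewrite lee_fin mulr_ge0 ?exprn_ge0 ?cmod_ge0.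
rewrite sumEFin lee_fin big_mkord; apply: le_trans (cmod_sum _ _ _) _.
apply: ler_sum => k _; rewrite cmodM cmod_real ger0_norm ?exprn_ge0//.
by rewrite mulrC.
Qed.

(** The moments decrease, so mu_(n+k) <= mu_k and one summability condition serves every n. *)
Lemma hankel_series_cvg a n :
  cvgn (series (fun k => moment mu k * cmod (a k))) -> cvgn (hankel_series mu a n).
Proof.
move=> ca; apply: (cvg_cplx_series _ ca) => k.
rewrite cmodM cmod_real ger0_norm ?moment_ge0// ler_wpM2r ?cmod_ge0//.
by apply: moment_decr; exact: leq_addl.
Qed.

(** Substitute, in the form of an inequality, for the integral formula of the coefficients: it holds
    for the partial inner sums by [cmod_moment_poly] and passes to the limit by dominated
    convergence, while the factor t^d <= 1 is dropped. It is used with d = 1 for the derivative and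
    with d = 0 for the constant term. *)
Lemma hankel_coef_sum a (q : nat -> cplx R) d M :
  subexp (fun k => cmod (a k)) ->
  cvgn (series (fun k => moment mu k * cmod (a k))) ->
  ((cmod (\sum_(i < M) q i * hankel_coef mu a (i + d)))%:E <=
   2%:E * \int[mu]_(t in I01)
     (cmod (\sum_(i < M) ofreal (t ^+ i) * q i) * cmod (psum a (ofreal t)))%:E)%E.
Proof.
move=> sa ca.
pose Q t := cmod (\sum_(i < M) ofreal (t ^+ i) * q i).
have mQ : measurable_fun I01 Q by exact/cmeas_cmod/cmeas_poly01.
have QG t : I01 t -> 0 <= Q t <= \sum_(i < M) cmod (q i).
  rewrite /= in_itv/= => /andP[t0 t1]; rewrite cmod_ge0/=.
  apply: le_trans (cmod_sum _ _ _) _; apply: ler_sum => i _.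
  rewrite cmodM cmod_real ger0_norm ?exprn_ge0// ler_piMl ?cmod_ge0//.
  by rewrite exprn_ile1// ltW.
have cR := cvg_int_partial sa ca mQ QG.
have cL : (fun n => \sum_(i < M) q i * hankel_series mu a (i + d) n) @ \oo -->
    \sum_(i < M) q i * hankel_coef mu a (i + d).
  apply: cvg_big => [|i _]; first exact: add_continuous.
  apply: cvgM; first exact: cvg_cst.
  exact: hankel_series_cvg.
have cL' : (fun n => (cmod (\sum_(i < M) q i * hankel_series mu a (i + d) n))%:E) @ \oo -->
    (cmod (\sum_(i < M) q i * hankel_coef mu a (i + d)))%:E.
  by apply/fine_cvgP; split; [exact: nearW|exact: cvg_cmod].
apply: (@lee_cvg_to _ _ _ _ _ _ _ _ cL' (cvgeZl _ cR)) => //.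
apply: nearW => n.
(* The double sum is indexed by pairs so that [cmod_moment_poly] applies to it as one finite sum. *)
have -> : \sum_(i < M) q i * hankel_series mu a (i + d) n =
    \sum_(p : 'I_M * 'I_n) ofreal (moment mu (p.1 + d + p.2)) * (q p.1 * a p.2).
  rewrite -(pair_big xpredT xpredT (fun (i : 'I_M) (k : 'I_n) =>
     ofreal (moment mu (i + d + k)) * (q i * a k)))/=; apply: eq_bigr => i _.
  rewrite /hankel_series /series/= big_mkord mulr_sumr; apply: eq_bigr => k _.
  by rewrite mulrCA.
apply: le_trans (cmod_moment_poly _ _ _) _; apply: lee_wpmul2l => //.
apply: ge0_le_integral => //.
- by move=> t _; rewrite lee_fin cmod_ge0.
- by apply/measurable_EFinP; exact/cmeas_cmod/cmeas_poly01.
- apply/measurable_EFinP; apply: measurable_funM => //.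
  exact/cmeas_cmod/cmeas_poly01.
move=> t /=; rewrite in_itv/= => /andP[t0 t1]; rewrite lee_fin /Q.
have -> : \sum_(p : 'I_M * 'I_n) ofreal (t ^+ (p.1 + d + p.2)) * (q p.1 * a p.2) =
   ofreal (t ^+ d) * ((\sum_(i < M) ofreal (t ^+ i) * q i) *
     (\sum_(k < n) ofreal (t ^+ k) * a k)).
  rewrite big_distrlr/= pair_big/= mulr_sumr; apply: eq_bigr => -[i k] _ /=.
  by rewrite !exprD !ofrealM; ring.
rewrite 2!cmodM ler_piMl// ?mulr_ge0 ?cmod_ge0//.
by rewrite cmod_real ger0_norm ?exprn_ge0// exprn_ile1// ltW.
Qed.

End moment_functional.

(** * Partial sums of the expansion of (1 - w)^(-2) *)

Section geometric_kernel.
Context {R : realType}.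
Implicit Types (w : cplx R).

Lemma geom_deriv w M : (1 - w) ^+ 2 * (\sum_(i < M) i.+1%:R * w ^+ i) =
  1 - M.+1%:R * w ^+ M + M%:R * w ^+ M.+1.
Proof.
elim: M => [|M IH]; first by rewrite big_ord0 mulr0 expr0 mul0r addr0 mulr1 subrr.
rewrite big_ord_recr/= mulrDr IH -!natr1 !exprS; ring.
Qed.

(** The correction depends on r and M only, not on w, so it can be taken out of an integral over w =
    t z and removed by letting M tend to infinity. *)
Lemma cmod_geom_deriv w (r : R) M : cmod w <= r -> r < 1 ->
  cmod (\sum_(i < M) i.+1%:R * w ^+ i) <=
  (1 + 2 * (M.+1%:R * r ^+ M)) * (cmod (1 - w) ^+ 2)^-1.
Proof.
move=> wr r1; have w0 := cmod_ge0 w; have r0 := le_trans w0 wr.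
have h0 : 0 < cmod (1 - w).
  by have := cmod_triangle 1 w; rewrite cmod1; lra.
rewrite ler_pdivlMr ?exprn_gt0// -cmodX -cmodM mulrC geom_deriv.
have hM : cmod (M.+1%:R * w ^+ M) <= M.+1%:R * r ^+ M.
  by rewrite cmodM cmod_nat cmodX ler_wpM2l// lerXn2r.
have hM' : cmod (M%:R * w ^+ M.+1) <= M.+1%:R * r ^+ M.
  rewrite cmodM cmod_nat cmodX; apply: ler_pM; rewrite ?exprn_ge0//.
    by rewrite ler_nat.
  apply: (@le_trans _ _ (r ^+ M.+1)); first by rewrite lerXn2r.
  by rewrite exprS ler_piMl ?exprn_ge0// ltW.
apply: le_trans (cmodD _ _) _; apply: le_trans (lerD (cmodB _ _) hM') _.
by rewrite cmod1; lra.
Qed.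

Lemma cvg_natr_geom (r : R) : 0 <= r < 1 -> (fun M => M.+1%:R * r ^+ M) @ \oo --> (0 : R).
Proof.
move=> r01; apply: cvg_series_cvg_0.
have h : subexp (fun=> 1 : R).
  split=> // s /andP[s0 s1]; exists 1 => k.
  by rewrite mul1r exprn_ile1// ltW.
have := subexp_summable (subexp_mulS h) r01.
by under [X in series X]eq_fun do rewrite mulr1.
Qed.

End geometric_kernel.

(** * Estimates for the image under the Hankel operator *)

Section hankel_operator.
Context {R : realType} (mu : {finite_measure set R -> \bar R}).
Local Notation leb := (@lebesgue_measure R).
Local Notation area := (leb \x leb)%E.
Local Notation I01 := (`[0%R, 1%R[%classic : set R).
Implicit Types (a : nat -> cplx R).

Let mI01 : measurable I01. Proof. exact: measurable_itv. Qed.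

Let sub01 : I01 `<=` `]-1, 1[%classic.
Proof. by move=> x /=; rewrite !in_itv/= => /andP[x0 ->]; rewrite andbT; lra. Qed.

Lemma hankel_coef_bounded a :
  cvgn (series (fun k => moment mu k * cmod (a k))) ->
  exists B, forall n, cmod (hankel_coef mu a n) <= B.
Proof.
move=> ca; exists (limn (series (fun k => moment mu k * cmod (a k)))) => n.
have hc : hankel_series mu a n @ \oo --> hankel_coef mu a n :=
  @hankel_series_cvg _ mu a n ca.
apply: (cmod_cvg_le hc) => N.
apply: (@le_trans _ _ (series (fun k => moment mu k * cmod (a k)) N)); last first.
  apply: nondecreasing_cvgn_le => //.
  by apply/nondecreasing_series => k _ _; rewrite mulr_ge0 ?moment_ge0 ?cmod_ge0.
apply: le_trans (cmod_sum _ _ _) _; apply: ler_sum => k _.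
rewrite cmodM cmod_real ger0_norm ?moment_ge0// ler_wpM2r ?cmod_ge0//.
by apply: moment_decr; exact: leq_addl.
Qed.

Lemma subexp_hankel_coef a :
  cvgn (series (fun k => moment mu k * cmod (a k))) ->
  subexp (fun n => cmod (hankel_coef mu a n)).
Proof.
move=> /hankel_coef_bounded[B HB]; split=> [n|r /andP[r0 r1]]; first exact: cmod_ge0.
exists B => n; apply: le_trans (HB n).
by rewrite ler_piMr ?cmod_ge0// exprn_ile1// ltW.
Qed.

Lemma hankel_taylor a :
  cvgn (series (fun k => moment mu k * cmod (a k))) ->
  has_taylor (hankel mu a) (hankel_coef mu a).
Proof. by move=> ca z z1; apply: psum_cvg => //; exact: subexp_hankel_coef. Qed.

Lemma measurable_kernel (z : cplx R) : measurable_fun I01 (fun t : R =>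
  (cmod (1 - ofreal t * z) ^+ 2)^-1).
Proof.
apply: measurable_funTS; apply: measurable_funV; apply: measurable_funX; apply: cmeas_cmod.
have -> : (fun t : R => 1 - ofreal t * z) = (fun t => 1 + ofreal t * (- z)).
  by apply/funext => t; rewrite mulrN.
apply: cmeasD; first exact: cmeas_cst.
by apply: cmeasM; [split; [exact: measurable_id|exact: measurable_cst]|exact: cmeas_cst].
Qed.

(** [hankel_coef_sum] with q_j = (j + 1) z^j and d = 1 treats the partial sums of the derivative,
    [cmod_geom_deriv] brings in the kernel, and the factor 1 + 2 (M + 1) |z|^M tends to 1. *)
Lemma hankel_deriv_le a z : subexp (fun k => cmod (a k)) ->
  cvgn (series (fun k => moment mu k * cmod (a k))) -> cmod z < 1 ->
  ((cmod (psum (dcoef (hankel_coef mu a)) z))%:E <=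
   2%:E * \int[mu]_(t in I01)
     (cmod (psum a (ofreal t)) * (cmod (1 - ofreal t * z) ^+ 2)^-1)%:E)%E.
Proof.
move=> sa ca z1; have z01 : 0 <= cmod z < 1 by rewrite cmod_ge0.
set I := (\int[mu]_(t in I01) _)%E.
have I0 : (0 <= I)%E.
  by apply: integral_ge0 => t _; rewrite lee_fin mulr_ge0 ?invr_ge0 ?exprn_ge0 ?cmod_ge0.
have mI : measurable_fun I01 (fun t : R =>
    (cmod (psum a (ofreal t)) * (cmod (1 - ofreal t * z) ^+ 2)^-1)%:E).
  apply/measurable_EFinP; apply: measurable_funM; first exact: cmod_psum_lt1.
  exact: measurable_kernel.
(* An infinite right-hand side is set apart so that the limit in M can be taken in [R]. *)
have [Ioo|Ifin] := eqVneq I +oo%E.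
  by rewrite Ioo gt0_muley ?leey// lte_fin.
have IE : I = (fine I)%:E by rewrite fineK// ge0_fin_numE// lt_neqAle Ifin leey.
set i := fine I in IE; have i0 : 0 <= i by rewrite -lee_fin -IE.
rewrite IE -EFinM lee_fin.
have part M : cmod (\sum_(j < M) dcoef (hankel_coef mu a) j * z ^+ j) <=
    2 * ((1 + 2 * (M.+1%:R * cmod z ^+ M)) * i).
  have := @hankel_coef_sum R mu a (fun j => j.+1%:R * z ^+ j) 1 M sa ca.
  have -> : \sum_(j < M) j.+1%:R * z ^+ j * hankel_coef mu a (j + 1) =
      \sum_(j < M) dcoef (hankel_coef mu a) j * z ^+ j.
    by apply: eq_bigr => j _; rewrite addn1 /dcoef mulrAC.
  move=> H; rewrite -lee_fin; apply: le_trans H _.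
  rewrite [leRHS]EFinM; apply: lee_wpmul2l; first by rewrite lee_fin.
  have c0 : 0 <= 1 + 2 * (M.+1%:R * cmod z ^+ M).
    by rewrite addr_ge0// !mulr_ge0// exprn_ge0 ?cmod_ge0.
  set c := 1 + 2 * _ in c0 *.
  have -> : (c * i)%:E = (\int[mu]_(t in I01) (c%:E *
      (cmod (psum a (ofreal t)) * (cmod (1 - ofreal t * z) ^+ 2)^-1)%:E))%E.
    rewrite EFinM -IE; apply/esym/ge0_integralZl => //.
    by move=> t _; rewrite lee_fin mulr_ge0 ?invr_ge0 ?exprn_ge0 ?cmod_ge0.
  apply: ge0_le_integral.
  - exact: mI01.
  - by move=> t _; rewrite lee_fin mulr_ge0 ?cmod_ge0.
  - apply/measurable_EFinP; apply: measurable_funM; last exact: cmod_psum_lt1.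
    exact/cmeas_cmod/cmeas_poly01.
  - exact: measurable_funeM.
  move=> t /=; rewrite in_itv/= => /andP[t0 t1].
  rewrite -EFinM lee_fin mulrC mulrCA ler_wpM2l ?cmod_ge0//.
  have -> : \sum_(j < M) ofreal (t ^+ j) * (j.+1%:R * z ^+ j) =
     \sum_(j < M) j.+1%:R * (ofreal t * z) ^+ j.
    by apply: eq_bigr => j _; rewrite mulrCA exprMn ofrealX.
  apply: cmod_geom_deriv => //; rewrite cmodM cmod_real ger0_norm//.
  by rewrite ler_piMl ?cmod_ge0// ltW.
have cL := cvg_cmod (psum_cvg (subexp_dcoef (subexp_hankel_coef ca)) z1).
have cR : (fun M => 2 * ((1 + 2 * (M.+1%:R * cmod z ^+ M)) * i)) @ \oo --> 2 * i.
  have -> : 2 * i = 2 * ((1 + 2 * 0) * i) by rewrite mulr0 addr0 mul1r.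
  apply: cvgM; first exact: cvg_cst.
  apply: cvgM; last exact: cvg_cst.
  apply: cvgD; first exact: cvg_cst.
  apply: cvgM; first exact: cvg_cst.
  exact: cvg_natr_geom.
apply: (ler_cvg_to cL cR); apply: nearW => M.
by rewrite /series/= big_mkord.
Qed.

Lemma D1_normE (al : R) f a : has_taylor f a ->
  D1_norm al f = ((cmod (a 0%N))%:E + ((al + 1) / pi)%:E *
    \int[area]_(q in @disc R) ((1 - nsq q) `^ al * cmod (psum (dcoef a) (zof q)))%:E)%E.
Proof.
move=> fa; have f0 : f 0 = a 0%N.
  by rewrite -[RHS]psum0; apply: taylor_psum => //; rewrite cmod0 ltr01.
rewrite /D1_norm f0.
congr (_ + _ * _)%E; apply: eq_integral => q; rewrite inE => dq.
by rewrite (taylor_derive1 fa)//; exact: nsq_lt1_cmod.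
Qed.

Lemma hankel_dirichlet_le (al : R) : -1 < al < 0 -> exists2 K, 0 < K &
  forall a, subexp (fun k => cmod (a k)) ->
    cvgn (series (fun k => moment mu k * cmod (a k))) ->
  (\int[area]_(q in @disc R) ((1 - nsq q) `^ al *
      cmod (psum (dcoef (hankel_coef mu a)) (zof q)))%:E <=
   K%:E * \int[mu]_(t in I01) (cmod (psum a (ofreal t)) * (1 - t) `^ al)%:E)%E.
Proof.
move=> al01; have [K K0 HK] := @kernel_int R al al01.
exists (2 * K); first by rewrite mulr_gt0.
move=> a sa ca.
have sh := subexp_dcoef (subexp_hankel_coef ca).
pose g (t : R) : R := \1_I01 t * cmod (psum a (ofreal t)).
have mg : measurable_fun setT g by apply: measurable_indicM => //; exact: cmod_psum_lt1.
have g0 t : 0 <= g t by rewrite mulr_ge0 ?cmod_ge0.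
pose W (q : R * R) : R := \1_(@disc R) q * (1 - nsq q) `^ al.
have mW : measurable_fun setT W.
  by apply: measurable_indicM; [exact: measurable_disc|exact: measurable_weight].
have W0 q : 0 <= W q by rewrite mulr_ge0 ?powR_ge0.
pose H (x : (R * R) * R) : R := (cmod (1 - ofreal x.2 * zof x.1) ^+ 2)^-1.
have mH : measurable_fun setT H.
  apply: measurable_funV; apply: measurable_funX; apply: cmeas_cmod.
  have -> : (fun x : (R * R) * R => 1 - ofreal x.2 * zof x.1) =
      (fun x => 1 + (- ofreal x.2) * zof x.1).
    by apply/funext => x; rewrite mulNr.
  apply: cmeasD; first exact: cmeas_cst.
  apply: cmeasM; split => /=.
  - by apply: measurableT_comp => //; exact: measurable_snd.
  - by rewrite oppr0; exact: measurable_cst.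
  - exact: (measurableT_comp measurable_fst measurable_fst).
  - exact: (measurableT_comp measurable_snd measurable_fst).
have H0 x : 0 <= H x by rewrite invr_ge0 exprn_ge0 ?cmod_ge0.
pose Phi (x : (R * R) * R) : \bar R := (W x.1 * (g x.2 * H x))%:E.
have mPhi : measurable_fun setT Phi.
  apply/measurable_EFinP; apply: measurable_funM; first exact: (measurableT_comp mW measurable_fst).
  by apply: measurable_funM; [exact: (measurableT_comp mg measurable_snd)|exact: mH].
have Phi0 x : (0 <= Phi x)%E.
  by rewrite lee_fin; apply: mulr_ge0 => //; exact: mulr_ge0.
have mgH q : measurable_fun setT (fun t : R => (g t * H (q, t))%:E).
  apply/measurable_EFinP; apply: measurable_funM => //.
  exact: (measurableT_comp mH (measurable_pair1 q)).
have mF : measurable_fun setT (fun q : R * R => \int[mu]_t Phi (q, t))%E.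
  exact: (@measurable_fun_fubini_tonelli_F _ _ (measurableTypeR R * measurableTypeR R)%type _ R mu Phi mPhi Phi0).
have mG : measurable_fun setT (fun t : R => \int[area]_q Phi (q, t))%E.
  exact: (@measurable_fun_fubini_tonelli_G _ _ _ (measurableTypeR R) R planar_measure Phi mPhi Phi0).
rewrite int_restrict.
apply: (@le_trans _ _ (\int[area]_q (2%:E * \int[mu]_t Phi (q, t)))%E).
  apply: ge0_le_integral.
  - exact: measurableT.
  - by move=> q _; rewrite lee_fin !mulr_ge0 ?powR_ge0 ?cmod_ge0.
  - apply/measurable_EFinP; apply: measurable_indicM; first exact: measurable_disc.
    by apply: measurable_funM; [exact: measurable_weight|exact: measurable_cmod_psum].
  - exact: measurable_funeM.
  move=> q _; rewrite mulrA -/(W q).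
  have -> : (\int[mu]_t Phi (q, t) = (W q)%:E * \int[mu]_t (g t * H (q, t))%:E)%E.
    rewrite /Phi/=; under eq_integral do rewrite EFinM.
    apply: ge0_integralZl; [exact: measurableT|exact: mgH| |by rewrite lee_fin].
    by move=> t _; rewrite lee_fin mulr_ge0.
  rewrite EFinM muleCA.
  have [dq|dq] := boolP (q \in @disc R); last by rewrite /W indicE (negbTE dq) !mul0r !mul0e.
  apply: lee_wpmul2l; first by rewrite lee_fin.
  move: dq; rewrite inE => dq.
  apply: le_trans (hankel_deriv_le sa ca (nsq_lt1_cmod dq)) _.
  rewrite le_eqVlt; apply/orP; left; apply/eqP; congr (_ * _)%E.
  rewrite integral_mkcond; apply: eq_integral => t _.
  by rewrite /patch /g indicE; case: (t \in I01); rewrite ?mul1r ?mul0r.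
have -> : (\int[area]_q (2%:E * \int[mu]_t Phi (q, t)) = 2%:E * \int[area]_q \int[mu]_t Phi (q, t))%E.
  apply: ge0_integralZl; [exact: measurableT|exact: mF| |by rewrite lee_fin].
  by move=> q _; apply: integral_ge0.
have -> : (\int[area]_q \int[mu]_t Phi (q, t) = \int[mu]_t \int[area]_q Phi (q, t))%E.
  exact: (@fubini_tonelli _ _ _ _ R planar_measure mu Phi mPhi Phi0).
rewrite EFinM -muleA; apply: lee_wpmul2l; first by rewrite lee_fin.
have mp : measurable_fun I01 (fun t : R => (cmod (psum a (ofreal t)) * (1 - t) `^ al)%:E).
  apply/measurable_EFinP; apply: measurable_funM; first exact: cmod_psum_lt1.
  apply: measurable_funTS.
  apply: (@measurableT_comp _ _ _ _ _ _ (fun x : R => x `^ al)); first exact: measurable_powR.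
  exact: measurable_funB.
have -> : (K%:E * \int[mu]_(t in I01) (cmod (psum a (ofreal t)) * (1 - t) `^ al)%:E =
    \int[mu]_(t in I01) (K%:E * (cmod (psum a (ofreal t)) * (1 - t) `^ al)%:E))%E.
  apply/esym/ge0_integralZl; [exact: mI01|exact: mp| |by rewrite lee_fin ltW].
  by move=> t _; rewrite lee_fin mulr_ge0 ?powR_ge0 ?cmod_ge0.
rewrite [leRHS]integral_mkcond; apply: ge0_le_integral.
- exact: measurableT.
- by move=> t _; apply: integral_ge0.
- exact: mG.
- by apply/(measurable_restrictT _ mI01); exact: measurable_funeM.
move=> t _; rewrite /patch.
have -> : (\int[area]_q Phi (q, t) = (g t)%:E * \int[area]_q (W q * H (q, t))%:E)%E.
  rewrite /Phi/=; under eq_integral do rewrite mulrCA EFinM.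
  apply: ge0_integralZl; [exact: measurableT| | |by rewrite lee_fin].
    apply/measurable_EFinP; apply: measurable_funM => //.
    exact: (measurableT_comp mH (measurable_pair2 t)).
  by move=> q _; rewrite lee_fin mulr_ge0.
rewrite /g indicE; case: (boolP (t \in I01)) => [|_]; last by rewrite mul0r mul0e.
rewrite inE/= in_itv/= => t01; rewrite mul1r -EFinM mulrCA EFinM.
apply: lee_wpmul2l; first by rewrite lee_fin cmod_ge0.
have := HK t t01; rewrite int_restrict.
by under eq_integral do rewrite mulrA.
Qed.

(** A single term with d = 0 in [hankel_coef_sum]; the weight is inserted for free because (1 -
    t)^al >= 1 when al <= 0. *)
Lemma hankel_coef0_le (al : R) a : al <= 0 -> subexp (fun k => cmod (a k)) ->
  cvgn (series (fun k => moment mu k * cmod (a k))) ->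
  ((cmod (hankel_coef mu a 0))%:E <= 2%:E *
    \int[mu]_(t in I01) (cmod (psum a (ofreal t)) * (1 - t) `^ al)%:E)%E.
Proof.
move=> al0 sa ca.
have := @hankel_coef_sum R mu a (fun=> 1) 0 1 sa ca.
rewrite big_ord1 mul1r addn0 => H; apply: le_trans H _.
apply: lee_wpmul2l; first by rewrite lee_fin.
apply: ge0_le_integral.
- exact: mI01.
- by move=> t _; rewrite lee_fin mulr_ge0 ?cmod_ge0.
- apply/measurable_EFinP; apply: measurable_funM; last exact: cmod_psum_lt1.
  exact/cmeas_cmod/cmeas_poly01.
- apply/measurable_EFinP; apply: measurable_funM; first exact: cmod_psum_lt1.
  apply: measurable_funTS.
  apply: (@measurableT_comp _ _ _ _ _ _ (fun x : R => x `^ al)); first exact: measurable_powR.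
  exact: measurable_funB.
move=> t /=; rewrite in_itv/= => /andP[t0 t1]; rewrite lee_fin.
rewrite big_ord1 expr0 mulr1 cmod_real normr1 mulrC ler_wpM2l ?cmod_ge0//.
rewrite -[leLHS](_ : 1 `^ al = 1); last by rewrite powR1.
by apply: powR_anti => //; lra.
Qed.

End hankel_operator.

Theorem theorem6 (R : realType) (mu : {finite_measure set R -> \bar R})
    (alpha : R) (mu_supp : mu (~` `[0, 1[) = 0%E)
    (alpha_bnd : -1 < alpha < 0) :
  carleson mu -> hankel_bounded_D1 mu alpha.
Proof.
move=> cmu; have /andP[al1 al0] := alpha_bnd.
have [K1 K10 H1] := mu_embed cmu alpha_bnd.
have [K2 K20 H2] := hankel_dirichlet_le mu alpha_bnd.
have c0 : 0 < (alpha + 1) / pi by rewrite divr_gt0 ?pi_gt0//; lra.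
set c := (alpha + 1) / pi in c0.
have c1 := ltW c0; have K11 := ltW K10; have K21 := ltW K20.
have v1 : 0 <= c^-1 by rewrite invr_ge0.
have cK : 0 <= c * K2 by rewrite mulr_ge0.
(* 2 comes from the constant coefficient of the image, c K2 from its Dirichlet integral and K1 from
   the embedding. The factor 1 + 1/c passes from |a_0| + J to the norm |a_0| + c J. *)
exists ((2 + c * K2) * (K1 * (1 + c^-1))); split.
  by apply: mulr_ge0; [rewrite addr_ge0|rewrite mulr_ge0// addr_ge0].
move=> f a [_ ffin] fa; have sa := taylor_subexp fa.
move: ffin; rewrite (D1_normE alpha fa) -/c.
set J := (\int[_]_(q in _) _)%E => Jfin.
have J0 : (0 <= J)%E.
  by apply: integral_ge0 => q _; rewrite lee_fin mulr_ge0 ?powR_ge0 ?cmod_ge0.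
have Joo : (J < +oo)%E.
  rewrite ltey; apply/negP => /eqP JE.
  by move: Jfin; rewrite JE gt0_muley ?lte_fin// addey// ltxx.
have ca := summable_moments cmu alpha_bnd sa Joo.
have ha := hankel_taylor ca.
set E := (\int[mu]_(t in `[0%R, 1%R[) (cmod (psum a (ofreal t)) * (1 - t) `^ alpha)%:E)%E.
have E0 : (0 <= E)%E.
  by apply: integral_ge0 => t _; rewrite lee_fin mulr_ge0 ?powR_ge0 ?cmod_ge0.
have hE : (D1_norm alpha (hankel mu a) <= (2 + c * K2)%:E * E)%E.
  rewrite (D1_normE alpha ha) -/c EFinD ge0_muleDl ?lee_fin//.
  apply: leeD; first exact: (hankel_coef0_le (ltW al0) sa ca).
  rewrite [(c * K2)%:E]EFinM -muleA; apply: lee_wpmul2l; first by rewrite lee_fin.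
  exact: H2.
have hN : (D1_norm alpha (hankel mu a) <= ((2 + c * K2) * (K1 * (1 + c^-1)))%:E *
    ((cmod (a 0%N))%:E + c%:E * J))%E.
  apply: le_trans hE _; rewrite EFinM -muleA; apply: lee_wpmul2l.
    by rewrite lee_fin addr_ge0.
  apply: le_trans (H1 a sa) _; rewrite -/J EFinM -muleA; apply: lee_wpmul2l.
    by rewrite lee_fin.
  have -> : J = (fine J)%:E by rewrite fineK// ge0_fin_numE.
  have j0 : 0 <= fine J by rewrite fine_ge0.
  change ((cmod (a 0%N) + fine J)%:E <=
    ((1 + c^-1) * (cmod (a 0%N) + c * fine J))%:E)%E.
  rewrite lee_fin mulrDl mul1r mulrDr mulrA (mulVf (lt0r_neq0 c0)) mul1r.
  have : 0 <= c^-1 * cmod (a 0%N) by rewrite mulr_ge0 ?cmod_ge0.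
  have : 0 <= c * fine J by rewrite mulr_ge0.
  lra.
split=> //.
- by split=> // n; exact: hankel_series_cvg.
- split; first by exists (hankel_coef mu a).
  apply: le_lt_trans hN _; have -> : J = (fine J)%:E by rewrite fineK// ge0_fin_numE.
  exact: ltry.
Qed.
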